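(* Let $\mathscr{L}=L^2_{\mathbb{R}}(0,\infty)$ and let $(\Omega,\mathcal{F}_\Omega,\mathbb{P})$ be the standard Wiener probability space. The operators $$\pi(a(k))F=\langle T(F),k\rangle_{\mathscr{L}},\qquad F\in\mathscr{D}_\pi,\ k\in\mathscr{L},$$ i.e. $\pi(a(k))$ is the Malliavin derivative in the direction $k$, define a $*$-representation $\pi:\mathrm{CCR}(\mathscr{L})\to \mathrm{End}(\mathscr{D}_\pi)$ on the dense subspace $\mathscr{D}_\pi$ of $\mathscr{H}_\pi=L^2(\Omega,\mathcal{F}_\Omega,\mathbb{P})$.
   Context: $\mathscr{L}=L^2_{\mathbb{R}}(0,\infty)$ (real Hilbert space). On the standard Wiener space $(\Omega,\mathcal{F}_\Omega,\mathbb{P})$ (continuous paths on $[0,\infty)$, cylinder $\sigma$-algebra, Wiener measure) put $\Phi_t(\omega)=\omega(t)$ and, for $k\in\mathscr{L}$, $\Phi(k)=\int_0^\infty k(t)\,d\Phi_t$ (the Itô/Wiener integral). $L^2$ is the space of real-valued square-integrable functions. $\mathscr{D}_\pi\subset L^2(\Omega,\mathcal{F}_\Omega,\mathbb{P})$ is the subspace of all $F=p(\Phi(h_1),\dots,\Phi(h_n))$ with $n\in\mathbb{N}_0$, $h_1,\dots,h_n\in\mathscr{L}$, $p$ a real polynomial in $n$ variables. The Malliavin derivative is $T(F)=\sum_{j=1}^n\frac{\partial p}{\partial x_j}(\Phi(h_1),\dots,\Phi(h_n))\otimes h_j\in L^2(\Omega,\mathbb{P})\otimes\mathscr{L}$ (independent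 of the representation of $F$), and $\langle T(F),k\rangle_{\mathscr{L}}=\sum_j\frac{\partial p}{\partial x_j}(\Phi(h_1),\dots,\Phi(h_n))\langle h_j,k\rangle_{\mathscr{L}}$. $\mathrm{CCR}(\mathscr{L})$ is the unital $*$-algebra on generators $a(k)$, $a^*(k)=a(k)^*$, $k\in\mathscr{L}$ (linear in $k$), subject to $[a(k),a(l)]=0$ and $[a(k),a^*(l)]=\langle k,l\rangle_{\mathscr{L}}\mathbf{1}$. A ($*$-)representation $\pi$ of $\mathrm{CCR}(\mathscr{L})$ consists of a Hilbert space $\mathscr{H}_\pi$, a dense subspace $\mathscr{D}_\pi\subset\mathscr{H}_\pi$ and a $*$-homomorphism $\pi:\mathrm{CCR}(\mathscr{L})\to\mathrm{End}(\mathscr{D}_\pi)$; in particular, on $\mathscr{D}_\pi$, $[\pi(a(k)),\pi(a(l))]=0$ and $[\pi(a(k)),\pi(a(l))^*]=\langle k,l\rangle_{\mathscr{L}}I$, where $\pi(a^*(l))$ is the restriction to $\mathscr{D}_\pi$ of the Hilbert space adjoint $\pi(a(l))^*$ (so $\mathscr{D}_\pi\subset\mathrm{dom}(\pi(a(l))^* )$). *)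

(* Defs.v *)
From HB Require Import structures.
From mathcomp Require Import all_boot all_order all_algebra.
From mathcomp Require Import all_classical all_reals all_analysis.
From mathcomp Require Import measurable_realfun.
From mathcomp Require mpoly.

Set Implicit Arguments.
Unset Strict Implicit.
Unset Printing Implicit Defensive.
Import Order.TTheory GRing.Theory Num.Theory.
Import numFieldNormedType.Exports.

Local Open Scope classical_set_scope.
Local Open Scope ring_scope.

Section ccr.
Context {R : realFieldType} {L : lmodType R} (dot : {dot L for @idfun R}).

Inductive ccr_term :=
  | ccr_scal of R
  | ccr_ann of L
  | ccr_cre of L
  | ccr_add of ccr_term & ccr_term
  | ccr_mul of ccr_term & ccr_term.

HB.instance Definition _ := gen_eqMixin ccr_term.
HB.instance Definition _ := gen_choiceMixin ccr_term.

(* The least congruence for which the terms form a unital R-algebra satisfying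
   the defining relations; the adjoints of the latter are listed as well, so
   that the involution passes to the quotient.  [ccr_scal c] stands for the
   multiple c 1 of the unit. *)
Inductive ccr_eq : ccr_term -> ccr_term -> Prop :=
  | ccr_refl x : ccr_eq x x
  | ccr_sym x y : ccr_eq x y -> ccr_eq y x
  | ccr_trans y x z : ccr_eq x y -> ccr_eq y z -> ccr_eq x z
  | ccr_cong_add x x' y y' : ccr_eq x x' -> ccr_eq y y' ->
      ccr_eq (ccr_add x y) (ccr_add x' y')
  | ccr_cong_mul x x' y y' : ccr_eq x x' -> ccr_eq y y' ->
      ccr_eq (ccr_mul x y) (ccr_mul x' y')
  | ccr_addA x y z :
      ccr_eq (ccr_add x (ccr_add y z)) (ccr_add (ccr_add x y) z)
  | ccr_addC x y : ccr_eq (ccr_add x y) (ccr_add y x)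
  | ccr_add0 x : ccr_eq (ccr_add (ccr_scal 0) x) x
  | ccr_mulA x y z :
      ccr_eq (ccr_mul x (ccr_mul y z)) (ccr_mul (ccr_mul x y) z)
  | ccr_mul0 x : ccr_eq (ccr_mul (ccr_scal 0) x) (ccr_scal 0)
  | ccr_mul1 x : ccr_eq (ccr_mul (ccr_scal 1) x) x
  | ccr_mulDl x y z :
      ccr_eq (ccr_mul (ccr_add x y) z) (ccr_add (ccr_mul x z) (ccr_mul y z))
  | ccr_mulDr x y z :
      ccr_eq (ccr_mul x (ccr_add y z)) (ccr_add (ccr_mul x y) (ccr_mul x z))
  | ccr_scalD c d :
      ccr_eq (ccr_scal (c + d)) (ccr_add (ccr_scal c) (ccr_scal d))
  | ccr_scalM c d :
      ccr_eq (ccr_scal (c * d)) (ccr_mul (ccr_scal c) (ccr_scal d))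
  | ccr_scalC c x : ccr_eq (ccr_mul (ccr_scal c) x) (ccr_mul x (ccr_scal c))
  | ccr_ann_linear c k l : ccr_eq (ccr_ann (c *: k + l))
      (ccr_add (ccr_mul (ccr_scal c) (ccr_ann k)) (ccr_ann l))
  | ccr_cre_linear c k l : ccr_eq (ccr_cre (c *: k + l))
      (ccr_add (ccr_mul (ccr_scal c) (ccr_cre k)) (ccr_cre l))
  | ccr_annC k l :
      ccr_eq (ccr_mul (ccr_ann k) (ccr_ann l)) (ccr_mul (ccr_ann l) (ccr_ann k))
  | ccr_creC k l :
      ccr_eq (ccr_mul (ccr_cre k) (ccr_cre l)) (ccr_mul (ccr_cre l) (ccr_cre k))
  | ccr_ann_cre k l : ccr_eq (ccr_mul (ccr_ann k) (ccr_cre l))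
      (ccr_add (ccr_mul (ccr_cre l) (ccr_ann k)) (ccr_scal (dot k l))).

Fixpoint ccr_term_star (x : ccr_term) : ccr_term :=
  match x with
  | ccr_scal c => ccr_scal c
  | ccr_ann k => ccr_cre k
  | ccr_cre k => ccr_ann k
  | ccr_add y z => ccr_add (ccr_term_star y) (ccr_term_star z)
  | ccr_mul y z => ccr_mul (ccr_term_star z) (ccr_term_star y)
  end.

Lemma ccr_dotC k l : dot k l = dot l k.
Proof. by rewrite (@hermitian_subproof R L false idfun dot k l) expr0 mul1r. Qed.

Lemma ccr_term_starK : involutive ccr_term_star.
Proof. by elim=> //= [x -> y ->|x -> y ->]. Qed.

Lemma ccr_eq_star x y :
  ccr_eq x y -> ccr_eq (ccr_term_star x) (ccr_term_star y).
Proof.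
elim=> /=; try by constructor.
- by move=> {}y {}x z _ + _; exact: ccr_trans.
- by move=> {}x {}y z; apply: ccr_sym; exact: ccr_mulA.
- by move=> {}x; apply: ccr_trans (ccr_mul0 (ccr_term_star x));
    apply: ccr_sym; exact: ccr_scalC.
- by move=> {}x; apply: ccr_trans (ccr_mul1 (ccr_term_star x));
    apply: ccr_sym; exact: ccr_scalC.
- move=> c d; rewrite mulrC; exact: ccr_scalM.
- by move=> c {}x; apply: ccr_sym; exact: ccr_scalC.
- move=> c k l; apply: ccr_trans (ccr_cre_linear _ _ _) _.
  by apply: ccr_cong_add; [exact: ccr_scalC|exact: ccr_refl].
- move=> c k l; apply: ccr_trans (ccr_ann_linear _ _ _) _.
  by apply: ccr_cong_add; [exact: ccr_scalC|exact: ccr_refl].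
- by move=> k l; rewrite ccr_dotC; exact: ccr_ann_cre.
Qed.

Let ccr_equiv (x y : ccr_term) := `[< ccr_eq x y >].

Let ccr_equiv_refl : reflexive ccr_equiv.
Proof. by move=> x; apply/asboolP; exact: ccr_refl. Qed.

Let ccr_equiv_sym : symmetric ccr_equiv.
Proof. by move=> x y; apply/asboolP/asboolP; exact: ccr_sym. Qed.

Let ccr_equiv_trans : transitive ccr_equiv.
Proof.
by move=> y x z /asboolP xy /asboolP yz; apply/asboolP/(ccr_trans xy yz).
Qed.

Canonical ccr_equiv_rel :=
  EquivRel ccr_equiv ccr_equiv_refl ccr_equiv_sym ccr_equiv_trans.

Local Open Scope quotient_scope.

Definition CCR : Type := {eq_quot ccr_equiv}.
HB.instance Definition _ := Choice.on CCR.
HB.instance Definition _ := EqQuotient.on CCR.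

Lemma ccr_pi_eq x y : ccr_eq x y -> \pi_CCR x = \pi_CCR y.
Proof. by move=> xy; apply/eqmodP/asboolP. Qed.

Lemma ccr_repr_eq x : ccr_eq (repr (\pi_CCR x)) x.
Proof. by have /eqmodP/asboolP : repr (\pi_CCR x) = x %[mod CCR] by rewrite reprK. Qed.

Let cadd (x y : CCR) : CCR := \pi_CCR (ccr_add (repr x) (repr y)).
Let cmul (x y : CCR) : CCR := \pi_CCR (ccr_mul (repr x) (repr y)).
Let cscal (c : R) : CCR := \pi_CCR (ccr_scal c).
Let copp (x : CCR) : CCR := cmul (cscal (-1)) x.
Let cscale (c : R) (x : CCR) : CCR := cmul (cscal c) x.
Let cstar (x : CCR) : CCR := \pi_CCR (ccr_term_star (repr x)).

Let pi_add x y : cadd (\pi_CCR x) (\pi_CCR y) = \pi_CCR (ccr_add x y).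
Proof. by apply: ccr_pi_eq; apply: ccr_cong_add; exact: ccr_repr_eq. Qed.

Let pi_mul x y : cmul (\pi_CCR x) (\pi_CCR y) = \pi_CCR (ccr_mul x y).
Proof. by apply: ccr_pi_eq; apply: ccr_cong_mul; exact: ccr_repr_eq. Qed.

Let pi_star x : cstar (\pi_CCR x) = \pi_CCR (ccr_term_star x).
Proof. by apply: ccr_pi_eq; apply: ccr_eq_star; exact: ccr_repr_eq. Qed.

Let piW (P : CCR -> Prop) : (forall x, P (\pi_CCR x)) -> forall x, P x.
Proof. by move=> H x; rewrite -[x]reprK. Qed.

Let caddA : associative cadd.
Proof.
elim/piW => x; elim/piW => y; elim/piW => z.
by rewrite !pi_add; apply: ccr_pi_eq; exact: ccr_addA.
Qed.

Let caddC : commutative cadd.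
Proof.
by elim/piW => x; elim/piW => y; rewrite !pi_add; apply: ccr_pi_eq; exact: ccr_addC.
Qed.

Let cadd0 : left_id (cscal 0) cadd.
Proof. by elim/piW => x; rewrite pi_add; apply: ccr_pi_eq; exact: ccr_add0. Qed.

Let cmulA : associative cmul.
Proof.
elim/piW => x; elim/piW => y; elim/piW => z.
by rewrite !pi_mul; apply: ccr_pi_eq; exact: ccr_mulA.
Qed.

Let cmul1 : left_id (cscal 1) cmul.
Proof. by elim/piW => x; rewrite pi_mul; apply: ccr_pi_eq; exact: ccr_mul1. Qed.

Let cscalC c x : cmul (cscal c) x = cmul x (cscal c).
Proof.
by elim/piW: x => x; rewrite !pi_mul; apply: ccr_pi_eq; exact: ccr_scalC.
Qed.

Let cmulr1 : right_id (cscal 1) cmul.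
Proof. by move=> x; rewrite -cscalC cmul1. Qed.

Let cmulDl : left_distributive cmul cadd.
Proof.
elim/piW => x; elim/piW => y; elim/piW => z.
by rewrite !(pi_mul, pi_add); apply: ccr_pi_eq; exact: ccr_mulDl.
Qed.

Let cmulDr : right_distributive cmul cadd.
Proof.
elim/piW => x; elim/piW => y; elim/piW => z.
by rewrite !(pi_mul, pi_add); apply: ccr_pi_eq; exact: ccr_mulDr.
Qed.

Let cscalD c d : cscal (c + d) = cadd (cscal c) (cscal d).
Proof. by rewrite pi_add; apply: ccr_pi_eq; exact: ccr_scalD. Qed.

Let cscalM c d : cscal (c * d) = cmul (cscal c) (cscal d).
Proof. by rewrite pi_mul; apply: ccr_pi_eq; exact: ccr_scalM. Qed.

Let cmul0 x : cmul (cscal 0) x = cscal 0.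
Proof. by elim/piW: x => x; rewrite pi_mul; apply: ccr_pi_eq; exact: ccr_mul0. Qed.

Let caddN : left_inverse (cscal 0) copp cadd.
Proof.
by move=> x; rewrite /copp -{2}[x]cmul1 -cmulDl -cscalD addNr cmul0.
Qed.

HB.instance Definition _ := GRing.isZmodule.Build CCR caddA caddC cadd0 caddN.
HB.instance Definition _ :=
  GRing.Zmodule_isPzRing.Build CCR cmulA cmul1 cmulr1 cmulDl cmulDr.

Lemma ccr_piD x y : \pi_CCR (ccr_add x y) = \pi_CCR x + \pi_CCR y.
Proof. exact/esym/pi_add. Qed.

Lemma ccr_piM x y : \pi_CCR (ccr_mul x y) = \pi_CCR x * \pi_CCR y.
Proof. exact/esym/pi_mul. Qed.

Let cscaleA c d x : cscale c (cscale d x) = cscale (c * d) x.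
Proof. by rewrite /cscale cmulA cscalM. Qed.

Let cscaleDl x : {morph cscale^~ x : c d / c + d}.
Proof. by move=> c d; rewrite /cscale cscalD cmulDl. Qed.

HB.instance Definition _ :=
  GRing.Zmodule_isLmodule.Build R CCR cscaleA cmul1 (fun c => cmulDr (cscal c)) cscaleDl.

Lemma ccr_pi_scal c : \pi_CCR (ccr_scal c) = c *: (1 : CCR).
Proof. exact/esym/cmulr1. Qed.

Definition ccr_star (x : CCR) : CCR := cstar x.

(* With the two instances above, the next five facts make CCR a real unital
   *-algebra (the library has no structure for algebras that may be trivial). *)
Lemma ccr_scalerAl (c : R) (x y : CCR) : c *: (x * y) = (c *: x) * y.
Proof. exact: cmulA. Qed.

Lemma ccr_scalerAr (c : R) (x y : CCR) : c *: (x * y) = x * (c *: y).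
Proof.
by rewrite [LHS]cmulA cscalC -[LHS]cmulA.
Qed.

Lemma ccr_starM (x y : CCR) : ccr_star (x * y) = ccr_star y * ccr_star x.
Proof.
rewrite /ccr_star.
elim/piW: x => x; elim/piW: y => y.
by rewrite [\pi_CCR x * \pi_CCR y]pi_mul !pi_star [RHS]pi_mul.
Qed.

Lemma ccr_star_linear (c : R) (x y : CCR) :
  ccr_star (c *: x + y) = c *: ccr_star x + ccr_star y.
Proof.
rewrite /ccr_star.
elim/piW: x => x; elim/piW: y => y.
rewrite [c *: \pi_CCR x]pi_mul [_ + \pi_CCR y]pi_add !pi_star.
rewrite [c *: _]pi_mul [RHS]pi_add.
apply: ccr_pi_eq; apply: ccr_cong_add; last exact: ccr_refl.
by apply: ccr_sym; exact: ccr_scalC.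
Qed.

Lemma ccr_starK : involutive ccr_star.
Proof. by rewrite /ccr_star; elim/piW => x; rewrite !pi_star ccr_term_starK. Qed.

Definition annihilation (k : L) : CCR := \pi_CCR (ccr_ann k).
Definition creation (k : L) : CCR := \pi_CCR (ccr_cre k).

Lemma ccr_star_annihilation k : ccr_star (annihilation k) = creation k.
Proof. exact: pi_star. Qed.

End ccr.
Arguments CCR {R L} dot.
Arguments annihilation {R L} dot k.

Section representation.
Context {R : realFieldType} {H : lmodType R} (dot : {dot H for @idfun R}).

Definition hilbert_space : Prop :=
  forall u : nat -> H,
    (forall e : R, 0 < e -> exists N : nat, forall m n : nat,
      (N <= m)%N -> (N <= n)%N -> dot (u m - u n) (u m - u n) < e) ->
    exists l : H, forall e : R, 0 < e -> exists N : nat, forall n : nat,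
      (N <= n)%N -> dot (u n - l) (u n - l) < e.

Definition linear_subspace (D : set H) : Prop :=
  D 0 /\ forall (c : R) (F G : H), D F -> D G -> D (c *: F + G).

Definition dense_subspace (D : set H) : Prop :=
  linear_subspace D /\
  forall (F : H) (e : R), 0 < e -> exists2 G, D G & dot (F - G) (F - G) < e.

(* [T] is only meaningful on [D]. *)
Definition endomorphism (D : set H) (T : H -> H) : Prop :=
  (forall F, D F -> D (T F)) /\
  forall (c : R) (F G : H), D F -> D G -> T (c *: F + G) = c *: T F + T G.

(* [G] lies in the domain of the Hilbert space adjoint of the operator [T]
   with domain [D], and the adjoint maps [G] to [G']. *)
Definition adjoint_at (D : set H) (T : H -> H) (G G' : H) : Prop :=
  forall F, D F -> dot (T F) G = dot F G'.

(* [pi] is a *-homomorphism from CCR(L) to the algebra of endomorphisms of the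
   dense subspace [D] of the Hilbert space [H]. *)
Record star_representation {L : lmodType R} (dotL : {dot L for @idfun R})
    (D : set H) (pi : CCR dotL -> H -> H) : Prop := {
  rep_hilbert : hilbert_space;
  rep_dense : dense_subspace D;
  rep_end : forall x, endomorphism D (pi x);
  rep_linear : forall (c : R) (x y : CCR dotL) F, D F ->
    pi (c *: x + y) F = c *: pi x F + pi y F;
  rep_one : forall F, D F -> pi 1 F = F;
  rep_mul : forall (x y : CCR dotL) F, D F -> pi (x * y) F = pi x (pi y F);
  rep_star : forall (x : CCR dotL) G, D G ->
    adjoint_at D (pi x) G (pi (ccr_star x) G)
}.

End representation.
Arguments star_representation {R H} dot {L dotL} D pi.

Section L2.
Context {d} {T : measurableType d} {R : realType}.
Variable mu : {measure set T -> \bar R}.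

Local Notation V := (LfunType mu (lee1n 2)).

Definition ae_null : {pred V} := fun f => `[< (f : T -> R) = cst 0 %[ae mu] >].

Lemma ae_nullB (f g : V) :
  (f - g \in ae_null) <-> (f : T -> R) = g %[ae mu].
Proof.
split => [/asboolP fg|fg]; last apply/asboolP; apply: filterS fg => t /= fg /fg.
  by move/eqP; rewrite subr_eq0 => /eqP.
by move=> e; rewrite -[LHS]/(f t - g t) e subrr.
Qed.

Let ae_null_zmod : zmod_closed ae_null.
Proof.
split; first by apply/asboolP; exact: ae_eq_refl.
move=> f g /asboolP f0 /asboolP g0; apply/ae_nullB.
exact: ae_eq_trans f0 (ae_eq_sym g0).
Qed.

HB.instance Definition _ := GRing.isZmodClosed.Build V ae_null ae_null_zmod.

Definition L2 : Type := Quotient.quot ae_null.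
HB.instance Definition _ := Choice.on L2.
HB.instance Definition _ := GRing.Zmodule.on L2.
HB.instance Definition _ := EqQuotient.on L2.
HB.instance Definition _ := ZmodQuotient.on L2.

Local Open Scope quotient_scope.

Definition L2_fun (f : L2) : T -> R := (repr f : V).
Coercion L2_fun : L2 >-> Funclass.

Definition L2_class (f : V) : L2 := \pi_L2 f.

Lemma L2_classE (f g : V) : L2_class f = L2_class g <-> (f : T -> R) = g %[ae mu].
Proof.
split=> [/eqmodP|fg]; first by rewrite /= Quotient.equivE => /ae_nullB.
by apply/eqmodP; rewrite /= Quotient.equivE; apply/ae_nullB.
Qed.

Lemma L2_classK (f : V) : L2_fun (L2_class f) = f %[ae mu].
Proof. by apply/L2_classE; rewrite /L2_class reprK. Qed.

Lemma L2_reprK (f : L2) : L2_class (repr f) = f. Proof. exact: reprK. Qed.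

Lemma L2P (f g : L2) : L2_fun f = g %[ae mu] -> f = g.
Proof. by move=> /L2_classE; rewrite !L2_reprK. Qed.

Lemma L2_Lfun (f : L2) : L2_fun f \in Lfun mu 2%:E.
Proof. exact: LfunP. Qed.

Let scale (c : R) (f : L2) : L2 := L2_class (c *: (repr f : V)).

Let scaleE c (f : L2) : L2_fun (scale c f) = (fun t => c * f t) %[ae mu].
Proof. exact: L2_classK. Qed.

Lemma L2_addE (f g : L2) : L2_fun (f + g) = (fun t => f t + g t) %[ae mu].
Proof.
have -> : f + g = L2_class (repr f + repr g) 
  by rewrite -{1}[f]L2_reprK -{1}[g]L2_reprK; exact/esym/raddfD.
exact: L2_classK.
Qed.

Let scaleA c e f : scale c (scale e f) = scale (c * e) f.
Proof.
apply: L2P; apply: ae_eq_trans (scaleE _ _) _.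
apply: ae_eq_trans _ (ae_eq_sym (scaleE _ _)).
by apply: filterS (scaleE e f) => t /= h _; rewrite h// mulrA.
Qed.

Let scale1 : left_id 1 scale.
Proof.
move=> f; apply: L2P; apply: ae_eq_trans (scaleE _ _) _.
by apply/aeW => t _ /=; rewrite mul1r.
Qed.

Let scaleDr : right_distributive scale +%R.
Proof.
move=> c f g; apply: L2P; apply: ae_eq_trans (scaleE _ _) _.
apply: ae_eq_trans _ (ae_eq_sym (L2_addE _ _)).
apply: filterS3 (L2_addE f g) (scaleE c f) (scaleE c g) => t /= h hf hg _.
by rewrite h// hf// hg// mulrDr.
Qed.

Let scaleDl f : {morph scale^~ f : c e / c + e}.
Proof.
move=> c e; apply: L2P; apply: ae_eq_trans (scaleE _ _) _.
apply: ae_eq_trans _ (ae_eq_sym (L2_addE _ _)).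
apply: filterS2 (scaleE c f) (scaleE e f) => t /= hc he _.
by rewrite hc// he// mulrDl.
Qed.

HB.instance Definition _ :=
  GRing.Zmodule_isLmodule.Build R L2 scaleA scale1 scaleDr scaleDl.

Lemma L2_scaleE c (f : L2) : L2_fun (c *: f) = (fun t => c * f t) %[ae mu].
Proof. exact: scaleE. Qed.

Definition L2_dot (f g : L2) : R := \int[mu]_x (f x * g x).

Lemma L2_integrable (f g : L2) :
  mu.-integrable setT (EFin \o (fun t => f t * g t)).
Proof.
by apply/Lfun1_integrable; apply: Lfun2_mul_Lfun1; exact: L2_Lfun.
Qed.

Lemma L2_dotC f g : L2_dot f g = L2_dot g f.
Proof. by apply: eq_Rintegral => t _; rewrite mulrC. Qed.

Lemma L2_dot_linear c f g h :
  L2_dot (c *: f + g) h = c * L2_dot f h + L2_dot g h.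
Proof.
rewrite /L2_dot -RintegralZl//; last exact: L2_integrable.
rewrite -RintegralD//; last 2 first.
- by have := integrableZl measurableT c (L2_integrable f h).
- exact: L2_integrable.
congr fine; apply: ae_eq_integral => //.
- by have /integrableP[] := L2_integrable (c *: f + g) h.
- apply/measurable_EFinP/measurable_funD; last first.
    by have /integrableP[/measurable_EFinP] := L2_integrable g h.
  apply: measurable_funM => //.
  by have /integrableP[/measurable_EFinP] := L2_integrable f h.
apply: filterS2 (L2_addE (c *: f) g) (L2_scaleE c f) => t /= h1 h2 _.
by rewrite h1// h2// mulrDl mulrA.
Qed.

Let L2_dot_bilinear : bilinear_for
  ( *%R : GRing.Scale.law R R) ((@idfun R) \; *%R : GRing.Scale.law R R) L2_dot.
Proof.
split=> h c f g; first exact: L2_dot_linear.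
by rewrite /= ![L2_dot h _]L2_dotC L2_dot_linear.
Qed.

HB.instance Definition _ := bilinear_isBilinear.Build R L2 L2 R
  ( *%R : GRing.Scale.law R R) ((@idfun R) \; *%R : GRing.Scale.law R R)
  L2_dot L2_dot_bilinear.

Let L2_dot_hermitian f g : L2_dot f g = (-1) ^+ false * idfun (L2_dot g f).
Proof. by rewrite expr0 mul1r L2_dotC. Qed.

HB.instance Definition _ := isHermitianSesquilinear.Build R L2 false (@idfun R)
  L2_dot L2_dot_hermitian.

Let L2_dot_gt0 (f : L2) : f != 0 -> 0 < L2_dot f f.
Proof.
move=> f0; rewrite lt_neqAle Rintegral_ge0 ?andbT; last first.
  by move=> t _; rewrite -expr2 sqr_ge0.
apply: contra_neq f0 => f0; apply: L2P.
have : (\int[mu]_x `|((f x * f x)%:E : \bar R)| = 0)%E.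
  have := fineK (integrable_fin_num measurableT (L2_integrable f f)).
  rewrite -[fine _]/(L2_dot f f) -f0 => fE; rewrite [RHS]fE.
  by apply: eq_integral => t _; rewrite gee0_abs// lee_fin -expr2 sqr_ge0.
have /integrableP[mff _] := L2_integrable f f.
move/(ae_eq_integral_abs mu measurableT mff) => ff0.
have z : L2_fun 0 = cst 0 %[ae mu].
  have -> : 0 = L2_class 0 by exact/esym/raddf0.
  exact: L2_classK.
apply: ae_eq_trans _ (ae_eq_sym z); apply: filterS ff0 => t /= ff0 tT.
by have /eqP := ff0 tT; rewrite eqe mulf_eq0 orbb => /eqP.
Qed.

HB.instance Definition _ := isDotProduct.Build R L2 L2_dot L2_dot_gt0.

End L2.
Arguments L2_dot {d T R} mu f g.

Definition half_line (R : realType) : Type := (`[0%R, +oo[%classic : set R).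
HB.instance Definition _ (R : realType) := Topological.on (half_line R).

Definition time {R : realType} (t : half_line R) : R := \val t.

Fact zero_half_line (R : realType) : (0 : R) \in `[0%R, +oo[%classic.
Proof. by apply/mem_set; rewrite /= in_itv /= lexx. Qed.

Definition time0 {R : realType} : half_line R := exist _ 0 (zero_half_line R).

Definition path_type (R : realType) : Type := continuousType (half_line R) R.
HB.instance Definition _ (R : realType) := Choice.on (path_type R).
HB.instance Definition _ (R : realType) :=
  isPointed.Build (path_type R) (cst 0 : continuousType (half_line R) R).

Definition coordinate {R : realType} (t : half_line R) (w : path_type R) : R :=
  (w : continuousType (half_line R) R) t.

Definition cylinders (R : realType) : set (set (path_type R)) :=
  [set A | exists (t : half_line R) (B : set R),
    measurable B /\ A = coordinate t @^-1` B].

Definition wiener_space (R : realType) := g_sigma_algebraType (@cylinders R).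
HB.instance Definition _ (R : realType) := Measurable.on (wiener_space R).

Section wiener.
Context {R : realType}.
Local Notation Omega := (wiener_space R).

(* The increments along a finite increasing sequence of times are independent,
   and w(t) - w(s) is centred Gaussian of variance t - s; the second parameter
   of [normal_prob] is the standard deviation. *)
Definition is_wiener_measure (P : probability Omega R) : Prop :=
  P [set w : Omega | coordinate time0 w = 0] = 1%E /\
  forall (n : nat) (t : nat -> half_line R) (B : nat -> set R),
    (forall i, (i < n)%N -> time (t i) < time (t i.+1)) ->
    (forall i, measurable (B i)) ->
    P [set w : Omega | forall i, (i < n)%N ->
         B i (coordinate (t i.+1) w - coordinate (t i) w)] =
    (\prod_(i < n)
       normal_prob 0 (Num.sqrt (time (t i.+1) - time (t i))) (B i))%E.

Definition halfline_measure : {measure set (measurableTypeR R) -> \bar R} :=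
  mrestr (@lebesgue_measure R) (measurable_itv `]0%R, +oo[).

Local Notation LL := (L2 halfline_measure).

(* A list of pairs (c, t) encodes the step function sum c 1_]0, t]; these are
   all the step functions, as 1_]s, t] = 1_]0, t] - 1_]0, s]. *)
Definition step_fun (s : seq (R * half_line R)) (x : R) : R :=
  \sum_(ct <- s) ct.1 * \1_(`]0%R, time ct.2]%classic : set R) x.

Definition step_integral (s : seq (R * half_line R)) (w : Omega) : R :=
  \sum_(ct <- s) ct.1 * (coordinate ct.2 w - coordinate time0 w).

Variable P : probability Omega R.

Definition is_wiener_integral (k : LL) (X : L2 P) : Prop :=
  exists s : nat -> seq (R * half_line R),
    Lnorm halfline_measure 2%:E (fun x => (step_fun (s n) x - k x)%:E)
      @[n --> \oo] --> 0%E /\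
    Lnorm P 2%:E (fun w => (step_integral (s n) w - X w)%:E)
      @[n --> \oo] --> 0%E.

(* Phi(k), as the limit in L^2(P) of the integrals of step functions that
   converge to k. *)
Definition wiener_integral (k : LL) : L2 P :=
  xget 0 [set X | is_wiener_integral k X].

Definition poly_functional (n : nat) (h : 'I_n -> LL) (p : mpoly.mpoly n R)
    (w : Omega) : R :=
  mpoly.meval (fun j => wiener_integral (h j) w) p.

Definition polynomial_domain : set (L2 P) :=
  [set F | exists (n : nat) (h : 'I_n -> LL) (p : mpoly.mpoly n R),
    L2_fun F = poly_functional h p %[ae P]].

(* T(F) is an element of the tensor product of L^2(P) and L^2(0, oo), here seen
   as a function on the Wiener space with values in L^2(0, oo), obtained from
   some representation of F. *)
Definition is_malliavin_derivative (F : L2 P) (TF : Omega -> LL) : Prop :=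
  exists (n : nat) (h : 'I_n -> LL) (p : mpoly.mpoly n R),
    L2_fun F = poly_functional h p %[ae P] /\
    TF = fun w => \sum_(j < n) poly_functional h (mpoly.mderiv j p) w *: h j.

End wiener.
Arguments halfline_measure : clear implicits.
Arguments polynomial_domain {R} P _.
Arguments poly_functional {R} P {n} h p w.

(* Main.v *)
(* Approximation by step functions gives the Laplace transform
   E exp Phi(k) = exp (|k|^2 / 2) for all k; everything else is deduced from this
   formula, from the a.e. linearity of Phi and from the fact that the Phi(k)
   generate the sigma-algebra up to null sets.

   Integration by parts: for all g,
     E ((Phi(k) - <g, k>) f exp Phi(g)) = E (D_k f exp Phi(g)).
   For f = 1 this is the derivative of the Laplace transform, and differentiating
   in g in the direction h replaces f by f Phi(h), so it holds for polynomials.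
   Hence a(k) = D_k has the adjoint f |-> Phi(k) f - D_k f on polynomials, the
   derivative of a polynomial depends only on its a.e. class, and the relations of
   the algebra reduce to the Leibniz rule and the symmetry of second derivatives.

   Density: let C be the closure of the polynomials in L^2.  The functions
   sin (c Phi(h) + b) are bounded multipliers of C, since their Taylor sums applied
   to a polynomial are dominated by exponentials.  Bounded pointwise limits of
   multipliers are multipliers; so are then the indicators of {Phi(h) > b}, and the
   sets whose indicator is a multiplier form a sigma-algebra.  Therefore all
   bounded measurable functions multiply 1 into C, which is dense. *)

Require Import Defs.
From mathcomp Require Import all_boot all_order all_algebra.
From mathcomp Require Import all_classical all_reals all_analysis.
From mathcomp Require Import measurable_realfun.
From mathcomp Require Import ring lra.
From mathcomp Require mpoly.
Import Order.TTheory GRing.Theory Num.Theory.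
Import numFieldNormedType.Exports.
Set Implicit Arguments.
Unset Strict Implicit.
Unset Printing Implicit Defensive.
Local Open Scope classical_set_scope.
Local Open Scope ring_scope.

(** The Wiener integral is an L^2 class obtained by a limit, so what is known of Phi holds up to
    null sets: Phi(c k + l) is a linear combination only almost everywhere, and the exceptional set
    depends on k and l. The analysis therefore runs on plain functions and their square integral
    [energy], and classes return only when the operators are built. Squares of norms satisfy (a +
    b)^2 <= 2 a^2 + 2 b^2 in place of the triangle inequality, which explains the factors 32 and 256
    below. Differentiation of an expectation in a parameter t takes the form of a first-order
    expansion with remainder at most C t^2 for |t| <= 1; two expansions of the same function then
    have the same linear coefficient ([quadratic_vanish]). In the density argument polynomials are
    unbounded and cannot be multipliers. The sine is chosen because it is bounded while its Taylor
    sums are polynomials. Its sign is a limit of polynomials in it, so indicators stay within reach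
    of the algebra of multipliers. *)

Lemma geometric_nneseries_lty (R : realType) (z : R) : 0 <= z < 1 ->
  (\sum_(n <oo) (z ^+ n)%:E < +oo)%E.
Proof.
move=> /andP[z0 z1]; apply: le_lt_trans (ltry ((1 - z)^-1)).
apply: lime_le.
  by apply: is_cvg_nneseries => n _ _; rewrite lee_fin exprn_ge0.
apply: nearW => n; rewrite sumEFin lee_fin.
rewrite -(mul1r (1 - z)^-1) -[X in X <= _]/(series (fun n => z ^+ n) n).
rewrite (_ : (fun n => z ^+ n) = geometric 1 z); last first.
  by apply/funext => k /=; rewrite mul1r.
rewrite geometric_seriesE ?lt_eqF// !mul1r -[leRHS]mul1r ler_pM2r ?invr_gt0 ?subr_gt0//.
by rewrite mul1r gerBl exprn_ge0.
Qed.

Lemma cvge0_lt (R : realType) (u : nat -> \bar R) : u @ \oo --> 0%E ->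
  forall e : R, 0 < e -> exists N, forall n, (N <= n)%N -> (u n < e%:E)%E.
Proof.
move=> u0 e e0; have : (0 < e%:E :> \bar R)%E by rewrite lte_fin.
by move=> /open_ereal_lt'/u0[N _ NP]; exists N => n Nn; exact: NP.
Qed.

(** * Closed subspaces of L^2 and their bounded multipliers *)

Section energy.
Context {d} {T : measurableType d} {R : realType}.
Variable mu : {measure set T -> \bar R}.
Implicit Types (f g h : T -> R) (c : R).

(** The squared L^2 norm with values in the extended reals, so that the estimates below require
    measurability but not finiteness. *)
Definition energy f : \bar R := (\int[mu]_x ((f x) ^+ 2)%:E)%E.

Definition sqint f := measurable_fun setT f /\ (energy f < +oo)%E.

Lemma energy_ge0 f : (0 <= energy f)%E.
Proof. by apply: integral_ge0 => x _; rewrite lee_fin sqr_ge0. Qed.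

Lemma measurable_sqr f : measurable_fun setT f ->
  measurable_fun setT (fun x => ((f x) ^+ 2)%:E).
Proof. by move=> mf; apply/measurable_EFinP; exact: measurable_funX. Qed.

Lemma sqintP f : f \in Lfun mu 2%:E <-> sqint f.
Proof.
split.
  move=> /[dup] /Lfun2_integrable_sqr/integrableP[_ fi].
  rewrite inE => /andP[/[!inE] mf _]; split=> //.
  apply: le_lt_trans fi; apply: ge0_le_integral => //.
  - by move=> x _; rewrite lee_fin sqr_ge0.
  - exact: measurable_sqr.
  - by apply: measurableT_comp => //; exact: measurable_sqr.
  - by move=> x _ /=; rewrite lee_fin ler_norm.
move=> [mf fi]; rewrite inE; apply/andP; split; rewrite inE//=.
rewrite /finite_norm unlock poweR_lty//.
apply: le_lt_trans fi; apply: ge0_le_integral => //.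
- by move=> x _; rewrite lee_fin powR_ge0.
- apply/measurable_EFinP; apply: (measurableT_comp (measurable_powR _)) => //.
  exact: measurableT_comp.
- exact: measurable_sqr.
- by move=> x _ /=; rewrite lee_fin powR_mulrn// -normrX ger0_norm// sqr_ge0.
Qed.

Lemma energy_le f g : measurable_fun setT f -> measurable_fun setT g ->
  (forall x, `|f x| <= `|g x|) -> (energy f <= energy g)%E.
Proof.
move=> mf mg fg; apply: ge0_le_integral => //.
- by move=> x _; rewrite lee_fin sqr_ge0.
- exact: measurable_sqr.
- exact: measurable_sqr.
- by move=> x _; rewrite lee_fin -[f x ^+ 2]real_normK ?num_real// -[g x ^+ 2]real_normK ?num_real// lerXn2r ?nnegrE.
Qed.

Lemma sqint_le f g : measurable_fun setT f -> sqint g ->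
  (forall x, `|f x| <= `|g x|) -> sqint f.
Proof.
move=> mf [mg gi] fg; split=> //; apply: le_lt_trans gi; exact: energy_le.
Qed.

Lemma energyZ c f : measurable_fun setT f ->
  energy (fun x => c * f x) = ((c ^+ 2)%:E * energy f)%E.
Proof.
move=> mf; rewrite /energy -ge0_integralZl_EFin ?sqr_ge0//.
- by apply: eq_integral => x _; rewrite exprMn EFinM.
- by move=> x _; rewrite lee_fin sqr_ge0.
- exact: measurable_sqr.
Qed.

(** The pointwise bound (a + b)^2 <= 2 a^2 + 2 b^2, which plays the part of the triangle inequality
    throughout. *)
Lemma energyD f g : measurable_fun setT f -> measurable_fun setT g ->
  (energy (fun x => (f x + g x)%R) <= 2%:E * energy f + 2%:E * energy g)%E.
Proof.
move=> mf mg; rewrite -!ge0_integralZl_EFin//; do ?[exact: measurable_sqr|by move=> x _; rewrite lee_fin sqr_ge0].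
have m2 h : measurable_fun setT h -> measurable_fun setT (fun x => 2%:E * (h x ^+ 2)%:E)%E.
  by move=> mh; apply: emeasurable_funM => //; exact: measurable_sqr.
rewrite -ge0_integralD//; do ?[exact: m2|by move=> x _; rewrite -EFinM lee_fin mulr_ge0 ?sqr_ge0].
apply: ge0_le_integral => //.
- by move=> x _; rewrite lee_fin sqr_ge0.
- by apply: measurable_sqr; exact: measurable_funD.
- by apply: emeasurable_funD; exact: m2.
- move=> x _; rewrite -!EFinM -EFinD lee_fin.
  by have := sqr_ge0 (f x - g x); rewrite sqrrB sqrrD => ?; lra.
Qed.

Lemma energyN f : energy (fun x => - f x) = energy f.
Proof. by apply: eq_integral => x _; rewrite sqrrN. Qed.

Lemma energyB f g : energy (fun x => f x - g x) = energy (fun x => g x - f x).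
Proof. by rewrite -energyN; congr energy; apply/funext => x; rewrite opprB. Qed.

Lemma energyBD f g h : measurable_fun setT f -> measurable_fun setT g ->
  measurable_fun setT h ->
  (energy (fun x => (f x - h x)%R) <=
     2%:E * energy (fun x => (f x - g x)%R) +
     2%:E * energy (fun x => (g x - h x)%R))%E.
Proof.
move=> mf mg mh.
have -> : (fun x => f x - h x) = (fun x => (f x - g x) + (g x - h x)).
  by apply/funext => x; rewrite addrA subrK.
by apply: energyD; exact: measurable_funB.
Qed.

Lemma sqintZ c f : sqint f -> sqint (fun x => c * f x).
Proof.
move=> [mf fi]; split; first exact: measurable_funM.
by rewrite energyZ// lte_mul_pinfty// lee_fin sqr_ge0.
Qed.

Lemma sqintD f g : sqint f -> sqint g -> sqint (fun x => f x + g x).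
Proof.
move=> [mf fi] [mg gi]; split; first exact: measurable_funD.
apply: le_lt_trans (energyD mf mg) _.
by apply: lte_add_pinfty; apply: lte_mul_pinfty.
Qed.

Lemma sqintB f g : sqint f -> sqint g -> sqint (fun x => f x - g x).
Proof.
move=> sf /(sqintZ (-1)) /(sqintD sf).
by under eq_fun do rewrite mulN1r.
Qed.

Lemma sqint_normr f : sqint f -> sqint (fun x => `|f x|).
Proof.
move=> sf; apply: (sqint_le _ sf) => [|x]; last by rewrite normr_id.
by apply: measurableT_comp => //; case: sf.
Qed.

Lemma sqint_bndM (K : R) (phi f : T -> R) : measurable_fun setT phi ->
  (forall x, `|phi x| <= K) -> sqint f -> sqint (fun x => phi x * f x).
Proof.
move=> mphi K0 sf; apply: (sqint_le _ (sqintZ K sf)) => [|x].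
  by apply: measurable_funM => //; case: sf.
by rewrite !normrM ler_wpM2r// (le_trans (K0 x))// ler_norm.
Qed.

Lemma ae_energy f g : measurable_fun setT f -> measurable_fun setT g ->
  f = g %[ae mu] -> energy f = energy g.
Proof.
move=> mf mg fg; apply: ge0_ae_eq_integral => //.
- exact: measurable_sqr.
- exact: measurable_sqr.
- by move=> x _; rewrite lee_fin sqr_ge0.
- by move=> x _; rewrite lee_fin sqr_ge0.
by apply: filterS fg => x /= fg xT; rewrite fg.
Qed.

Lemma energy0 : energy (fun=> 0) = 0%E.
Proof. by rewrite /energy; under eq_integral do rewrite expr0n/=; exact: integral0. Qed.

Lemma energyB_ae f g : measurable_fun setT f -> measurable_fun setT g ->
  f = g %[ae mu] -> energy (fun x => f x - g x) = 0%E.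
Proof.
move=> mf mg fg; rewrite -energy0; apply: ae_energy => //.
  exact: measurable_funB.
by apply: filterS fg => x /= fg xT; rewrite fg// subrr.
Qed.

Lemma energy_eq0 f : measurable_fun setT f -> energy f = 0%E -> f = (fun=> 0) %[ae mu].
Proof.
move=> mf f0.
have : (\int[mu]_x `|((f x ^+ 2)%:E : \bar R)| = 0)%E.
  by rewrite -[RHS]f0; apply: eq_integral => x _; rewrite gee0_abs// lee_fin sqr_ge0.
move/(ae_eq_integral_abs mu measurableT (measurable_sqr mf)).
apply: filterS => x /= f0x xT.
by have /eqP := f0x xT; rewrite eqe sqrf_eq0 => /eqP.
Qed.

Lemma energy_dominated (f_ : nat -> T -> R) f g :
  (forall n, measurable_fun setT (f_ n)) -> measurable_fun setT f -> sqint g ->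
  {ae mu, forall x, f_ ^~ x @ \oo --> f x} ->
  {ae mu, forall x n, `|f_ n x| <= g x} ->
  energy (fun x => (f_ n x - f x)%R) @[n --> \oo] --> 0%E.
Proof.
move=> mf_ mf [mg gi] ff fg.
pose F n x : \bar R := ((f_ n x - f x) ^+ 2)%:E.
have mF n : measurable_fun setT (F n).
  by apply: measurable_sqr; exact: measurable_funB.
(* Both [f_ n] and the limit are bounded by g, so the squared difference is at most (2 g)^2. *)
have ig : mu.-integrable setT (fun x => 4%:E * (g x ^+ 2)%:E)%E.
  apply: integrableZl => //; apply/integrableP; split; first exact: measurable_sqr.
  apply: le_lt_trans gi; apply: ge0_le_integral => //.
  - by apply: measurableT_comp => //; exact: measurable_sqr.
  - exact: measurable_sqr.
  - by move=> x _; rewrite gee0_abs// lee_fin sqr_ge0.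
have Fcv : {ae mu, forall x, setT x -> F ^~ x @ \oo --> (0 : \bar R)}.
  apply: filterS ff => x /= ffx _; rewrite /F; apply: cvg_EFin; first exact: nearW.
  rewrite /comp /= (_ : 0 = (f x - f x) ^+ 2 :> R); last by rewrite subrr expr0n.
  rewrite !expr2; under eq_cvg do rewrite expr2.
  by apply: cvgM; apply: cvgB => //; exact: cvg_cst.
have Fdom : {ae mu, forall x n, setT x -> (`|F n x| <= 4%:E * (g x ^+ 2)%:E)%E}.
  apply: filterS2 ff fg => x /= ffx fgx n _.
  rewrite /F /= ger0_norm ?sqr_ge0// -EFinM lee_fin.
  have fgn : `|f x| <= g x.
    have : `|f_ k x| @[k --> \oo] --> `|f x| by apply: cvg_norm.
    move=> /cvgP-/cvg_lim; move: (ffx) => /cvg_norm cn.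
    move=> _; rewrite -(cvg_lim _ cn)//.
    by apply: limr_le; [apply/cvg_ex; exists (`|f x|) | apply: nearW].
  have : `|f_ n x - f x| <= 2 * g x.
    by apply: le_trans (ler_normB _ _) _; have := fgx n; lra.
  move=> h; rewrite -real_normK ?num_real//.
  rewrite (_ : 4 * _ = (2 * g x) ^+ 2); last by ring.
  rewrite lerXn2r ?nnegrE//; exact: le_trans h.
have [_ _] := dominated_convergence measurableT mF (measurable_cst 0%E) Fcv ig Fdom.
by rewrite integral0.
Qed.

Lemma fatou_bound (F_ : nat -> T -> R) (F : T -> R) (M : \bar R) :
  (forall n, measurable_fun setT (F_ n)) -> measurable_fun setT F ->
  (forall n x, 0 <= F_ n x) -> (forall x, 0 <= F x) ->
  {ae mu, forall x, F_ ^~ x @ \oo --> F x} ->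
  (forall n, (\int[mu]_x (F_ n x)%:E <= M)%E) ->
  (\int[mu]_x (F x)%:E <= M)%E.
Proof.
move=> mF_ mF F_0 F0 FF FM.
have mFn n : measurable_fun setT (EFin \o F_ n) by exact/measurable_EFinP.
(* [fatou] bounds the integral of the lower limit, which equals F only almost everywhere. *)
have FE : (\int[mu]_x (F x)%:E =
    \int[mu]_x (limn_einf (fun n => (F_ n x)%:E)))%E.
  apply: ge0_ae_eq_integral => //.
  - exact/measurable_EFinP.
  - under eq_fun do rewrite limn_einf_lim.
    apply: emeasurable_fun_cvg => [n|x _]; last exact: is_cvg_einfs.
    exact: measurable_fun_einfs.
  - by move=> x _; rewrite lee_fin.
  - move=> x _; rewrite limn_einf_lim; apply: lime_ge; first exact: is_cvg_einfs.
    apply: nearW => n; apply: le_ereal_inf_tmp => _ [m _ <-].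
    by rewrite lee_fin.
  - apply: filterS FF => x FFx _.
    have /cvg_limn_einf_sup[-> _] // : (F_ n x)%:E @[n --> \oo] --> (F x)%:E.
    by apply: cvg_EFin => //; exact: nearW.
rewrite FE.
apply: le_trans (fatou mu measurableT mFn _) _ => //.
  by move=> n x _; rewrite lee_fin.
rewrite limn_einf_lim; apply: lime_le; first exact: is_cvg_einfs.
apply: nearW => n; apply: le_trans (FM n).
by apply: ereal_inf_lbound; exists n => //=.
Qed.

Lemma energy_fatou (f_ : nat -> T -> R) f (M : \bar R) :
  (forall n, measurable_fun setT (f_ n)) -> measurable_fun setT f ->
  {ae mu, forall x, f_ ^~ x @ \oo --> f x} ->
  (forall n, (energy (f_ n) <= M)%E) -> (energy f <= M)%E.
Proof.
move=> mf_ mf ff; apply: (fatou_bound (F_ := fun n x => f_ n x ^+ 2)).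
- by move=> n; exact: measurable_funX.
- exact: measurable_funX.
- by move=> n x; exact: sqr_ge0.
- by move=> x; exact: sqr_ge0.
apply: filterS ff => x ffx; rewrite expr2; under eq_cvg do rewrite expr2.
exact: cvgM.
Qed.

Lemma ae_cvg_series (h : nat -> T -> R) :
  (forall n, measurable_fun setT (h n)) -> (forall n x, 0 <= h n x) ->
  (\sum_(n <oo) \int[mu]_x (h n x)%:E < +oo)%E ->
  {ae mu, forall x, cvgn (series (h ^~ x))}.
Proof.
move=> mh h0 hoo.
have mhE n : measurable_fun setT (EFin \o h n) by exact/measurable_EFinP.
pose S x := (\sum_(n <oo) (h n x)%:E)%E.
have S0 x : (0 <= S x)%E by apply: nneseries_ge0 => n _ _; rewrite lee_fin.
have mS : measurable_fun setT S.
  apply: (ge0_emeasurable_sum (h := fun n x => (h n x)%:E) (P := xpredT)) => //.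
    by move=> n x _ _; rewrite lee_fin.
  by move=> n _; exact: mhE.
have /(integrable_ae measurableT) : mu.-integrable setT S.
  apply/integrableP; split; first exact: mS.
  rewrite (eq_integral S); last by move=> x _; rewrite gee0_abs.
  by rewrite integral_nneseries// => n x _; rewrite lee_fin.
apply: filterS => x /(_ I) Sx.
apply: nondecreasing_is_cvgn.
  by apply: nondecreasing_series => n _ _.
exists (fine (S x)) => _ [n _ <-].
rewrite -lee_fin fineK// seriesEnat /= -sumEFin.
by apply: nneseries_lim_ge => k _ _; rewrite lee_fin.
Qed.

(** Along indices where the energies are below 2^-n, the integrals of the squares are summable, so
    the squares themselves are summable at almost every point and tend to 0. *)
Lemma ae_cvg0_subseq (h : nat -> T -> R) :
  (forall n, measurable_fun setT (h n)) ->
  (forall e : R, 0 < e -> exists n, forall m, (n <= m)%N -> (energy (h m) < e%:E)%E) ->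
  exists s : nat -> nat, (forall n, (n <= s n)%N) /\
    {ae mu, forall x, h (s n) x @[n --> \oo] --> (0 : R)}.
Proof.
move=> mh hcv.
have e0 n : 0 < 2^-1 ^+ n :> R by rewrite exprn_gt0// invr_gt0.
pose N n := projT1 (cid (hcv _ (e0 n))).
have NP n m : (N n <= m)%N -> (energy (h m) < (2^-1 ^+ n)%:E)%E.
  by rewrite /N; case: cid => ? /=; exact.
exists (fun n => maxn n (N n)); split; first by move=> n; exact: leq_maxl.
have : {ae mu, forall x, cvgn (series (fun n => h (maxn n (N n)) x ^+ 2))}.
  apply: (@ae_cvg_series (fun n x => h (maxn n (N n)) x ^+ 2)).
  - by move=> n; exact: measurable_funX.
  - by move=> n x; exact: sqr_ge0.
  apply: (@le_lt_trans _ _ (\sum_(n <oo) (2^-1 ^+ n)%:E)%E).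
    apply: lee_nneseries => [n _ _|n _]; first exact: energy_ge0.
    by apply/ltW/NP; exact: leq_maxr.
  by apply: geometric_nneseries_lty; lra.
apply: filterS => x /cvg_series_cvg_0 hx.
have : Num.sqrt (h (maxn n (N n)) x ^+ 2) @[n --> \oo] --> Num.sqrt (0 : R).
  by apply: continuous_cvg => //; exact: sqrt_continuous.
rewrite sqrtr0; under eq_cvg do rewrite sqrtr_sqr.
by move/norm_cvg0P.
Qed.

(** Riesz-Fischer: a fast subsequence converges almost everywhere, and Fatou's lemma shows that its
    limit is also the limit in energy of the whole sequence. *)
Lemma energy_complete (u : nat -> T -> R) :
  (forall n, sqint (u n)) ->
  (forall e : R, 0 < e -> exists N, forall m n, (N <= m)%N -> (N <= n)%N ->
     (energy (fun x => (u m x - u n x)%R) < e%:E)%E) ->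
  exists2 l, sqint l & forall e : R, 0 < e -> exists N, forall n, (N <= n)%N ->
     (energy (fun x => (u n x - l x)%R) < e%:E)%E.
Proof.
move=> su ucau.
have mu_ n : measurable_fun setT (u n) by case: (su n).
(* The bound 8^-k leaves room for the weight 2^k in [h] below, whose integral is then at most 4^-k.
   The increments a are absolutely summable by |a| <= 2^-k + 2^k a^2. *)
have e0 n : 0 < 8^-1 ^+ n :> R by rewrite exprn_gt0// invr_gt0.
pose N n := projT1 (cid (ucau _ (e0 n))).
have NP k m n : (N k <= m)%N -> (N k <= n)%N ->
    (energy (fun x => (u m x - u n x)%R) < (8^-1 ^+ k)%:E)%E.
  by rewrite /N; case: cid => ? /=; exact.
(* Summing the thresholds gives at once a nondecreasing sequence with [N k <= s k] and
   [k <= s k]. *)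
pose s k := (\sum_(i < k.+1) (N i).+1)%N.
have sS k : (s k <= s k.+1)%N by rewrite /s [in leqRHS]big_ord_recr/= leq_addr.
have sN k : (N k <= s k)%N.
  by rewrite /s big_ord_recr/= (leq_trans (leqnSn _)) ?leq_addl.
have sk k : (k <= s k)%N.
  elim: k => [//|k IH]; rewrite /s big_ord_recr/= -/(s k).
  by rewrite -addn1 leq_add.
pose h k x : R := 2 ^+ k * (u (s k.+1) x - u (s k) x) ^+ 2.
have mB k : measurable_fun setT (fun x => u (s k.+1) x - u (s k) x).
  exact: measurable_funB.
have mh k : measurable_fun setT (h k).
  by apply: measurable_funM => //; exact: measurable_funX.
have h0 k x : 0 <= h k x by rewrite mulr_ge0 ?sqr_ge0// exprn_ge0.
have hcv : {ae mu, forall x, cvgn (series (h ^~ x))}.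
  apply: ae_cvg_series => //.
  apply: (@le_lt_trans _ _ (\sum_(n <oo) (4^-1 ^+ n)%:E)%E).
    apply: lee_nneseries => [n _ _|n _].
      by apply: integral_ge0 => x _; rewrite lee_fin.
    under eq_integral do rewrite EFinM.
    rewrite ge0_integralZl_EFin ?exprn_ge0//; last 2 first.
      by move=> x _; rewrite lee_fin sqr_ge0.
      exact: measurable_sqr.
    apply: (@le_trans _ _ ((2 ^+ n)%:E * (8^-1 ^+ n)%:E)%E).
      apply: lee_wpmul2l; first by rewrite lee_fin exprn_ge0.
      by apply/ltW/NP => //; exact: leq_trans (sS n).
    by rewrite -EFinM -exprMn lee_fin lerXn2r ?nnegrE//; lra.
  by apply: geometric_nneseries_lty; lra.
have ucv : {ae mu, forall x, cvgn (fun k => u (s k) x)}.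
  apply: filterS hcv => x hx.
  have : cvgn (series (fun k => u (s k.+1) x - u (s k) x)).
    apply: normed_cvg; apply: (@series_le_cvg _ _ (fun k => 2^-1 ^+ k + h k x)) => //=.
    - by move=> n; rewrite addr_ge0// exprn_ge0// invr_ge0.
    - move=> n; rewrite /h; set a := u _ x - _.
      have p0 : 0 < 2 ^+ n :> R by rewrite exprn_gt0.
      have pV : (2 ^+ n) * (2^-1 ^+ n) = 1 :> R by rewrite -exprMn divff ?expr1n.
      have q0 : 0 < 2^-1 ^+ n :> R by rewrite exprn_gt0// invr_gt0.
      have -> : a ^+ 2 = `|a| ^+ 2 by rewrite real_normK ?num_real.
      have := sqr_ge0 (2 ^+ n * `|a| - 1).
      have := normr_ge0 a; set b := `|a|; set p := 2 ^+ n in p0 pV *.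
      set q := 2^-1 ^+ n in pV q0 * => b0 h1; nra.
    - apply: is_cvg_seriesD => //.
      rewrite exprn_geometric.
      by apply: is_cvg_geometric_series; rewrite ger0_norm//; lra.
  have -> : (fun k => u (s k) x) =
      (fun k => u (s 0%N) x + series (telescope (fun k => u (s k) x)) k).
    by apply/funext => k; rewrite (eq_sum_telescope (fun k => u (s k) x)).
  by move=> ?; apply: is_cvgD => //; exact: is_cvg_cst.
have [A [mA A0 subA]] := ucv.
have AP x : ~ A x -> cvgn (fun k => u (s k) x).
  by move=> Ax; apply: contrapT => ux; apply: Ax; exact: subA.
(* Setting the sequence to 0 on the null set A makes it converge at every point, so that the limit
   is measurable. *)
pose v k x := \1_(~` A) x * u (s k) x.
have vcv x : cvgn (v ^~ x).
  rewrite /v indicE; have [xA|xA] := boolP (x \in ~` A).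
    by under eq_fun do rewrite mul1r; apply: AP; move: xA; rewrite inE.
  by under eq_fun do rewrite mul0r; exact: is_cvg_cst.
pose l x := limn (v ^~ x).
have mv k : measurable_fun setT (v k).
  by apply: measurable_funM => //; apply: measurable_indic; exact: measurableC.
have ml : measurable_fun setT l.
  by apply: (measurable_fun_cvg mv) => x _; exact: vcv.
have ul : {ae mu, forall x, u (s k) x @[k --> \oo] --> l x}.
  exists A; split => // x /= ux; apply: contrapT => Ax; apply: ux.
  rewrite /l (_ : v ^~ x = (fun k => u (s k) x)); first exact: AP.
  by apply/funext => k; rewrite /v indicE mem_set// mul1r.
have main (e : R) : 0 < e -> exists M, forall n, (M <= n)%N ->
    (energy (fun x => (u n x - l x)%R) <= e%:E)%E.
  move=> e_gt0; have [M MP] := ucau _ e_gt0; exists M => n Mn.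
  (* The shift by M places every index of the subsequence beyond the Cauchy threshold. *)
  apply: (@energy_fatou (fun k x => u n x - u (s (k + M)%N) x)).
  - by move=> k; exact: measurable_funB.
  - exact: measurable_funB.
  - apply: filterS ul => x ul; apply: cvgB; first exact: cvg_cst.
    by rewrite (cvg_shiftn M (fun k => u (s k) x)).
  - move=> k; apply/ltW/MP => //.
    by apply: leq_trans (sk _); exact: leq_addl.
exists l.
  have [M /(_ M (leqnn _)) Ml] := main 1 ltr01.
  have : sqint (fun x => u M x - l x).
    by split; [exact: measurable_funB|apply: le_lt_trans Ml _; rewrite ltry].
  move=> /(sqintB (su M)).
  by under eq_fun do rewrite opprB addrC subrK.
move=> e e_gt0; have [|M MP] := main (e / 2); first by lra.
by exists M => n /MP h1; apply: le_lt_trans h1 _; rewrite lte_fin; lra.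
Qed.

(** Closedness under limits in energy also makes such a set of functions stable under modification
    on null sets ([closed_ae]), so it stands for a closed subspace of L^2. *)
Record closed_subspace (C : set (T -> R)) : Prop := {
  closed_sqint : forall f, C f -> sqint f;
  closed_lin : forall c f g, C f -> C g -> C (fun x => c * f x + g x);
  closed_lim : forall f, sqint f ->
    (forall e : R, 0 < e -> exists2 g, C g &
       (energy (fun x => (f x - g x)%R) < e%:E)%E) -> C f
}.

Section closed_subspace.
Variables (C : set (T -> R)) (cC : closed_subspace C).

Lemma closed_ae f g : sqint f -> C g -> f = g %[ae mu] -> C f.
Proof.
move=> sf Cg fg; apply: (closed_lim cC sf) => e e0; exists g => //.
have [mf _] := sf; have [mg _] := closed_sqint cC Cg.
by rewrite energyB_ae// lte_fin.
Qed.

Lemma closed_dominated (f_ : nat -> T -> R) f g :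
  (forall n, C (f_ n)) -> measurable_fun setT f -> sqint g ->
  {ae mu, forall x, f_ ^~ x @ \oo --> f x} ->
  {ae mu, forall x n, `|f_ n x| <= g x} -> C f.
Proof.
move=> Cf_ mf sg ff fg.
have mf_ n : measurable_fun setT (f_ n) by case: (closed_sqint cC (Cf_ n)).
have cv := energy_dominated mf_ mf sg ff fg.
have sf : sqint f.
  split=> //; have [N /(_ N (leqnn _)) Nf] := cvge0_lt cv ltr01.
  have [_ fNoo] := closed_sqint cC (Cf_ N).
  apply: le_lt_trans (_ : 2%:E * energy (fun x => (f x - f_ N x)%R) + 2%:E * energy (f_ N) < +oo)%E.
    have := energyD (measurable_funB mf (mf_ N)) (mf_ N).
    by rewrite /=; under eq_fun do rewrite subrK.
  apply: lte_add_pinfty; apply: lte_mul_pinfty => //.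
  by rewrite energyB (lt_trans Nf)// ltry.
apply: (closed_lim cC sf) => e /(cvge0_lt cv)[N /(_ N (leqnn _)) Nf].
by exists (f_ N) => //; rewrite energyB.
Qed.

Lemma closed0 f : C f -> C (fun=> 0).
Proof.
by move=> Cf; have := closed_lin cC (-1) Cf Cf; under eq_fun do rewrite mulN1r addNr.
Qed.

Lemma closedZ c f : C f -> C (fun x => c * f x).
Proof.
move=> Cf; have := closed_lin cC c Cf (closed0 Cf).
by under eq_fun do rewrite addr0.
Qed.

Lemma closedD f g : C f -> C g -> C (fun x => f x + g x).
Proof.
move=> Cf Cg; have := closed_lin cC 1 Cf Cg.
by under eq_fun do rewrite mul1r.
Qed.

(** Multipliers of C form an algebra that is closed under bounded pointwise limits; from there one
    passes to a sigma-algebra of sets and to all bounded measurable functions. *)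
Definition multiplier (phi : T -> R) := [/\ measurable_fun setT phi,
  exists K, forall x, `|phi x| <= K &
  forall f, C f -> C (fun x => phi x * f x)].

Lemma multiplier_cst c : multiplier (fun=> c).
Proof. by split=> //; [exists (`|c|) | move=> f; exact: closedZ]. Qed.

Lemma multiplierD phi psi : multiplier phi -> multiplier psi ->
  multiplier (fun x => phi x + psi x).
Proof.
move=> [m1 [K1 b1] c1] [m2 [K2 b2] c2]; split.
- exact: measurable_funD.
- exists (K1 + K2) => x; apply: le_trans (ler_normD _ _) _.
  exact: lerD.
- move=> f Cf; under eq_fun do rewrite mulrDl.
  by apply: closedD; [exact: c1|exact: c2].
Qed.

Lemma multiplierM phi psi : multiplier phi -> multiplier psi ->
  multiplier (fun x => phi x * psi x).
Proof.
move=> [m1 [K1 b1] c1] [m2 [K2 b2] c2]; split.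
- exact: measurable_funM.
- by exists (K1 * K2) => x; rewrite normrM ler_pM.
- move=> f Cf; under eq_fun do rewrite -mulrA.
  by apply: c1; exact: c2.
Qed.

Lemma multiplierX phi n : multiplier phi -> multiplier (fun x => phi x ^+ n).
Proof.
move=> mphi; elim: n => [|n IH]; first exact: multiplier_cst.
by under eq_fun do rewrite exprS; exact: multiplierM.
Qed.

Lemma multiplierBl c phi : multiplier phi -> multiplier (fun x => c - phi x).
Proof.
move=> mphi; apply: multiplierD; first exact: multiplier_cst.
under eq_fun do rewrite -mulN1r.
by apply: multiplierM => //; exact: multiplier_cst.
Qed.

Lemma multiplier_cvg (phi_ : nat -> T -> R) (phi : T -> R) (K : R) :
  (forall n, multiplier (phi_ n)) -> (forall n x, `|phi_ n x| <= K) ->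
  (forall x, phi_ n x @[n --> \oo] --> phi x) -> multiplier phi.
Proof.
move=> mphi_ bphi cphi.
have mphi : measurable_fun setT phi.
  by apply: (@measurable_fun_cvg _ _ _ _ phi_) => // n; case: (mphi_ n).
split=> //.
  exists K => x; have cn : `|phi_ n x| @[n --> \oo] --> `|phi x| by exact: cvg_norm.
  rewrite -(cvg_lim _ cn)//.
  by apply: limr_le; [apply/cvg_ex; exists (`|phi x|) | apply: nearW].
move=> f Cf; have [mf _] := closed_sqint cC Cf.
apply: (@closed_dominated (fun n x => phi_ n x * f x) _ (fun x => K * `|f x|)).
- by move=> n; have [_ _] := mphi_ n; exact.
- exact: measurable_funM.
- by apply: sqintZ; apply: sqint_normr; exact: closed_sqint Cf.
- by apply: aeW => x; apply: cvgM => //; exact: cvg_cst.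
- by apply: aeW => x n; rewrite normrM ler_wpM2r.
Qed.

Definition multiplier_set : set (set T) := [set E | multiplier \1_E].

Lemma multiplier_setC E : multiplier_set E -> multiplier_set (~` E).
Proof.
move=> /(multiplierBl 1); rewrite /multiplier_set/=; congr multiplier.
by apply/funext => x; rewrite !indicE in_setC; case: (_ \in _); rewrite ?subr0 ?subrr.
Qed.

Lemma multiplier_setI E F : multiplier_set E -> multiplier_set F ->
  multiplier_set (E `&` F).
Proof.
move=> mE mF; have := multiplierM mE mF; rewrite /multiplier_set/=.
by rewrite indicI.
Qed.

Lemma multiplier_sigma_algebra : sigma_algebra setT multiplier_set.
Proof.
split.
- rewrite /multiplier_set/= indic0; exact: multiplier_cst.
- by move=> E; rewrite setTD; exact: multiplier_setC.
- move=> F mF.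
  have mU n : multiplier_set (\bigcup_(k < n) F k).
    elim: n => [|n IH].
      by rewrite bigcup_mkord big_ord0 /multiplier_set/= indic0; exact: multiplier_cst.
    rewrite bigcup_mkord big_ord_recr/= -bigcup_mkord -[_ `|` _]setCK setCU.
    by apply: multiplier_setC; apply: multiplier_setI; apply: multiplier_setC.
  apply: (multiplier_cvg mU (K := 1)) => [n x|x].
    by rewrite indicE; case: (_ \in _); rewrite ?normr1 ?normr0.
  apply: cvg_near_cst; have [[k _ Fkx]|nF] := pselect ((\bigcup_k F k) x).
    exists k.+1 => // n /= kn; rewrite !indicE !mem_set//; first by exists k.
    by exists k.
  apply: nearW => n; rewrite !indicE !memNset// => -[k _ Fkx].
  by apply: nF; exists k.
Qed.

Lemma multiplier_sum (I : eqType) (s : seq I) (phi : I -> T -> R) :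
  (forall i, i \in s -> multiplier (phi i)) ->
  multiplier (fun x => \sum_(i <- s) phi i x).
Proof.
elim: s => [|i s IH] mphi.
  by under eq_fun do rewrite big_nil; exact: multiplier_cst.
under eq_fun do rewrite big_cons; apply: multiplierD.
  by apply: mphi; rewrite mem_head.
by apply: IH => j js; apply: mphi; rewrite in_cons js orbT.
Qed.

Import HBNNSimple.

(** A nonnegative phi is a bounded limit of simple functions, which are combinations of multiplier
    indicators. A signed phi is K - (K - phi), where K - phi is nonnegative and bounded by K + K. *)
Lemma multiplier_bounded (phi : T -> R) (K : R) :
  (forall E, measurable E -> multiplier_set E) ->
  measurable_fun setT phi -> (forall x, `|phi x| <= K) -> multiplier phi.
Proof.
move=> mE mphi bphi.
wlog phi0 : phi mphi K bphi / forall x, 0 <= phi x.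
  move=> gen; have : multiplier (fun x => K - phi x).
    apply: (gen _ _ (K + K)).
    - exact: measurable_funB.
    - move=> x; apply: le_trans (ler_normB _ _) _; apply: lerD => //.
      by rewrite ger0_norm// (le_trans _ (bphi x)).
    - by move=> x; rewrite subr_ge0 (le_trans (ler_norm _)).
  by move=> /(multiplierBl K); under eq_fun do rewrite opprB addrC subrK.
have mphiE : measurable_fun setT (EFin \o phi) by exact/measurable_EFinP.
have phi0E t : setT t -> (0 <= (EFin \o phi) t)%E by rewrite lee_fin.
pose s n := nnsfun_approx measurableT mphiE n.
have sle n x : s n x <= phi x.
  by have := le_approx n phi0E (I : setT x); rewrite /s nnsfun_approxE lee_fin.
apply: (multiplier_cvg (phi_ := s) (K := K)).
- move=> n; have -> : (s n : T -> R) = (fun x => \sum_(y <- finmap.enum_fset (fset_set (range (s n))))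
      y * \1_(s n @^-1` [set y]) x).
    by apply/funext => x; rewrite [LHS](fimfunE (s n) x) fsbig_finite.
  apply: multiplier_sum => y _; apply: multiplierM; first exact: multiplier_cst.
  by apply: mE; exact: measurable_sfunP.
- move=> n x; rewrite ger0_norm// (le_trans (sle n x))//.
  by rewrite (le_trans (ler_norm _)).
- move=> x.
  have := @cvg_nnsfun_approx _ _ _ setT measurableT (EFin \o phi) mphiE phi0E x I.
  by move=> /fine_cvgP[_].
Qed.

(** Truncations of f to [|f| <= n] are multipliers; applied to the indicator of [E n] they give
    elements of C dominated by |f|. The sets [E n] take the place of the constant 1, which is not
    square integrable on the half line: they are ]0, n] there, and the whole space for a
    probability. *)
Lemma multiplier_dense (E : nat -> set T) :
  (forall A, measurable A -> multiplier_set A) ->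
  (forall n, measurable (E n)) -> (forall n, C \1_(E n)) ->
  {ae mu, forall x, \forall n \near \oo, E n x} ->
  forall f, sqint f -> C f.
Proof.
move=> mA mE CE Ecv f sf; have [mf _] := sf.
pose A n := [set x | `|f x| <= n%:R].
have mAn n : measurable (A n).
  have := @measurable_fun_ler _ _ _ setT (fun x => `|f x|) (fun=> n%:R)
    (measurableT_comp (@normr_measurable R setT) mf) (measurable_cst _) measurableT.
  by move=> /(_ [set true] _)/wrap[//|]; rewrite setTI; congr measurable.
have bA n x : `|f x * \1_(A n) x| <= n%:R.
  rewrite indicE; have [|_] := boolP (x \in A n); last by rewrite mulr0 normr0.
  by rewrite inE mulr1.
have Cn n : C (fun x => f x * \1_(A n) x * \1_(E n) x).
  have [_ _] : multiplier (fun x => f x * \1_(A n) x).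
    apply: (multiplier_bounded mA (K := n%:R)) => //.
    by apply: measurable_funM => //; exact: measurable_indic.
  by apply.
apply: (closed_dominated Cn mf (sqint_normr sf)).
  apply: filterS Ecv => x nEx; apply: cvg_near_cst; near=> n.
  rewrite !indicE !mem_set ?mulr1//=; first by near: n.
  by near: n; exact: nbhs_infty_ger.
apply: aeW => x n; rewrite !indicE !normrM.
by do 2 case: (_ \in _); rewrite ?(normr1, normr0, mulr1, mulr0).
Unshelve. all: by end_near. Qed.

End closed_subspace.

Record subspace (D : set (T -> R)) : Prop := {
  subspace0 : D (fun=> 0);
  subspace_sqint : forall f, D f -> sqint f;
  subspace_lin : forall c f g, D f -> D g -> D (fun x => c * f x + g x)
}.

Definition L2_closure (D : set (T -> R)) : set (T -> R) :=
  [set f | sqint f /\ forall e : R, 0 < e ->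
    exists2 g, D g & (energy (fun x => (f x - g x)%R) < e%:E)%E].

Lemma sub_L2_closure D : subspace D -> D `<=` L2_closure D.
Proof.
move=> sD f Df; split; first exact: subspace_sqint Df.
move=> e e0; exists f => //; under eq_fun do rewrite subrr.
by rewrite energy0 lte_fin.
Qed.

Lemma L2_closure_closed D : subspace D -> closed_subspace (L2_closure D).
Proof.
move=> sD.
have mD f : D f -> measurable_fun setT f by move=> /(subspace_sqint sD)[].
split; first by move=> f [].
  move=> c f g [sf Df] [sg Dg]; split; first exact: sqintD (sqintZ c sf) sg.
  move=> e e0; have c0 : 0 < c ^+ 2 + 1 by rewrite ltr_wpDl// sqr_ge0.
  (* With this accuracy c^2 times the first error is at most e / 4, and [energyD] doubles both
     errors. Adding 1 avoids a division by 0 when c = 0. *)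
  have d0 : 0 < e / 4 / (c ^+ 2 + 1) by rewrite !divr_gt0.
  have [f' Df' ff'] := Df _ d0; have [g' Dg' gg'] := Dg (e / 4) ltac:(lra).
  have [mf _] := sf; have [mg _] := sg.
  have mf' := mD _ Df'; have mg' := mD _ Dg'.
  exists (fun x => c * f' x + g' x); first exact: subspace_lin.
  have -> : (fun x => c * f x + g x - (c * f' x + g' x)) =
            (fun x => c * (f x - f' x) + (g x - g' x)).
    by apply/funext => x; ring.
  have mff : measurable_fun setT (fun x => f x - f' x) by exact: measurable_funB.
  have mgg : measurable_fun setT (fun x => g x - g' x) by exact: measurable_funB.
  apply: le_lt_trans (energyD (measurable_funM (measurable_cst c) mff) mgg) _.
  rewrite energyZ//.
  have [a aE] : exists a, energy (fun x => f x - f' x) = a%:E.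
    exists (fine (energy (fun x => f x - f' x))); rewrite fineK// ge0_fin_numE ?energy_ge0//.
    by rewrite (lt_trans ff')// ltry.
  have [b bE] : exists b, energy (fun x => g x - g' x) = b%:E.
    exists (fine (energy (fun x => g x - g' x))); rewrite fineK// ge0_fin_numE ?energy_ge0//.
    by rewrite (lt_trans gg')// ltry.
  have := energy_ge0 (fun x => f x - f' x).
  move: ff' gg'; rewrite aE bE -!EFinM -EFinD !lte_fin lee_fin => ha hb a0.
  have : c ^+ 2 * a <= e / 4.
    move: ha; rewrite ltr_pdivlMr// => ha; nra.
  lra.
move=> f sf fC; split=> // e e0.
have [g [sg Dg] fg] := fC (e / 4) ltac:(lra).
have [h Dh gh] := Dg (e / 4) ltac:(lra).
exists h => //; have [mf _] := sf; have [mg _] := sg.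
apply: le_lt_trans (energyBD mf mg (mD _ Dh)) _.
have -> : e%:E = (2%:E * (e / 4)%:E + 2%:E * (e / 4)%:E)%E.
  by rewrite -!EFinM -EFinD; congr EFin; lra.
by apply: lteD; rewrite lte_pmul2l.
Qed.

End energy.

(** * Laplace transform of the Wiener increments *)

Section weighted_image.
Context {d1 d2} {X : measurableType d1} {Y : measurableType d2} {R : realType}.
Variables (m : {measure set X -> \bar R}) (nu : {measure set Y -> \bar R}).
Variables (xi : X -> Y) (g : X -> R) (c : R).
Hypothesis mxi : measurable_fun setT xi.
Hypothesis mg : measurable_fun setT g.
Hypothesis g0 : forall x, 0 <= g x.
Hypothesis c0 : 0 <= c.
Hypothesis gnu : forall B, measurable B ->
  (\int[m]_x (g x * \1_B (xi x))%:E = c%:E * nu B)%E.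

Import HBNNSimple.

Let weighted_image_nnsfun (h : {nnsfun Y >-> R}) :
  (\int[m]_x (g x * h (xi x))%:E = c%:E * \int[nu]_y (h y)%:E)%E.
Proof.
pose s := finmap.enum_fset (fset_set (range h)).
(* On the range of h, z and |z| agree; the absolute value makes every term nonnegative without
   tracking membership in the range. *)
have hE y : h y = \sum_(z <- s) `|z| * \1_(h @^-1` [set z]) y.
  rewrite [LHS](fimfunE h y) fsbig_finite//= big_seq [RHS]big_seq.
  apply: eq_bigr => z; rewrite in_fset_set// inE => -[t _ <-].
  by rewrite ger0_norm.
have mB z : measurable (h @^-1` [set z]) by exact: measurable_sfunP.
have mI z : measurable_fun setT (\1_(h @^-1` [set z]) : Y -> R).
  exact: measurable_indic.
have I0 z y : 0 <= \1_(h @^-1` [set z]) y :> R by rewrite indicE.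
under eq_integral do rewrite hE mulr_sumr -sumEFin.
rewrite ge0_integral_sum//; last 2 first.
- move=> z; apply/measurable_EFinP; apply: measurable_funM => //.
  by apply: measurable_funM => //; exact: (measurableT_comp (mI z) mxi).
- by move=> z x _; rewrite lee_fin !mulr_ge0.
under [in RHS]eq_integral do rewrite hE -sumEFin.
rewrite ge0_integral_sum//; last first.
  by move=> z; apply/measurable_EFinP; exact: measurable_funM.
rewrite ge0_sume_distrr; last first.
  by move=> z _; apply: integral_ge0 => y _; rewrite lee_fin mulr_ge0.
apply: eq_bigr => z _.
under eq_integral do rewrite mulrCA EFinM.
rewrite ge0_integralZl_EFin//; last 2 first.
- by move=> x _; rewrite lee_fin mulr_ge0.
- apply/measurable_EFinP; apply: measurable_funM => //.
  exact: (measurableT_comp (mI z) mxi).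
rewrite gnu//; under [in RHS]eq_integral do rewrite EFinM.
rewrite ge0_integralZl_EFin//; last exact/measurable_EFinP.
by rewrite integral_indic// setIT muleCA.
Qed.

(** The hypothesis [gnu] says that xi maps the measure of density g to c nu; monotone approximation
    extends this from sets to nonnegative functions. It serves with xi the identity and g a Gaussian
    density, and then with g a product of factors independent of xi. *)
Lemma weighted_image (f : Y -> R) : measurable_fun setT f ->
  (forall y, 0 <= f y) ->
  (\int[m]_x (g x * f (xi x))%:E = c%:E * \int[nu]_y (f y)%:E)%E.
Proof.
move=> mf f0.
have mfE : measurable_fun setT (EFin \o f) by exact/measurable_EFinP.
have f0E y : setT y -> (0 <= (EFin \o f) y)%E by rewrite lee_fin.
pose s n := nnsfun_approx measurableT mfE n.
have ms n : measurable_fun setT (s n : Y -> R) by exact: measurable_funP.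
have scv y : (s n y)%:E @[n --> \oo] --> (f y)%:E.
  exact: (@cvg_nnsfun_approx _ _ _ setT measurableT (EFin \o f) mfE f0E y I).
have snd a b : (a <= b)%N -> forall y, s a y <= s b y.
  by move=> ab; exact/lefP/(nd_nnsfun_approx measurableT mfE).
have cv1 : (\int[nu]_y (s n y)%:E)%E @[n --> \oo] --> (\int[nu]_y (f y)%:E)%E.
  rewrite (eq_integral (fun y => limn (fun n => (s n y)%:E))); last first.
    by move=> y _; apply/esym/cvg_lim.
  apply: (@cvg_monotone_convergence _ _ _ nu setT measurableT (fun n y => (s n y)%:E)) => //.
  - by move=> n; exact/measurable_EFinP.
  - by move=> n y _; rewrite lee_fin.
  - by move=> y _ a b ab; rewrite lee_fin; exact: snd.
have cv2 : (\int[m]_x (g x * s n (xi x))%:E)%E @[n --> \oo] -->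
    (\int[m]_x (g x * f (xi x))%:E)%E.
  rewrite (eq_integral (fun x => limn (fun n => (g x * s n (xi x))%:E))); last first.
    move=> x _; apply/esym/cvg_lim => //.
    apply: cvg_EFin; first exact: nearW.
    by apply: cvgM; [exact: cvg_cst|have /fine_cvgP[] := scv (xi x)].
  apply: (@cvg_monotone_convergence _ _ _ m setT measurableT (fun n x => (g x * s n (xi x))%:E)) => //.
  - move=> n; apply/measurable_EFinP/measurable_funM => //.
    exact: measurableT_comp.
  - by move=> n x _; rewrite lee_fin mulr_ge0.
  - by move=> x _ a b ab; rewrite lee_fin ler_wpM2l// snd.
move: cv2; under eq_cvg do rewrite weighted_image_nnsfun.
move=> cv2; apply: (cvg_unique _ cv2) => //.
exact: cvgeZl.
Qed.

End weighted_image.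

Lemma gaussian_mgf (R : realType) (s a : R) : s != 0 ->
  (\int[normal_prob 0 s]_x (expR (a * x))%:E = (expR (a ^+ 2 * s ^+ 2 / 2))%:E)%E.
Proof.
move=> s0.
have mpdf m : measurable_fun setT (@normal_pdf R m s) by exact: measurable_normal_pdf.
have me : measurable_fun setT (fun x : R => expR (a * x)).
  by apply: measurableT_comp => //; exact: measurable_funM.
have := @weighted_image _ _ _ _ R lebesgue_measure (normal_prob 0 s) id (normal_pdf 0 s) 1 _ (mpdf 0) (normal_pdf_ge0 0 s) _ _ me (fun x => expR_ge0 _).
move=> /(_ (@measurable_id _ _ _)) wi.
rewrite -[LHS]mul1e -wi; last first.
  move=> B mB; rewrite mul1e /normal_prob [RHS]integral_mkcond.
  by apply: eq_integral => x _; rewrite patchE indicE; case: ifPn => _; rewrite ?mulr1 ?mulr0.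
(* Completing the square: the exponential factor moves the mean of the Gaussian density from 0 to a
   s^2. *)
transitivity (\int[lebesgue_measure]_x ((expR (a ^+ 2 * s ^+ 2 / 2))%:E * (normal_pdf (a * s ^+ 2) s x)%:E))%E; last first.
  rewrite ge0_integralZl_EFin ?expR_ge0//.
  - by rewrite integral_normal_pdf mule1.
  - by move=> x _; rewrite lee_fin normal_pdf_ge0.
  - by apply/measurable_EFinP; exact: mpdf.
apply: eq_integral => x _; rewrite -EFinM; congr EFin.
rewrite /normal_pdf (negbTE s0) /normal_fun [RHS]mulrCA -[LHS]mulrA.
congr (_ * _); rewrite -!expRD; congr expR.
by field.
Qed.

Lemma independent_expectation d (T : measurableType d) (R : realType)
    (P : probability T R) (xi : nat -> T -> R)
    (N : nat -> probability (measurableTypeR R) R) (f : nat -> R -> R)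
    (m : nat -> R) (n : nat) :
  (forall i, measurable_fun setT (xi i)) ->
  (forall B : nat -> set R, (forall i, measurable (B i)) ->
    P [set w | forall i, (i < n)%N -> B i (xi i w)] = (\prod_(i < n) N i (B i))%E) ->
  (forall i, measurable_fun setT (f i)) -> (forall i x, 0 <= f i x) ->
  (forall i, (\int[N i]_x (f i x)%:E = (m i)%:E)%E) ->
  (\int[P]_w (\prod_(i < n) f i (xi i w))%:E = (\prod_(i < n) m i)%:E)%E.
Proof.
move=> mxi ind mf f0 fm.
have m0 i : 0 <= m i.
  by rewrite -lee_fin -fm; apply: integral_ge0 => x _; rewrite lee_fin.
have Nfin i (A : set (measurableTypeR R)) : measurable A -> N i A \is a fin_num.
  by move=> mA; exact: fin_num_measure.
(* Hybrid products: the first k factors are the functions [f i], the remaining ones indicators of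
   [B i]. The induction on k turns one set into one function at a time, from the hypothesis on sets
   at k = 0 to the claim at k = n. *)
pose F k (B : nat -> set R) i x : R := if (i < k)%N then f i x else \1_(B i) x.
pose M k (B : nat -> set R) i : R := if (i < k)%N then m i else fine (N i (B i)).
have F0 k B i x : 0 <= F k B i x by rewrite /F; case: ifP => // _; rewrite indicE.
have M0 k B i : 0 <= M k B i by rewrite /M; case: ifP => // _; rewrite fine_ge0.
have mF k B i : (forall i, measurable (B i)) -> measurable_fun setT (F k B i).
  by move=> mB; rewrite /F; case: (i < k)%N => //; exact: measurable_indic.
suff main k : (k <= n)%N -> forall B, (forall i, measurable (B i)) ->
    (\int[P]_w (\prod_(i < n) F k B i (xi i w))%:E = (\prod_(i < n) M k B i)%:E)%E.
  have := main n (leqnn n) (fun=> setT) (fun=> measurableT).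
  under eq_integral do under eq_bigr => i _ do rewrite /F ltn_ord.
  by under [in X in _ = X -> _]eq_bigr => i _ do rewrite /M ltn_ord.
elim: k => [_ B mB|k IH kn B mB].
  have -> : (\prod_(i < n) M 0%N B i)%:E = P [set w | forall i, (i < n)%N -> B i (xi i w)].
    rewrite ind// (big_morph EFin EFinM erefl); apply: eq_bigr => i _.
    by rewrite /M/= fineK//; apply: Nfin; exact: mB.
  have mA : measurable [set w | forall i, (i < n)%N -> B i (xi i w)].
    have -> : [set w | forall i, (i < n)%N -> B i (xi i w)] =
        \bigcap_(i in [set i | (i < n)%N]) (xi i @^-1` B i).
      by apply/seteqP; split => w /= h i /= ?; exact: h.
    apply: bigcap_measurableType => i _.
    by rewrite -[_ @^-1` _]setTI; exact: mxi.
  rewrite -(setIT [set w | _]) -integral_indic//; apply: eq_integral => w _.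
  congr EFin; rewrite /F/= indicE.
  have [|/negP] := boolP (w \in _); rewrite inE/= => Bw.
    by rewrite big1// => i _; rewrite indicE mem_set//; exact: Bw.
  apply/eqP; rewrite prodf_seq_eq0; apply/hasP.
  move/existsNP: Bw => [i /not_implyP[ilt nB]].
  by exists (Ordinal ilt); rewrite ?mem_index_enum//= indicE memNset.
pose ko := Ordinal kn.
have E1 w : \prod_(i < n) F k.+1 B i (xi i w) =
    (\prod_(i < n | i != ko) F k.+1 B i (xi i w)) * f k (xi k w).
  by rewrite (bigD1 ko)//= mulrC /F ltnSn.
have E2 : \prod_(i < n) M k.+1 B i =
    (\prod_(i < n | i != ko) M k.+1 B i) * m k.
  by rewrite (bigD1 ko)//= mulrC /M ltnSn.
have neqk (i : 'I_n) : i != ko -> (i < k.+1)%N = (i < k)%N.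
  by rewrite ltnS leq_eqVlt -val_eqE /= => /negbTE->.
under eq_integral do rewrite E1.
rewrite E2 EFinM -fm.
apply: (@weighted_image _ _ _ _ _ P (N k) (xi k)); last 2 first.
- exact: mf.
- exact: f0.
- exact: mxi.
- under eq_fun do rewrite big_mkcond/=.
  apply: measurable_prod => i _; case: (i != ko) => //.
  by apply: (measurableT_comp (mF _ _ _ mB)).
- by move=> w; apply: prodr_ge0.
(* Placing an arbitrary set A at index k turns the induction hypothesis into the hypothesis on sets
   of [weighted_image]. *)
move=> A mAA; pose B' i := if i == k then A else B i.
have mB' i : measurable (B' i).
  by rewrite /B'; case: eqP => _; [exact: mAA|exact: mB].
have E3 : \prod_(i < n) M k B' i = (\prod_(i < n | i != ko) M k.+1 B i) * fine (N k A).
  rewrite (bigD1 ko)//= mulrC; congr (_ * _); last by rewrite /M ltnn /B' eqxx.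
  by apply: eq_bigr => i ik; rewrite /M neqk// /B' (negbTE (ik : val i != k)).
have -> : ((\prod_(i < n | i != ko) M k.+1 B i)%:E * N k A)%E = (\prod_(i < n) M k B' i)%:E.
  by rewrite E3 EFinM fineK// Nfin.
rewrite -(IH (ltnW kn) _ mB'); apply: eq_integral => w _.
rewrite [in RHS](bigD1 ko)//= [in RHS]mulrC; congr (_ * _)%:E.
  by apply: eq_bigr => i ik; rewrite /F neqk// /B' (negbTE (ik : val i != k)).
by rewrite /F ltnn /B' eqxx.
Qed.

Section wiener.
Context {R : realType}.
Local Notation Omega := (wiener_space R).

Lemma measurable_coordinate (t : half_line R) :
  measurable_fun setT (coordinate t : Omega -> R).
Proof.
move=> _ B mB; rewrite setTI; apply: sub_sigma_algebra.
by exists t, B.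
Qed.

Lemma increments_mgf (P : probability Omega R) (hP : is_wiener_measure P)
    (n : nat) (t : nat -> half_line R) (a : nat -> R) :
  (forall i, (i < n)%N -> time (t i) < time (t i.+1)) ->
  (\int[P]_w (expR (\sum_(i < n) a i * (coordinate (t i.+1) w - coordinate (t i) w)))%:E =
   (expR ((\sum_(i < n) a i ^+ 2 * (time (t i.+1) - time (t i))) / 2))%:E)%E.
Proof.
move=> tlt; have [_ hP2] := hP.
(* [independent_expectation] requires a law at every index, and [gaussian_mgf] a nonzero deviation;
   beyond n the value 1 is a filler. *)
pose dt i := if (i < n)%N then time (t i.+1) - time (t i) else 1.
have dt0 i : 0 < dt i by rewrite /dt; case: ifP => // /tlt; rewrite subr_gt0.
pose s i := Num.sqrt (dt i).
have s0 i : s i != 0 by rewrite gt_eqF// sqrtr_gt0.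
have := @independent_expectation _ _ _ P
  (fun i (w : Omega) => coordinate (t i.+1) w - coordinate (t i) w)
  (fun i => normal_prob 0 (s i)) (fun i x => expR (a i * x))
  (fun i => expR (a i ^+ 2 * s i ^+ 2 / 2)) n _ _ _ _ _.
move=> ind.
under eq_integral do rewrite expR_sum.
rewrite ind.
- rewrite mulr_suml expR_sum; congr EFin; apply: eq_bigr => i _.
  by rewrite /s sqr_sqrtr ?(ltW (dt0 _))// /dt ltn_ord.
- by move=> i; apply: measurable_funB; exact: measurable_coordinate.
- move=> B mB; apply: (eq_trans (hP2 n t B tlt mB)); apply: eq_bigr => i _.
  have -> // : s i = Num.sqrt (time (t i.+1) - time (t i)).
  by rewrite /s /dt ltn_ord.
- by move=> i; apply: measurableT_comp => //; exact: measurable_funM.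
- by move=> i x; exact: expR_ge0.
- by move=> i; exact: gaussian_mgf.
Qed.

End wiener.

Lemma cvge0P (R : realType) (u : nat -> \bar R) : (forall n, (0 <= u n)%E) ->
  (forall e : R, 0 < e -> exists N, forall n, (N <= n)%N -> (u n < e%:E)%E) ->
  u @ \oo --> 0%E.
Proof.
move=> u0 ue; apply/fine_cvgP; split.
  have [N NP] := ue 1 ltr01; exists N => // n /NP un.
  by rewrite ge0_fin_numE// (lt_trans un)// ltry.
apply/cvgrPdist_lt => e e0; have [N NP] := ue e e0.
exists N => // n /NP un /=; rewrite sub0r normrN ger0_norm ?fine_ge0//.
by rewrite -lte_fin fineK// ge0_fin_numE// (lt_trans un)// ltry.
Qed.

(** * Convergence in L^2 *)

Section L2_convergence.
Context {d} {T : measurableType d} {R : realType}.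
Variable mu : {measure set T -> \bar R}.
Implicit Types (f g : T -> R).

Lemma Lnorm2_energy f : (Lnorm mu 2%:E (fun x => (f x)%:E) `^ 2 = energy mu f)%E.
Proof.
rewrite (@poweR_Lnorm _ _ _ mu (fun x => (f x)%:E) 2)//.
by apply: eq_integral => x _; rewrite abse_EFin poweR_EFin powR_mulrn// -normrX ger0_norm// sqr_ge0.
Qed.

Lemma Lnorm2_cvg0 (f_ : nat -> T -> R) :
  Lnorm mu 2%:E (fun x => (f_ n x)%:E) @[n --> \oo] --> 0%E <->
  forall e : R, 0 < e -> exists N, forall n, (N <= n)%N -> (energy mu (f_ n) < e%:E)%E.
Proof.
split=> [/cvge0_lt h e e0|h].
  (* Half of e, because the monotonicity of the square is used in its non-strict form. *)
  have s0 : 0 < Num.sqrt (e / 2) by rewrite sqrtr_gt0 divr_gt0.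
  have [N NP] := h _ s0; exists N => n /NP; rewrite -Lnorm2_energy => ne.
  apply: (@le_lt_trans _ _ (e / 2)%:E); last by rewrite lte_fin; lra.
  have -> : ((e / 2)%:E = (Num.sqrt (e / 2))%:E `^ 2)%E.
    by rewrite poweR_EFin powR_mulrn ?sqr_sqrtr// divr_ge0// ltW.
  rewrite gt0_ler_poweR ?(ltW ne)//; last by rewrite in_itv/= leey lee_fin ltW.
  by rewrite in_itv/= leey Lnorm_ge0.
apply: cvge0P => [n|e e0]; first exact: Lnorm_ge0.
have [N NP] := h _ (exprn_gt0 2 e0); exists N => n /NP.
rewrite -Lnorm2_energy; apply: contraTT; rewrite -!leNgt => en.
have -> : ((e ^+ 2)%:E = e%:E `^ 2)%E by rewrite poweR_EFin powR_mulrn// ltW.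
by rewrite gt0_ler_poweR// in_itv/= ?leey ?andbT ?Lnorm_ge0// lee_fin ltW.
Qed.

(** Multiplication by phi enlarges the energy by at most K^2, so it passes from D to its closure by
    continuity. *)
Lemma multiplier_closure (D : set (T -> R)) (phi : T -> R) (K : R) : subspace mu D ->
  measurable_fun setT phi -> (forall x, `|phi x| <= K) ->
  (forall f, D f -> L2_closure mu D (fun x => phi x * f x)) ->
  multiplier (L2_closure mu D) phi.
Proof.
move=> sD mphi bphi Dphi; have cD := L2_closure_closed sD.
split=> //; first by exists K.
move=> f [sf fD]; apply: (closed_lim cD); first exact: sqint_bndM bphi sf.
move=> e e0; have K0 : 0 < K ^+ 2 + 1 by rewrite ltr_wpDl// sqr_ge0.
have [g Dg fg] := fD _ (divr_gt0 e0 K0).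
exists (fun x => phi x * g x); first exact: Dphi.
have [mf _] := sf; have [mg _] := subspace_sqint sD Dg.
have mfg : measurable_fun setT (fun x => f x - g x) by exact: measurable_funB.
apply: (@le_lt_trans _ _ (energy mu (fun x => K * (f x - g x)))).
  apply: energy_le.
  - by apply: measurable_funB; exact: measurable_funM.
  - exact: measurable_funM.
  - move=> x; rewrite -mulrBr !normrM ler_wpM2r// (le_trans (bphi x))//.
    exact: ler_norm.
rewrite energyZ//.
have [a aE] : exists a, energy mu (fun x => f x - g x) = a%:E.
  exists (fine (energy mu (fun x => f x - g x))); rewrite fineK// ge0_fin_numE ?energy_ge0//.
  by rewrite (lt_trans fg)// ltry.
have := energy_ge0 mu (fun x => f x - g x).
move: fg; rewrite aE -EFinM !lte_fin lee_fin ltr_pdivlMr// => h1 h2; nra.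
Qed.

Lemma multiplier_ae (C : set (T -> R)) (phi psi : T -> R) (K : R) :
  closed_subspace mu C -> measurable_fun setT phi -> (forall x, `|phi x| <= K) ->
  phi = psi %[ae mu] -> multiplier C psi -> multiplier C phi.
Proof.
move=> cC mphi bphi pp [mpsi _ Cpsi]; split=> //; first by exists K.
move=> f Cf; apply: (closed_ae cC _ (Cpsi _ Cf)).
  by apply: sqint_bndM bphi _ => //; exact: closed_sqint Cf.
by apply: filterS pp => x /= + xT => ->.
Qed.

(* The integrals of [G_ n] are bounded: choose first [e] small, then [n] large. *)
Lemma integral_cvg_quadratic (F_ G_ X_ : nat -> T -> R) (F X : T -> R) (K : R) :
  (forall n, measurable_fun setT (F_ n)) -> measurable_fun setT F ->
  (forall n, measurable_fun setT (G_ n)) ->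
  (forall n, measurable_fun setT (X_ n)) -> measurable_fun setT X ->
  (forall n x, 0 <= F_ n x) -> (forall x, 0 <= F x) -> (forall n x, 0 <= G_ n x) ->
  (forall n, (\int[mu]_x (G_ n x)%:E <= K%:E)%E) ->
  (forall e : R, 0 < e -> exists N, forall n, (N <= n)%N ->
     (energy mu (fun x => (X_ n x - X x)%R) < e%:E)%E) ->
  (forall n x e, 0 < e ->
     `|F_ n x - F x| <= e^-1 * (X_ n x - X x) ^+ 2 + e * G_ n x) ->
  (\int[mu]_x (F x)%:E < +oo)%E ->
  (\int[mu]_x (F_ n x)%:E)%E @[n --> \oo] --> (\int[mu]_x (F x)%:E)%E.
Proof.
move=> mF_ mF mG mX_ mX F_0 F0 G0 GK Xcv FF Foo.
have Ffin : (\int[mu]_x (F x)%:E)%E \is a fin_num.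
  by rewrite ge0_fin_numE// integral_ge0// => x _; rewrite lee_fin.
have K0 : 0 <= K.
  rewrite -lee_fin (le_trans _ (GK 0%N))// integral_ge0// => x _.
  by rewrite lee_fin.
have mXX n : measurable_fun setT (fun x => X_ n x - X x) by exact: measurable_funB.
have dist (U V : T -> R) n e : 0 < e ->
    measurable_fun setT U -> measurable_fun setT V ->
    (forall x, 0 <= U x) -> (forall x, 0 <= V x) ->
    (forall x, `|U x - V x| <= e^-1 * (X_ n x - X x) ^+ 2 + e * G_ n x) ->
    (\int[mu]_x (U x)%:E <= \int[mu]_x (V x)%:E +
      (e^-1%:E * energy mu (fun x => (X_ n x - X x)%R) + e%:E * K%:E))%E.
  move=> e0 mU mV U0 V0 UV.
  have me1 : measurable_fun setT (fun x => e^-1 * (X_ n x - X x) ^+ 2).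
    by apply: measurable_funM => //; exact: measurable_funX.
  have me2 : measurable_fun setT (fun x => e * G_ n x) by exact: measurable_funM.
  apply: (@le_trans _ _ (\int[mu]_x ((V x)%:E + ((e^-1 * (X_ n x - X x) ^+ 2)%:E + (e * G_ n x)%:E)))%E).
    apply: ge0_le_integral => //.
    - by move=> x _; rewrite lee_fin.
    - exact/measurable_EFinP.
    - by apply: emeasurable_funD; [|apply: emeasurable_funD]; exact/measurable_EFinP.
    - move=> x _; rewrite -!EFinD lee_fin -lerBlDl; apply: le_trans (UV x).
      exact: ler_norm.
  have p1 x : (0 <= (e^-1 * (X_ n x - X x) ^+ 2)%:E)%E.
    by rewrite lee_fin mulr_ge0 ?sqr_ge0// invr_ge0 ltW.
  have p2 x : (0 <= (e * G_ n x)%:E)%E by rewrite lee_fin mulr_ge0// ltW.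
  rewrite ge0_integralD//; last 4 first.
  - by move=> x _; rewrite lee_fin.
  - exact/measurable_EFinP.
  - by move=> x _; exact: adde_ge0.
  - by apply: emeasurable_funD; exact/measurable_EFinP.
  apply: leeD2l; rewrite ge0_integralD//; try exact/measurable_EFinP.
  under eq_integral do rewrite EFinM.
  rewrite ge0_integralZl_EFin ?invr_ge0 ?(ltW e0)//; last 2 first.
  - by move=> x _; rewrite lee_fin sqr_ge0.
  - exact: measurable_sqr.
  apply: leeD2l; under eq_integral do rewrite EFinM.
  rewrite ge0_integralZl_EFin ?(ltW e0)//; last 2 first.
  - by move=> x _; rewrite lee_fin.
  - exact/measurable_EFinP.
  by apply: lee_wpmul2l => //; rewrite lee_fin ltW.
have main (e : R) : 0 < e -> exists N, forall n, (N <= n)%N ->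
    (\int[mu]_x (F_ n x)%:E <= \int[mu]_x (F x)%:E + e%:E)%E /\
    (\int[mu]_x (F x)%:E <= \int[mu]_x (F_ n x)%:E + e%:E)%E.
  (* This is the small parameter, chosen so that [dl * K <= e / 2] whatever n is; n is then taken so
     large that the quadratic term is below e / 2 too. *)
  move=> e0; pose dl := e / 2 / (K + 1).
  have K1 : 0 < K + 1 by rewrite ltr_wpDl.
  have dl0 : 0 < dl by rewrite !divr_gt0.
  have dlK : dl * K <= e / 2.
    have : dl * (K + 1) = e / 2 by rewrite /dl -mulrA mulVf ?mulr1 ?gt_eqF.
    by move=> h; nra.
  have [N NP] := Xcv (dl * (e / 2)) ltac:(by rewrite mulr_gt0// divr_gt0).
  exists N => n /NP Xn.
  have small : (dl^-1%:E * energy mu (fun x => (X_ n x - X x)%R) + dl%:E * K%:E <= e%:E)%E.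
    have -> : e%:E = ((e / 2)%:E + (e / 2)%:E)%E by rewrite -EFinD -splitr.
    apply: leeD; last by rewrite -EFinM lee_fin.
    apply: (@le_trans _ _ (dl^-1%:E * (dl * (e / 2))%:E)%E).
      by apply: lee_wpmul2l; [rewrite lee_fin invr_ge0 ltW|exact: ltW].
    by rewrite -EFinM lee_fin mulKf// gt_eqF.
  split.
    apply: le_trans (dist _ _ n dl dl0 (mF_ n) mF (F_0 n) F0 (fun x => FF n x dl dl0)) _.
    exact: leeD2l.
  apply: le_trans (dist _ _ n dl dl0 mF (mF_ n) F0 (F_0 n) _) _; last exact: leeD2l.
  by move=> x; rewrite distrC; exact: FF.
have Fn0 n : (0 <= \int[mu]_x (F_ n x)%:E)%E.
  by apply: integral_ge0 => x _; rewrite lee_fin.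
rewrite -(fineK Ffin); apply/fine_cvgP; split.
  have [N NP] := main 1 ltr01; exists N => // n /NP[h _].
  by rewrite ge0_fin_numE// (le_lt_trans h)// lte_add_pinfty// ltry.
apply/cvgrPdist_le => e e0; have [N NP] := main e e0.
exists N => // n /NP[h1 h2] /=.
have Fnfin : (\int[mu]_x (F_ n x)%:E)%E \is a fin_num.
  by rewrite ge0_fin_numE// (le_lt_trans h1)// lte_add_pinfty// ltry.
move: h1 h2; rewrite -(fineK Ffin) -(fineK Fnfin) -!EFinD !lee_fin /= => h1 h2.
by rewrite ler_norml; apply/andP; split; lra.
Qed.

(** |u^2 - v^2| = |u - v| |u + v| is split by the inequality between arithmetic and geometric means
    into the form that [integral_cvg_quadratic] expects. The bound 1 on the distances makes the
    energies of [f_ n] bounded uniformly in n. *)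
Lemma energy_cvg (f_ : nat -> T -> R) f : (forall n, sqint mu (f_ n)) -> sqint mu f ->
  (forall n, (energy mu (fun x => (f_ n x - f x)%R) <= 1)%E) ->
  (forall e : R, 0 < e -> exists N, forall n, (N <= n)%N ->
     (energy mu (fun x => (f_ n x - f x)%R) < e%:E)%E) ->
  energy mu (f_ n) @[n --> \oo] --> energy mu f.
Proof.
move=> sf_ sf f1 fcv; have [mf foo] := sf.
have mf_ n : measurable_fun setT (f_ n) by case: (sf_ n).
have [a aE] : exists a, energy mu f = a%:E.
  by exists (fine (energy mu f)); rewrite fineK// ge0_fin_numE ?energy_ge0.
have fb n : (energy mu (f_ n) <= (2 + 2 * a)%:E)%E.
  have := energyD mu (measurable_funB (mf_ n) mf) mf.
  under eq_fun do rewrite subrK.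
  move=> /le_trans; apply; rewrite aE.
  have -> : ((2 + 2 * a)%:E = 2%:E + 2%:E * a%:E)%E by rewrite -EFinM -EFinD.
  apply: leeD => //.
  by rewrite -[leRHS]mule1; apply: lee_wpmul2l; rewrite ?lee_fin//; exact: (f1 n).
apply: (@integral_cvg_quadratic (fun n x => f_ n x ^+ 2)
  (fun n x => f_ n x ^+ 2 + f x ^+ 2) f_ _ f (2 + 2 * a + a)) => //.
- by move=> n; exact: measurable_funX.
- exact: measurable_funX.
- by move=> n; apply: measurable_funD; exact: measurable_funX.
- by move=> n x; exact: sqr_ge0.
- by move=> x; exact: sqr_ge0.
- by move=> n x; rewrite addr_ge0 ?sqr_ge0.
- move=> n; under eq_integral do rewrite EFinD.
  rewrite ge0_integralD//; do ?[exact: measurable_sqr|by move=> x _; rewrite lee_fin sqr_ge0].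
  by rewrite EFinD; apply: leeD; [exact: fb|rewrite -aE].
- move=> n x e e0; have h : e^-1 * e = 1 by rewrite mulVf// gt_eqF.
  have i0 : 0 < e^-1 by rewrite invr_gt0.
  set u := f_ n x; set v := f x.
  have -> : e^-1 * (u - v) ^+ 2 + e * (u ^+ 2 + v ^+ 2) =
     e^-1 * ((u - v) ^+ 2 + e ^+ 2 * (u ^+ 2 + v ^+ 2)).
    have ? : e != 0 by rewrite gt_eqF.
    by field.
  rewrite -ler_pdivrMl ?invr_gt0 ?invrK//.
  have p1 := sqr_ge0 (`|u - v| - e * `|u + v| / 2).
  have p2 : e * `|u ^+ 2 - v ^+ 2| = `|u - v| * (e * `|u + v|).
    by rewrite subr_sqr normrM mulrCA.
  rewrite p2 -(real_normK (num_real (u - v))).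
  have p3 : (e * `|u + v|) ^+ 2 <= 2 * (e ^+ 2 * (u ^+ 2 + v ^+ 2)).
    rewrite exprMn real_normK ?num_real//.
    have := sqr_ge0 (u - v); have := sqr_ge0 e; nra.
  set A := `|u - v| in p1 *; set B := e * `|u + v| in p1 p3 *.
  have : B ^+ 2 / 2 <= e ^+ 2 * (u ^+ 2 + v ^+ 2) by lra.
  have := sqr_ge0 B; nra.
Qed.

End L2_convergence.

(** The right-hand side is 4 (exp(y/2) - exp(-y/2))^2, and for y >= 0 the difference is at least
    y/2. This converts a bound on the Laplace transform into one on the second moment. *)
Lemma sqr_le_expR (R : realType) (y : R) : y ^+ 2 <= 4 * (expR y + expR (- y) - 2).
Proof.
wlog y0 : y / 0 <= y.
  move=> gen; have [/gen//|/ltW y0] := leP 0 y.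
  by have := gen (- y); rewrite sqrrN opprK oppr_ge0 [expR (- y) + _]addrC; exact.
have h : expR (y / 2) * expR (- (y / 2)) = 1 by rewrite -expRD subrr expR0.
have e1 : expR y = expR (y / 2) ^+ 2 by rewrite expr2 -expRD -splitr.
have e2 : expR (- y) = expR (- (y / 2)) ^+ 2 by rewrite expr2 -expRD -opprD -splitr.
have h1 := expR_ge1Dx (y / 2).
have h2 : expR (- (y / 2)) <= 1 by rewrite -[leRHS]expR0 ler_expR; lra.
have : (expR (y / 2) - expR (- (y / 2))) ^+ 2 = expR y + expR (- y) - 2.
  by rewrite e1 e2 sqrrB h; lra.
move=> <-; have : y / 2 <= expR (y / 2) - expR (- (y / 2)) by lra.
set A := _ - _ => h3; have : 0 <= y / 2 by lra.
nra.
Qed.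

Lemma expR_half_le (R : realType) (v : R) : 0 <= v <= 2^-1 -> expR v - 1 <= 2 * v.
Proof.
move=> /andP[v0 v1]; have := expR_ge1Dx (- v).
have : expR v * expR (- v) = 1 by rewrite -expRD subrr expR0.
have := expR_gt0 v; set A := expR v; set B := expR (- v) => A0 AB B1.
have : A * (1 - v) <= 1 by rewrite -AB; nra.
nra.
Qed.

Lemma integral_prob_cst d (T : measurableType d) (R : realType)
  (P : probability T R) (c : R) : (\int[P]_w c%:E = c%:E)%E.
Proof.
rewrite (integral_cst P measurableT c%:E) -[RHS]mule1; congr (_ * _)%E.
exact: probability_setT.
Qed.

(** * The Wiener integral *)

Section steps.
Context {R : realType}.
Local Notation Omega := (wiener_space R).
Local Notation hm := (halfline_measure R).
Implicit Types (s : seq (R * half_line R)).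

Definition to_time (x : R) : half_line R :=
  match asboolP (x \in (`[0%R, +oo[%classic : set R)) with
  | ReflectT p => exist _ x p
  | ReflectF _ => time0
  end.

Lemma to_timeK (x : R) : 0 <= x -> time (to_time x) = x.
Proof.
move=> x0; rewrite /to_time; case: asboolP => //= -[].
by rewrite inE /= in_itv/= x0.
Qed.

Lemma time_ge0 (t : half_line R) : 0 <= time t.
Proof. by have := valP t; rewrite inE/= in_itv/= andbT. Qed.

Lemma time_inj : injective (@time R).
Proof. by move=> t u /val_inj. Qed.

Lemma timeK (t : half_line R) : to_time (time t) = t.
Proof. by apply: time_inj; rewrite to_timeK// time_ge0. Qed.

(* Summation by parts over the sorted list of the jump times. *)
Lemma step_partition s : exists (n : nat) (tau : nat -> half_line R) (a : nat -> R),
  (forall i, (i < n)%N -> time (tau i) < time (tau i.+1)) /\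
  forall phi : half_line R -> R,
    \sum_(ct <- s) ct.1 * (phi ct.2 - phi time0) =
    \sum_(i < n) a i * (phi (tau i.+1) - phi (tau i)).
Proof.
pose r : seq R := sort <=%R (undup (0 :: map (fun ct => time ct.2) s)).
have r0 : 0 \in r by rewrite mem_sort mem_undup mem_head.
have rs ct : ct \in s -> time ct.2 \in r.
  move=> cs; rewrite mem_sort mem_undup in_cons; apply/orP; right.
  exact: (map_f (fun ct : R * half_line R => time ct.2) cs).
have rge x : x \in r -> 0 <= x.
  rewrite mem_sort mem_undup inE => /orP[/eqP->//|/mapP[ct _ ->]].
  exact: time_ge0.
have rsort : sorted <%R r by rewrite lt_sorted_uniq_le sort_uniq undup_uniq sort_le_sorted.
have rmono i j : (i < j)%N -> (j < size r)%N -> r`_i < r`_j.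
  move=> ij jr; apply: (sorted_ltn_nth lt_trans 0 rsort) => //.
  by rewrite inE (ltn_trans ij).
have r00 : r`_0 = 0.
  apply/eqP; rewrite eq_le rge ?mem_nth ?andbT//; last by case: (r) r0.
  have : (index 0%R r < size r)%N by rewrite index_mem.
  have := nth_index 0 r0; case: (index 0%R r) => [->//|k rk] kr.
  by apply: le_trans (ltW (rmono 0%N k.+1 isT kr)) _; rewrite rk.
pose tau i := to_time r`_i.
have tauE i : (i < size r)%N -> time (tau i) = r`_i.
  by move=> ir; rewrite to_timeK// rge// mem_nth.
(* The increment between the points i and i + 1 of r is covered by exactly those steps whose end has
   an index greater than i; their coefficients add up. *)
exists (size r).-1, tau, (fun i => \sum_(ct <- s) ct.1 * (i < index (time ct.2) r)%:R).
split=> [i ir|phi].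
  have ir' : (i.+1 < size r)%N by case: (size r) ir.
  by rewrite !tauE ?(ltnW ir')// rmono.
under [RHS]eq_bigr do rewrite mulr_suml.
rewrite exchange_big/= [LHS]big_seq [RHS]big_seq; apply: eq_bigr => ct cs.
under eq_bigr do rewrite -mulrA.
rewrite -mulr_sumr; congr (_ * _).
have jr : (index (time ct.2) r < size r)%N by rewrite index_mem rs.
set j := index _ r in jr *.
rewrite -(big_mkord xpredT (fun i => (i < j)%:R * (phi (tau i.+1) - phi (tau i)))).
rewrite (big_cat_nat (n := j))//=; last by case: (size r) jr.
rewrite [X in _ = _ + X]big_nat_cond [X in _ = _ + X]big1 ?addr0; last first.
  by move=> i /andP[/andP[ji _] _]; rewrite ltnNge ji mul0r.
rewrite big_nat_cond.
under eq_bigr => i /andP[/andP[_ ij] _] do rewrite ij mul1r.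
rewrite -big_nat_cond telescope_sumr//.
by rewrite /tau nth_index ?rs// timeK r00 -[0]/(time (time0 : half_line R)) timeK.
Qed.

Let ind (t : half_line R) (x : R) : R := \1_(`]0, time t]%classic : set R) x.

(** The form to which [step_partition] applies; the subtracted term vanishes because ]0, 0] is
    empty. *)
Lemma step_funE s x :
  step_fun s x = \sum_(ct <- s) ct.1 * (ind ct.2 x - ind time0 x).
Proof.
have -> : ind time0 x = 0; last by apply: eq_bigr => ct _; rewrite subr0.
rewrite /ind indicE memNset//= in_itv/= => /andP[x0 x1].
by have := lt_le_trans x0 x1; rewrite ltxx.
Qed.

Lemma halfline_measure_itv (a b : R) : 0 <= a -> a <= b ->
  hm `]a, b]%classic = (b - a)%:E.
Proof.
move=> a0 ab.
rewrite -[LHS]/(lebesgue_measure (`]a, b]%classic `&` `]0, +oo[%classic)) setIidl; last first.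
  by move=> x /=; rewrite !in_itv/= andbT => /andP[ax _]; exact: le_lt_trans ax.
rewrite lebesgue_measure_itv/= lte_fin; case: ltP => // ba.
by rewrite (_ : a = b) ?subrr//; apply/eqP; rewrite eq_le ab.
Qed.

(** The intervals are disjoint, so the square has no cross terms. The value is the variance that
    appears in [increments_mgf]. *)
Lemma energy_step (n : nat) (tau : nat -> half_line R) (a : nat -> R) :
  (forall i, (i < n)%N -> time (tau i) < time (tau i.+1)) ->
  energy hm (fun x => \sum_(i < n) a i * (ind (tau i.+1) x - ind (tau i) x)) =
  (\sum_(i < n) a i ^+ 2 * (time (tau i.+1) - time (tau i)))%:E.
Proof.
move=> tlt; pose I i : set R := `]time (tau i), time (tau i.+1)]%classic.
have mono i j : (i <= j)%N -> (j <= n)%N -> time (tau i) <= time (tau j).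
  move=> /subnK<-; elim: (j - i)%N => [|k IH]//= kn.
  by rewrite addSn; apply: le_trans (IH (ltnW kn)) (ltW (tlt _ _)).
have indE i x : (i < n)%N -> ind (tau i.+1) x - ind (tau i) x = \1_(I i) x.
  move=> /tlt lti; rewrite /ind !indicE !mem_setE !in_itv/=.
  have t0 := time_ge0 (tau i).
  have [x0|x0] := ltP 0 x => /=; last first.
    by rewrite subrr ltNge (le_trans x0 t0).
  have [x1|x1] := leP x (time (tau i)); last by rewrite subr0.
  by rewrite (le_trans x1 (ltW lti)) subrr.
rewrite /energy.
transitivity (\int[hm]_x (\sum_(i < n) (a i ^+ 2)%:E * (\1_(I i) x)%:E))%E.
  apply: eq_integral => x _.
  under eq_bigr => i _ do rewrite indE//.
  under [RHS]eq_bigr do rewrite -EFinM.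
  rewrite sumEFin; congr EFin.
  rewrite expr2 big_distrlr/=; apply: eq_bigr => i _.
  rewrite (bigD1 i)//= [X in _ + X]big1 ?addr0.
    by rewrite !indicE; case: (_ \in _); rewrite ?mulr1 ?mulr0 ?expr2.
  move=> j ji; rewrite mulrACA !indicE.
  have [|] := boolP (x \in I i); last by rewrite mul0r mulr0.
  have [|] := boolP (x \in I j); last by rewrite mulr0 mulr0.
  rewrite !inE /I/= !in_itv/= => /andP[h1 h2] /andP[h3 h4]; exfalso.
  have /orP[ij|ij] : (i < j)%N || (j < i)%N by rewrite -neq_ltn eq_sym.
  - have := le_lt_trans (mono _ _ ij (ltnW (ltn_ord j))) h1.
    by rewrite ltNge h4.
  - have := le_lt_trans (mono _ _ ij (ltnW (ltn_ord i))) h3.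
    by rewrite ltNge h2.
have mI i : measurable_fun (setT : set (measurableTypeR R)) (fun x => (\1_(I i) x)%:E : \bar R).
  by apply/measurable_EFinP; apply: measurable_indic; exact: measurable_itv.
rewrite ge0_integral_sum//; last 2 first.
- move=> i; apply: emeasurable_funM => //; exact: mI.
- by move=> i x _; rewrite -EFinM lee_fin mulr_ge0 ?sqr_ge0// indicE.
rewrite -sumEFin; apply: eq_bigr => i _.
rewrite ge0_integralZl_EFin ?sqr_ge0//.
  rewrite integral_indic ?setIT//; last exact: measurable_itv.
  by rewrite halfline_measure_itv ?time_ge0 ?EFinM// ltW// tlt.
Qed.

Lemma sqint_step_fun s : sqint hm (step_fun s).
Proof.
have [n [tau [a [tlt tE]]]] := step_partition s.
have E : step_fun s = (fun x => \sum_(i < n) a i * (ind (tau i.+1) x - ind (tau i) x)).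
  by apply/funext => x; rewrite step_funE (tE (fun t => ind t x)).
split; last by rewrite E energy_step// ltry.
rewrite E; apply: measurable_sum => i; apply: measurable_funM => //.
by apply: measurable_funB; apply: measurable_indic; exact: measurable_itv.
Qed.

Variables (P : probability Omega R) (hP : is_wiener_measure P).

(** [step_partition] holds for every function of time, so one partition rewrites both the step
    function and its integral along a path. *)
Lemma step_mgf s :
  (\int[P]_w (expR (step_integral s w))%:E =
   (expR (fine (energy hm (step_fun s)) / 2))%:E)%E.
Proof.
have [n [tau [a [tlt tE]]]] := step_partition s.
have -> : step_fun s = (fun x => \sum_(i < n) a i * (ind (tau i.+1) x - ind (tau i) x)).
  by apply/funext => x; rewrite step_funE (tE (fun t => ind t x)).
rewrite energy_step//; apply: etrans (increments_mgf hP a tlt).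
by apply: eq_integral => w _; rewrite /step_integral (tE (fun t => coordinate t w)).
Qed.

Lemma measurable_step_integral s : measurable_fun setT (step_integral s : Omega -> R).
Proof.
apply: measurable_sum => ct; apply: measurable_funM => //.
by apply: measurable_funB; exact: measurable_coordinate.
Qed.

Definition step_lin (c : R) s s' := map (fun ct => (c * ct.1, ct.2)) s ++ s'.

Lemma step_fun_lin c s s' x :
  step_fun (step_lin c s s') x = c * step_fun s x + step_fun s' x.
Proof.
rewrite /step_fun big_cat big_map mulr_sumr; congr (_ + _).
by apply: eq_bigr => ct _; rewrite mulrA.
Qed.

Lemma step_integral_lin c s s' (w : Omega) :
  step_integral (step_lin c s s') w = c * step_integral s w + step_integral s' w.
Proof.
rewrite /step_integral big_cat big_map mulr_sumr; congr (_ + _).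
by apply: eq_bigr => ct _; rewrite mulrA.
Qed.

(** Let v be the energy of the step function, X the integral and c^2 v <= 1. Then [sqr_le_expR]
    gives (c^2/4) E X^2 + 2 <= 2 exp(c^2 v/2), and exp(c^2 v/2) - 1 <= c^2 v yields E X^2 <= 8 v. *)
Lemma step_integral_bounded s :
  (energy P (step_integral s) <= 8%:E * energy hm (step_fun s))%E.
Proof.
have [ms soo] := sqint_step_fun s.
pose v := fine (energy hm (step_fun s)).
have vE : energy hm (step_fun s) = v%:E.
  by rewrite /v fineK// ge0_fin_numE ?energy_ge0.
have v0 : 0 <= v by rewrite -lee_fin -vE energy_ge0.
have mgf c : (\int[P]_w (expR (c * step_integral s w))%:E = (expR (c ^+ 2 * v / 2))%:E)%E.
  have := step_mgf (step_lin c s [::]).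
  have -> : step_fun (step_lin c s [::]) = (fun x => c * step_fun s x).
    by apply/funext => x; rewrite step_fun_lin /step_fun big_nil addr0.
  rewrite energyZ// vE -EFinM/= => <-; apply: eq_integral => w _.
  by rewrite step_integral_lin [step_integral [::] _]big_nil addr0.
pose X := step_integral s : Omega -> R.
have mX : measurable_fun setT X by exact: measurable_step_integral.
(* This scale is positive even for v = 0 and keeps the exponent c^2 v / 2 within the range of
   [expR_half_le]. *)
pose c := (v + 1)^-1.
have c0 : 0 < c by rewrite invr_gt0 ltr_wpDl.
have cv : c ^+ 2 * v <= 1.
  have h : c * (v + 1) = 1 by rewrite mulVf// gt_eqF// ltr_wpDl.
  have : c <= 1 by rewrite -h; nra.
  by nra.
have me b : measurable_fun setT (fun w => (expR (b * X w))%:E).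
  by apply/measurable_EFinP; apply: measurableT_comp => //; exact: measurable_funM.
(* The constant 2 stands on the left so that both integrands are nonnegative; the second moment is
   not yet known to be finite. *)
have main : (\int[P]_w ((c ^+ 2 / 4)%:E * ((X w) ^+ 2)%:E + 2%:E) <=
    \int[P]_w ((expR (c * X w))%:E + (expR ((- c) * X w))%:E))%E.
  apply: ge0_le_integral => //.
  - by move=> w _; rewrite -EFinM -EFinD lee_fin addr_ge0// mulr_ge0 ?sqr_ge0// divr_ge0 ?sqr_ge0.
  - apply: emeasurable_funD => //; apply: emeasurable_funM => //; exact: measurable_sqr.
  - by apply: emeasurable_funD; exact: me.
  - move=> w _; rewrite -EFinM -!EFinD lee_fin.
    by have := sqr_le_expR (c * X w); rewrite exprMn mulNr => h; lra.
have E1 : (\int[P]_w ((expR (c * X w))%:E + (expR ((- c) * X w))%:E) =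
    (expR (c ^+ 2 * v / 2))%:E + (expR (c ^+ 2 * v / 2))%:E)%E.
  by rewrite ge0_integralD ?mgf ?sqrrN// => w _; rewrite lee_fin expR_ge0.
have E2 : (\int[P]_w ((c ^+ 2 / 4)%:E * ((X w) ^+ 2)%:E + 2%:E) =
    (c ^+ 2 / 4)%:E * energy P X + 2%:E)%E.
  rewrite ge0_integralD//; last 2 first.
  - by move=> w _; rewrite -EFinM lee_fin mulr_ge0 ?sqr_ge0// divr_ge0 ?sqr_ge0.
  - by apply: emeasurable_funM => //; exact: measurable_sqr.
  have c40 : 0 <= c ^+ 2 / 4 by apply: divr_ge0 => //; exact: sqr_ge0.
  rewrite ge0_integralZl_EFin//; last 2 first.
  - by move=> w _; rewrite lee_fin sqr_ge0.
  - exact: measurable_sqr.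
  by rewrite integral_prob_cst.
move: main; rewrite {}E1 {}E2 -EFinD vE -EFinM => main.
have Xfin : energy P X \is a fin_num.
  rewrite ge0_fin_numE ?energy_ge0//; rewrite ltNge leye_eq; apply/negP => /eqP Xoo.
  have c4 : 0 < c ^+ 2 / 4 by apply: divr_gt0 => //; exact: exprn_gt0.
  by move: main; rewrite Xoo gt0_muley ?lte_fin// addye// leye_eq.
move: main; rewrite -(fineK Xfin) -EFinM -EFinD !lee_fin.
set x := fine _ => main.
have h2 : expR (c ^+ 2 * v / 2) - 1 <= 2 * (c ^+ 2 * v / 2).
  by apply: expR_half_le; apply/andP; split; [rewrite divr_ge0// mulr_ge0// sqr_ge0|lra].
have cc : 0 < c ^+ 2 by rewrite exprn_gt0.
have : c ^+ 2 * x <= c ^+ 2 * (8 * v) by lra.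
by rewrite ler_pM2l.
Qed.

Lemma sqint_step_integral s : sqint P (step_integral s).
Proof.
split; first exact: measurable_step_integral.
apply: le_lt_trans (step_integral_bounded s) _.
by rewrite lte_mul_pinfty//; case: (sqint_step_fun s).
Qed.

Lemma step_integral_lipschitz s s' :
  (energy P (fun w => (step_integral s w - step_integral s' w)%R) <=
   8%:E * energy hm (fun x => (step_fun s x - step_fun s' x)%R))%E.
Proof.
have := step_integral_bounded (step_lin (-1) s' s).
have -> : step_fun (step_lin (-1) s' s) = (fun x => step_fun s x - step_fun s' x).
  by apply/funext => x; rewrite step_fun_lin mulN1r addrC.
have -> // : step_integral (step_lin (-1) s' s) = (fun w => step_integral s w - step_integral s' w).
by apply/funext => w; rewrite step_integral_lin mulN1r addrC.
Qed.

End steps.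

Lemma ae_imply d (T : measurableType d) (R : realType)
  (mu : {measure set T -> \bar R}) (A B : T -> Prop) :
  {ae mu, forall x, A x} -> (forall x, A x -> B x) -> {ae mu, forall x, B x}.
Proof. by move=> Aae AB; apply: filterS Aae. Qed.

(** * Density of the step functions in L^2(0, oo) *)

Section dense_steps.
Context {R : realType}.
Local Notation hm := (halfline_measure R).

Let steps : set (R -> R) := [set f | exists s : seq (R * half_line R), f = step_fun s].

Let steps_subspace : subspace hm steps.
Proof.
split.
- by exists [::]; apply/funext => x; rewrite /step_fun big_nil.
- by move=> _ [s ->]; exact: sqint_step_fun.
- move=> c _ _ [s ->] [s' ->]; exists (step_lin c s s').
  by apply/funext => x; rewrite step_fun_lin.
Qed.

Let C := L2_closure hm steps.
Let cC : closed_subspace hm C := L2_closure_closed steps_subspace.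

Lemma halfline_measure_ae_pos : {ae hm, forall x, 0 < x}.
Proof.
exists `]-oo, 0]%classic; split; first exact: measurable_itv.
  rewrite -[LHS]/(lebesgue_measure (`]-oo, 0]%classic `&` `]0, +oo[%classic)).
  rewrite (_ : _ `&` _ = set0) ?measure0//.
  apply/seteqP; split => // x /= []; rewrite !in_itv/= andbT => x0.
  by rewrite ltNge x0.
by move=> x /= /negP; rewrite in_itv/= -leNgt.
Qed.

(** The product of the indicators of ]0, t] and ]0, u] is that of ]0, min(t, u)], so step functions
    are sent to step functions. *)
Let multiplier_ioc (t : half_line R) :
  multiplier C (\1_(`]0, time t]%classic : set R)).
Proof.
apply: (multiplier_closure steps_subspace (K := 1)).
- by apply: measurable_indic; exact: measurable_itv.
- by move=> x; rewrite indicE; case: (_ \in _); rewrite ?normr1 ?normr0.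
move=> _ [s ->]; apply: (sub_L2_closure steps_subspace).
exists (map (fun ct => (ct.1, to_time (Num.min (time t) (time ct.2)))) s).
apply/funext => x; rewrite /step_fun big_map mulr_sumr; apply: eq_bigr => ct _.
rewrite mulrCA; congr (_ * _); rewrite /= to_timeK; last first.
  by rewrite le_min !time_ge0.
rewrite !indicE !mem_setE !in_itv/= le_min.
by case: (0 < x) => //=; rewrite ?mulr0//; case: (x <= time t); rewrite ?mul1r ?mul0r.
Qed.

(** Rays generate the Borel sets. As the measure lives on x > 0, the indicator of ]x,
    oo[ is almost everywhere 1 minus that of ]0, x] when x >= 0, and 1 when x < 0. *)
Let measurable_multiplier (E : set (measurableTypeR R)) :
  measurable E -> multiplier_set C E.
Proof.
move=> mE.
have : (@RGenOInfty.G R).-sigma.-measurable E by rewrite -RGenOInfty.measurableE.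
apply: smallest_sub; first exact: (multiplier_sigma_algebra cC).
move=> _ [x ->]; rewrite /multiplier_set/=.
have ind1 (A : set R) y : `|\1_A y| <= 1 :> R.
  by rewrite indicE; case: (_ \in _); rewrite ?normr1 ?normr0.
have mI : measurable_fun setT (\1_(`]x, +oo[%classic : set R) : measurableTypeR R -> R).
  by apply: measurable_indic; exact: measurable_itv.
have [x0|x0] := leP 0 x.
  apply: (multiplier_ae cC mI (ind1 _) _ (multiplierBl cC 1 (multiplier_ioc (to_time x)))).
  apply: (ae_imply halfline_measure_ae_pos) => y y0 _.
  rewrite !indicE !mem_setE !in_itv/= andbT y0 to_timeK//= ltNge.
  by case: (y <= x); rewrite ?subrr ?subr0.
apply: (multiplier_ae cC mI (ind1 _) _ (multiplier_cst cC 1)).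
apply: (ae_imply halfline_measure_ae_pos) => y y0 _.
by rewrite indicE mem_setE in_itv/= andbT (lt_trans x0 y0).
Qed.

Lemma step_fun_dense (f : R -> R) (e : R) : sqint hm f -> 0 < e ->
  exists s, (energy hm (fun x => (step_fun s x - f x)%R) < e%:E)%E.
Proof.
move=> sf e0.
have [_ /(_ e e0)[_ [s ->] fs]] : C f.
  apply: (multiplier_dense cC measurable_multiplier (E := fun n => `]0, n%:R]%classic)) => //.
  - move=> n; apply: (sub_L2_closure steps_subspace); exists [:: (1, to_time n%:R)].
    by apply/funext => x; rewrite /step_fun big_seq1 mul1r/= to_timeK.
  - apply: (ae_imply halfline_measure_ae_pos) => x x0.
    near=> n; rewrite /= in_itv/= x0/=; near: n; exact: nbhs_infty_ger.
by exists s; rewrite energyB.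
Unshelve. all: by end_near. Qed.

End dense_steps.

(** * Passage between functions and L^2 classes; completeness *)

Section L2_facts.
Context {d} {T : measurableType d} {R : realType}.
Variable mu : {measure set T -> \bar R}.

Lemma L2_sqint (f : L2 mu) : sqint mu f.
Proof. by apply/sqintP; exact: L2_Lfun. Qed.

Lemma L2_measurable (f : L2 mu) : measurable_fun setT f.
Proof. by have [] := L2_sqint f. Qed.

Lemma L2_dotE (f : L2 mu) : (L2_dot mu f f)%:E = energy mu f.
Proof.
rewrite /L2_dot /Rintegral fineK; last exact: (integrable_fin_num measurableT (L2_integrable f f)).
by apply: eq_integral => x _; rewrite expr2.
Qed.

Lemma sqint_L2 (f : T -> R) : sqint mu f -> exists F : L2 mu, L2_fun F = f %[ae mu].
Proof.
move=> /sqintP f2; exists (L2_class (Lfun_Sub (lee1n 2) f2)).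
exact: L2_classK.
Qed.

Lemma L2_subE (f g : L2 mu) : L2_fun (f - g) = (fun t => f t - g t) %[ae mu].
Proof.
rewrite -scaleN1r.
apply: filterS2 (L2_addE f (-1 *: g)) (L2_scaleE (-1) g) => x /= h1 h2 _.
by rewrite h1// h2// mulN1r.
Qed.

Lemma energy_L2_subE (f g : L2 mu) :
  (L2_dot mu (f - g) (f - g))%:E = energy mu (fun x => f x - g x).
Proof.
rewrite L2_dotE; apply: ae_energy (L2_subE f g); first exact: L2_measurable.
by apply: measurable_funB; exact: L2_measurable.
Qed.

Lemma L2_hilbert_space : hilbert_space (L2_dot mu).
Proof.
move=> u ucau; have [||l sl lcv] := @energy_complete _ _ _ mu (fun n => L2_fun (u n : L2 mu)).
- by move=> n; exact: L2_sqint.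
- move=> e e0; have [N NP] := ucau e e0; exists N => m n mN nN.
  by rewrite -energy_L2_subE lte_fin; exact: NP.
have [F Fl] := sqint_L2 sl; exists F => e e0; have [N NP] := lcv e e0.
exists N => n /NP; rewrite -lte_fin energy_L2_subE; apply: le_lt_trans.
rewrite le_eqVlt; apply/orP; left; apply/eqP; apply: ae_energy.
- by apply: measurable_funB; exact: L2_measurable.
- by apply: measurable_funB; [exact: L2_measurable|case: sl].
- by apply: filterS Fl => x /= h xT; rewrite h.
Qed.

End L2_facts.

(** For v <= u, exp u - exp v <= exp(u) (u - v), and this product is split into squares with weights
    1/e and e, as [integral_cvg_quadratic] expects. *)
Lemma ler_dist_expR (R : realType) (u v e : R) : 0 < e ->
  `|expR u - expR v| <= e^-1 * (u - v) ^+ 2 + e * (expR (2 * u) + expR (2 * v)).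
Proof.
move=> e0; wlog uv : u v / v <= u.
  move=> gen; have [/gen//|/ltW/gen] := leP v u.
  by rewrite distrC -sqrrN opprB [expR (2 * v) + _]addrC.
have h : expR u - expR v <= expR u * (u - v).
  have := expR_ge1Dx (v - u); have : expR u * expR (v - u) = expR v.
    by rewrite -expRD addrC subrK.
  by have := expR_gt0 u => h1 h2 h3; nra.
rewrite ger0_norm ?subr_ge0 ?ler_expR//; apply: le_trans h _.
have -> : expR (2 * u) = expR u ^+ 2 by rewrite mulr_natl mulr2n expRD expr2.
have p := sqr_ge0 (expR v); have e1 : e * e^-1 = 1 by rewrite divff// gt_eqF.
have i0 : 0 < e^-1 by rewrite invr_gt0.
have := sqr_ge0 (u - v - e * expR u).
have := sqr_ge0 (expR (2 * v)); have v0 := expR_gt0 (2 * v).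
set a := u - v; set b := expR u => _ h1.
have : 0 <= e^-1 * (a - e * b) ^+ 2 by rewrite mulr_ge0// ltW.
have -> : e^-1 * (a - e * b) ^+ 2 = e^-1 * a ^+ 2 - 2 * (a * b) + e * b ^+ 2.
  by field; rewrite gt_eqF.
have p2 : 0 < e * expR (2 * v) by rewrite mulr_gt0.
have p3 : 0 <= e * b ^+ 2 by rewrite mulr_ge0 ?sqr_ge0// ltW.
have p4 : 0 <= e^-1 * a ^+ 2 by rewrite mulr_ge0 ?sqr_ge0// ltW.
lra.
Qed.

(** * The Wiener integral on all of L^2(0, oo) *)

Section wiener_integral.
Context {R : realType}.
Local Notation Omega := (wiener_space R).
Local Notation hm := (halfline_measure R).
Local Notation LL := (L2 hm).
Variables (P : probability Omega R) (hP : is_wiener_measure P).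

(* The Lipschitz bound with all steps characterizes the Wiener integral and is
   stable under linear combinations. *)
Let W (k : LL) (X : L2 P) := forall s,
  (energy P (fun w => (step_integral s w - X w)%R) <=
   32%:E * energy hm (fun x => (step_fun s x - k x)%R))%E.

(** The constant is 32 = 2 * 8 * 2: one use of [energyBD] on each side of the Lipschitz bound with
    constant 8. The errors of the approximating sequence are absorbed in e. *)
Let is_wiener_integralW k X : is_wiener_integral k X -> W k X.
Proof.
move=> [s_ [/Lnorm2_cvg0 s1 /Lnorm2_cvg0 s2]] s.
have ms s' : measurable_fun setT (step_fun s' : measurableTypeR R -> R) by case: (sqint_step_fun s').
have mi s' : measurable_fun setT (step_integral s' : Omega -> R) by exact: measurable_step_integral.
have mk := L2_measurable k; have mX := L2_measurable X.
apply/lee_addgt0Pr => e e0.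
have [N1 N1P] := s1 (e / 64) ltac:(lra).
have [N2 N2P] := s2 (e / 8) ltac:(lra).
pose n := maxn N1 N2.
have h1 := N1P n (leq_maxl _ _); have h2 := N2P n (leq_maxr _ _).
have h3 := energyBD P (mi s) (mi (s_ n)) mX.
have h4 := step_integral_lipschitz hP s (s_ n).
have h5 := energyBD hm (ms s) mk (ms (s_ n)).
move: h1 h2 h3 h4 h5; rewrite (energyB hm k).
have fin d (T : measurableType d) (mu : {measure set T -> \bar R}) f g :
    sqint mu f -> sqint mu g ->
    exists2 a, energy mu (fun x => (f x - g x)%R) = a%:E & 0 <= a.
  move=> sf sg; have [_ h] := sqintB sf sg.
  exists (fine (energy mu (fun x => f x - g x))); last by rewrite fine_ge0// energy_ge0.
  by rewrite fineK// ge0_fin_numE// energy_ge0.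
have ss (s' : seq (R * half_line R)) : sqint hm (step_fun s') by exact: sqint_step_fun.
have si s' := sqint_step_integral hP s'.
have sk := L2_sqint k; have sX := L2_sqint X.
have [a1 -> p1] := fin _ _ _ _ _ (ss (s_ n)) sk.
have [a2 -> p2] := fin _ _ _ _ _ (si (s_ n)) sX.
have [a3 -> p3] := fin _ _ _ _ _ (si s) sX.
have [a4 -> p4] := fin _ _ _ _ _ (si s) (si (s_ n)).
have [a5 -> p5] := fin _ _ _ _ _ (ss s) (ss (s_ n)).
have [a6 -> p6] := fin _ _ _ _ _ (ss s) sk.
rewrite -!EFinM -!EFinD !lte_fin !lee_fin => h1 h2 h3 h4 h5; lra.
Qed.

Let step_approx (k : LL) : exists s_ : nat -> seq (R * half_line R),
  forall n, (energy hm (fun x => (step_fun (s_ n) x - k x)%R) < (n.+1%:R^-1)%:E)%E.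
Proof.
have sk := L2_sqint k.
have i0 n : 0 < n.+1%:R^-1 :> R by rewrite invr_gt0.
exists (fun n => projT1 (cid (step_fun_dense sk (i0 n)))) => n.
by case: cid.
Qed.

Let inv_small (e : R) : 0 < e -> exists N, forall n, (N <= n)%N -> n.+1%:R^-1 < e.
Proof.
move=> e0; have [N _ NP] := near_infty_natSinv_lt (PosNum e0).
by exists N => n; exact: NP.
Qed.

Let mstep s : measurable_fun setT (step_fun s : measurableTypeR R -> R).
Proof. by have [] := sqint_step_fun s. Qed.

Let mint s : measurable_fun setT (step_integral s : Omega -> R).
Proof. exact: measurable_step_integral. Qed.

(** Existence guarantees that the choice by [xget] in [wiener_integral] does not fall back to its
    default 0. *)
Let wiener_integral_exists (k : LL) : exists X : L2 P, is_wiener_integral k X.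
Proof.
have [s_ sP] := step_approx k.
have scv e : 0 < e -> exists N, forall n, (N <= n)%N ->
    (energy hm (fun x => (step_fun (s_ n) x - k x)%R) < e%:E)%E.
  move=> /inv_small[N NP]; exists N => n /NP nN.
  by apply: lt_trans (sP n) _; rewrite lte_fin.
have [||l sl lcv] := @energy_complete _ _ _ P (fun n => step_integral (s_ n)).
- by move=> n; exact: sqint_step_integral.
- move=> e e0; have [N NP] := scv (e / 64) ltac:(lra); exists N => m n mN nN.
  apply: le_lt_trans (step_integral_lipschitz hP _ _) _.
  have -> : e%:E = (8%:E * (e / 8)%:E)%E by rewrite -EFinM; congr EFin; lra.
  rewrite lte_pmul2l//.
  apply: le_lt_trans (energyBD hm (mstep _) (L2_measurable k) (mstep _)) _.
  rewrite (energyB hm k).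
  have -> : (e / 8)%:E = (2%:E * (e / 32)%:E + 2%:E * (e / 32)%:E)%E.
    by rewrite -!EFinM -EFinD; congr EFin; lra.
  apply: lteD; rewrite lte_pmul2l//.
    by apply: lt_trans (NP m mN) _; rewrite lte_fin; lra.
  by apply: lt_trans (NP n nN) _; rewrite lte_fin; lra.
have [X Xl] := sqint_L2 sl.
exists X, s_; split; apply/Lnorm2_cvg0 => // e e0.
have [N NP] := lcv e e0; exists N => n /NP; apply: le_lt_trans.
rewrite le_eqVlt; apply/orP; left; apply/eqP; apply: ae_energy.
- by apply: measurable_funB => //; exact: L2_measurable.
- by apply: measurable_funB => //; case: sl.
- by apply: filterS Xl => x /= h xT; rewrite h.
Qed.

Let wiener_integralW k : W k (wiener_integral P k).
Proof.
have [X Xk] := wiener_integral_exists k.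
by apply: is_wiener_integralW; apply: (xgetPex 0); exists X.
Qed.

Lemma energyB_fin d (T : measurableType d) (mu : {measure set T -> \bar R}) f g :
  sqint mu f -> sqint mu g ->
  exists2 a, energy mu (fun x => (f x - g x)%R) = a%:E & 0 <= a.
Proof.
move=> sf sg; have [_ h] := sqintB sf sg.
exists (fine (energy mu (fun x => f x - g x))); last by rewrite fine_ge0// energy_ge0.
by rewrite fineK// ge0_fin_numE// energy_ge0.
Qed.

(** Approximate k and l by steps s and s'. The integral of c s + s' is close both to Phi(c k + l)
    and to c Phi(k) + Phi(l), by the bound [W] applied to all three integrals. *)
Lemma wiener_integral_linear c (k l : LL) :
  wiener_integral P (c *: k + l) = c *: wiener_integral P k + wiener_integral P l.
Proof.
set X := wiener_integral P k; set Y := wiener_integral P l; set Z := wiener_integral _ _.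
have mX := L2_measurable X; have mY := L2_measurable Y; have mZ := L2_measurable Z.
have mk := L2_measurable k; have ml := L2_measurable l.
pose V w := c * X w + Y w.
have sV : sqint P V by apply: sqintD; [apply: sqintZ|]; exact: L2_sqint.
have [mV _] := sV.
suff ZV : L2_fun Z = V %[ae P].
  apply: L2P; apply: ae_eq_trans ZV _; apply: ae_eq_sym.
  apply: filterS2 (L2_addE (c *: X) Y) (L2_scaleE c X) => w /= h1 h2 _.
  by rewrite h1// h2.
have klE : L2_fun (c *: k + l) = (fun x => c * k x + l x) %[ae hm].
  have := L2_scaleE c k; have := L2_addE (c *: k) l.
  by apply: filterS2 => x /= h1 h2 _; rewrite h1// h2.
suff : energy P (fun w => Z w - V w) = 0%E.
  move=> /(energy_eq0 (measurable_funB mZ mV)); apply: filterS => w /= h /h.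
  by move/eqP; rewrite subr_eq0 => /eqP.
apply/eqP; rewrite eq_le energy_ge0 andbT; apply/lee_addgt0Pr => e e0; rewrite add0e.
(* Each of the two distances contributes at most 128 (c^2 |s - k|^2 + |s' - l|^2), with 128 = 2 * 32
   * 2. *)
pose K := 256 * (c ^+ 2 + 1).
have K0 : 0 < K by rewrite mulr_gt0// ltr_wpDl// sqr_ge0.
have [s sk] := step_fun_dense (L2_sqint k) (divr_gt0 e0 K0).
have [s' sl] := step_fun_dense (L2_sqint l) (divr_gt0 e0 K0).
pose t := step_lin c s s'.
have Wk := wiener_integralW k s; have Wl := wiener_integralW l s'.
have Wt := wiener_integralW (c *: k + l) t.
have Et : energy hm (fun x => (step_fun t x - (c *: k + l : LL) x)%R) =
    energy hm (fun x => c * (step_fun s x - k x) + (step_fun s' x - l x)).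
  apply: ae_energy.
  - by apply: measurable_funB => //; exact: L2_measurable.
  - apply: measurable_funD; last exact: measurable_funB.
    by apply: measurable_funM => //; exact: measurable_funB.
  - by apply: filterS klE => x /= h xT; rewrite h// step_fun_lin; ring.
have Ei : energy P (fun w => step_integral t w - V w) =
    energy P (fun w => c * (step_integral s w - X w) + (step_integral s' w - Y w)).
  by congr energy; apply/funext => w; rewrite step_integral_lin /V; ring.
have h1 := energyBD P mZ (mint t) mV.
have h2 : (energy hm (fun x => (c * (step_fun s x - k x) + (step_fun s' x - l x))%R) <=
    2%:E * ((c ^+ 2)%:E * energy hm (fun x => (step_fun s x - k x)%R)) +
    2%:E * energy hm (fun x => (step_fun s' x - l x)%R))%E.
  rewrite -energyZ; last exact: measurable_funB.
  by apply: energyD; [apply: measurable_funM => //|]; exact: measurable_funB.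
have h3 : (energy P (fun w => (c * (step_integral s w - X w) + (step_integral s' w - Y w))%R) <=
    2%:E * ((c ^+ 2)%:E * energy P (fun w => (step_integral s w - X w)%R)) +
    2%:E * energy P (fun w => (step_integral s' w - Y w)%R))%E.
  rewrite -energyZ; last exact: measurable_funB.
  by apply: energyD; [apply: measurable_funM => //|]; exact: measurable_funB.
move: sk sl Wk Wl Wt h1 h2 h3; rewrite -/X -/Y -/Z (energyB P Z (step_integral t)).
rewrite -Et -Ei.
have [a1 E1 p1] := energyB_fin (sqint_step_fun s) (L2_sqint k).
have [a2 E2 p2] := energyB_fin (sqint_step_fun s') (L2_sqint l).
have [a3 E3 p3] := energyB_fin (sqint_step_integral hP s) (L2_sqint X).
have [a4 E4 p4] := energyB_fin (sqint_step_integral hP s') (L2_sqint Y).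
have [a5 E5 p5] := energyB_fin (sqint_step_fun t) (L2_sqint (c *: k + l)).
have [a6 E6 p6] := energyB_fin (sqint_step_integral hP t) (L2_sqint Z).
have [a7 E7 p7] := energyB_fin (L2_sqint Z) sV.
have [a8 E8 p8] := energyB_fin (sqint_step_integral hP t) sV.
rewrite E1 E2 E3 E4 E5 E6 E7 E8 -!EFinM -!EFinD !lte_fin !lee_fin.
have c0 := sqr_ge0 c; set q := e / K.
have qK : 256 * (c ^+ 2 + 1) * q = e by rewrite mulrC divfK// gt_eqF.
move: c0 qK; set cc := c ^+ 2 => c0 qK h1 h2 h3 h4 h5 h6 h7 h8.
have n1 : cc * a1 <= cc * q by rewrite ler_wpM2l// ltW.
have n3 : cc * a3 <= cc * (32 * a1) by rewrite ler_wpM2l.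
lra.
Qed.

(** For k the class of the step function 1 on ]0, t], the bound [W] is 0, so Phi(k) is w(t) - w(0),
    and w(0) = 0 almost surely. *)
Lemma wiener_integral_coordinate (t : half_line R) : exists k : LL,
  coordinate t = L2_fun (wiener_integral P k) %[ae P].
Proof.
pose s : seq (R * half_line R) := [:: (1, t)].
have [k ks] := sqint_L2 (sqint_step_fun s).
exists k; have := wiener_integralW k s.
rewrite (energyB_ae (mstep s) (L2_measurable k) (ae_eq_sym ks)) mule0 => h.
have {}h : energy P (fun w => (step_integral s w - wiener_integral P k w)%R) = 0%E.
  by apply/eqP; rewrite eq_le h energy_ge0.
have {}h := energy_eq0 (measurable_funB (mint s) (L2_measurable _)) h.
have h0 : {ae P, forall w, coordinate time0 w = 0}.
  have mA : measurable [set w : Omega | coordinate time0 w = 0].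
    have := @measurable_coordinate R time0 measurableT [set 0] (measurable_set1 0).
    by rewrite setTI.
  exists (~` [set w : Omega | coordinate time0 w = 0]); split => //.
    exact: measurableC.
  have [h1 _] := hP; rewrite probability_setC// h1 subee//.
apply: filterS2 h h0 => w /= h1 h2 wT; move: (h1 wT) => /eqP.
by rewrite subr_eq0 /step_integral big_seq1/= mul1r h2 subr0 => /eqP.
Qed.

(** The limit of [step_mgf] is taken by [integral_cvg_quadratic], which needs exp(2 X) to be
    integrable for the limit X. That comes from Fatou's lemma along an almost everywhere convergent
    subsequence, the energies of the approximating steps being bounded. *)
Lemma wiener_integral_mgf (k : LL) :
  (\int[P]_w (expR (wiener_integral P k w))%:E = (expR (L2_dot hm k k / 2))%:E)%E.
Proof.
pose X := wiener_integral P k; have mX := L2_measurable X.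
have mexp c (Y : Omega -> R) : measurable_fun setT Y -> measurable_fun setT (fun w => expR (c * Y w)).
  by move=> mY; apply: measurableT_comp => //; exact: measurable_funM.
have [s_ sP] := step_approx k.
have s1 n : (energy hm (fun x => (step_fun (s_ n) x - k x)%R) <= 1)%E.
  by apply/ltW/(lt_le_trans (sP n)); rewrite lee_fin invf_le1// ler1n.
have scv e : 0 < e -> exists N, forall n, (N <= n)%N ->
    (energy hm (fun x => (step_fun (s_ n) x - k x)%R) < e%:E)%E.
  move=> /inv_small[N NP]; exists N => n /NP nN.
  by apply: lt_trans (sP n) _; rewrite lte_fin.
have Xcv e : 0 < e -> exists N, forall n, (N <= n)%N ->
    (energy P (fun w => (step_integral (s_ n) w - X w)%R) < e%:E)%E.
  move=> e0; have [N NP] := scv (e / 32) ltac:(lra).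
  exists N => n /NP nN; apply: le_lt_trans (wiener_integralW k (s_ n)) _.
  have -> : e%:E = (32%:E * (e / 32)%:E)%E by rewrite -EFinM; congr EFin; lra.
  by rewrite lte_pmul2l.
pose v n := fine (energy hm (step_fun (s_ n))).
have vE n : energy hm (step_fun (s_ n)) = (v n)%:E.
  by rewrite fineK// ge0_fin_numE ?energy_ge0//; case: (sqint_step_fun (s_ n)).
have vcv : v n @[n --> \oo] --> L2_dot hm k k.
  have := energy_cvg (fun n => sqint_step_fun (s_ n)) (L2_sqint k) s1 scv.
  by rewrite -L2_dotE => /fine_cvgP[].
have [B Bv] : exists B, forall n, v n <= B.
  have /cvg_seq_bounded/bounded_fun_has_ubound[B BP] : cvgn v by apply/cvg_ex; eexists; exact: vcv.
  by exists B => n; apply: BP; exists n.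
have v0 n : 0 <= v n by rewrite fine_ge0// energy_ge0.
have mgf c n : (\int[P]_w (expR (c * step_integral (s_ n) w))%:E = (expR (c ^+ 2 * v n / 2))%:E)%E.
  have := step_mgf hP (step_lin c (s_ n) [::]).
  have -> : step_fun (step_lin c (s_ n) [::]) = (fun x => c * step_fun (s_ n) x).
    by apply/funext => x; rewrite step_fun_lin /step_fun big_nil addr0.
  rewrite energyZ// vE -EFinM/= => <-; apply: eq_integral => w _.
  by rewrite step_integral_lin [step_integral [::] _]big_nil addr0.
have mgfB c n : (\int[P]_w (expR (c * step_integral (s_ n) w))%:E <= (expR (c ^+ 2 * B / 2))%:E)%E.
  rewrite mgf lee_fin ler_expR ler_wpM2r// ler_wpM2l ?sqr_ge0//.
have [sg [sgn sgcv]] := ae_cvg0_subseq (fun n => measurable_funB (mint (s_ n)) mX) Xcv.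
have XB c : (\int[P]_w (expR (c * X w))%:E <= (expR (c ^+ 2 * B / 2))%:E)%E.
  apply: (@fatou_bound _ _ _ P (fun n w => expR (c * step_integral (s_ (sg n)) w))) => //.
  - by move=> n; exact: mexp.
  - exact: mexp.
  apply: filterS sgcv => w h; apply: continuous_cvg; first exact: continuous_expR.
  apply: cvgM; first exact: cvg_cst.
  have -> : (fun n => step_integral (s_ (sg n)) w) =
      (fun n => (step_integral (s_ (sg n)) w - X w) + X w).
    by apply/funext => n; rewrite subrK.
  by rewrite -[X in _ --> X]add0r; apply: cvgD => //; exact: cvg_cst.
have cv1 : (\int[P]_w (expR (step_integral (s_ n) w))%:E)%E @[n --> \oo] -->
    (\int[P]_w (expR (X w))%:E)%E.
  apply: (@integral_cvg_quadratic _ _ _ P _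
    (fun n w => expR (2 * step_integral (s_ n) w) + expR (2 * X w))
    (fun n => step_integral (s_ n)) _ X (expR (2 ^+ 2 * B / 2) + expR (2 ^+ 2 * B / 2))) => //.
  - by move=> n; apply: measurableT_comp.
  - by apply: measurableT_comp.
  - by move=> n; apply: measurable_funD; exact: mexp.
  - move=> n; under eq_integral do rewrite EFinD.
    rewrite ge0_integralD//; try by move=> w _; rewrite lee_fin expR_ge0.
    + by rewrite EFinD; apply: leeD; [exact: mgfB|exact: XB].
    + by apply/measurable_EFinP; exact: mexp.
    + by apply/measurable_EFinP; exact: mexp.
  - by move=> n x e e0; exact: ler_dist_expR.
  - have <- : (\int[P]_w (expR (1 * X w))%:E = \int[P]_w (expR (X w))%:E)%E.
      by apply: eq_integral => w _; rewrite mul1r.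
    by apply: le_lt_trans (XB 1) _; rewrite ltry.
apply: cvg_unique cv1 _ => //.
have -> : (fun n => \int[P]_w (expR (step_integral (s_ n) w))%:E)%E = (fun n => (expR (v n / 2))%:E).
  apply/funext => n; rewrite step_mgf// vE.
apply: cvg_EFin; first exact: nearW.
apply: continuous_cvg; first exact: continuous_expR.
by apply: cvgM => //; exact: cvg_cst.
Qed.

End wiener_integral.

(** * Polynomials of a Gaussian family and integration by parts *)

Section moderate.
Context {d} {T : measurableType d} {R : realType}.
Variable P : probability T R.
Implicit Types f g : T -> R.

(** Finite absolute moments of all orders. Such functions form an algebra containing the polynomials
    and exponentials of Phi, which settles the integrability of every product below. *)
Definition moderate f := measurable_fun setT f /\
  forall p : nat, (\int[P]_w (`|f w| ^+ p)%:E < +oo)%E.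

Let mpow f p : measurable_fun setT f ->
  measurable_fun setT (fun w => (`|f w| ^+ p)%:E).
Proof.
by move=> mf; apply/measurable_EFinP; apply: measurable_funX; exact: measurableT_comp.
Qed.

Lemma moderate_le f g : measurable_fun setT f -> moderate g ->
  (forall w, `|f w| <= `|g w|) -> moderate f.
Proof.
move=> mf [mg gp] fg; split=> // p; apply: le_lt_trans (gp p).
apply: ge0_le_integral => //; try exact: mpow.
by move=> w _; rewrite lee_fin lerXn2r ?nnegrE.
Qed.

Lemma moderate_cst c : moderate (fun=> c).
Proof. by split=> // p; rewrite integral_prob_cst ltry. Qed.

Lemma moderateD f g : moderate f -> moderate g -> moderate (fun w => f w + g w).
Proof.
move=> [mf fp] [mg gp]; split=> [|p]; first exact: measurable_funD.
have m2 (h : T -> R) : measurable_fun setT h -> measurable_fun setT (fun w => (2 ^+ p)%:E * (`|h w| ^+ p)%:E)%E.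
  by move=> mh; apply: emeasurable_funM => //; exact: mpow.
have p2 (h : T -> R) w : (0 <= (2 ^+ p)%:E * (`|h w| ^+ p)%:E)%E.
  by rewrite -EFinM lee_fin mulr_ge0// exprn_ge0.
apply: (@le_lt_trans _ _ (\int[P]_w ((2 ^+ p)%:E * (`|f w| ^+ p)%:E + (2 ^+ p)%:E * (`|g w| ^+ p)%:E))%E).
  apply: ge0_le_integral => //.
  - by apply: mpow; exact: measurable_funD.
  - by apply: emeasurable_funD; exact: m2.
  - move=> w _; rewrite -!EFinM -EFinD lee_fin -mulrDr.
    apply: (@le_trans _ _ ((2 * Num.max `|f w| `|g w|) ^+ p)).
      rewrite lerXn2r ?nnegrE ?mulr_ge0 ?le_max ?normr_ge0//.
      apply: le_trans (ler_normD _ _) _; rewrite mulr_natl mulr2n.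
      by rewrite lerD// le_max lexx ?orbT.
    rewrite exprMn ler_wpM2l ?exprn_ge0//.
    by case: (leP `|f w| `|g w|) => _; rewrite ?lerDl ?lerDr ?exprn_ge0.
rewrite ge0_integralD//; try exact: m2.
rewrite !ge0_integralZl_EFin ?exprn_ge0//; try exact: mpow;
  try by move=> w _; rewrite lee_fin exprn_ge0.
by apply: lte_add_pinfty; apply: lte_mul_pinfty; rewrite ?lee_fin ?exprn_ge0.
Qed.

Lemma moderateM f g : moderate f -> moderate g -> moderate (fun w => f w * g w).
Proof.
move=> [mf fp] [mg gp]; split=> [|p]; first exact: measurable_funM.
apply: (@le_lt_trans _ _ (\int[P]_w ((`|f w| ^+ (2 * p))%:E + (`|g w| ^+ (2 * p))%:E))%E).
  apply: ge0_le_integral => //.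
  - by apply: mpow; exact: measurable_funM.
  - by apply: emeasurable_funD; exact: mpow.
  - move=> w _; rewrite -EFinD lee_fin normrM exprMn !(mulnC 2%N) !exprM.
    set a := `|f w| ^+ p; set b := `|g w| ^+ p.
    by have := sqr_ge0 (a - b); have := sqr_ge0 (a + b); rewrite sqrrB sqrrD => ? ?; lra.
rewrite ge0_integralD//; try exact: mpow; try by move=> w _; rewrite lee_fin exprn_ge0.
exact: lte_add_pinfty.
Qed.

Lemma moderateZ c f : moderate f -> moderate (fun w => c * f w).
Proof. by move=> mf; apply: moderateM => //; exact: moderate_cst. Qed.

Lemma moderateB f g : moderate f -> moderate g -> moderate (fun w => f w - g w).
Proof.
move=> mf /(moderateZ (-1)) /(moderateD mf).
by under eq_fun do rewrite mulN1r.
Qed.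

Lemma moderate_norm f : moderate f -> moderate (fun w => `|f w|).
Proof.
move=> mf; apply: (moderate_le _ mf) => [|w]; last by rewrite normr_id.
by apply: measurableT_comp => //; case: mf.
Qed.

Lemma moderate_sqint f : moderate f -> sqint P f.
Proof.
move=> [mf /(_ 2%N)]; split=> //; rewrite /energy.
by under eq_integral do rewrite -[f _ ^+ 2]real_normK ?num_real//.
Qed.

Lemma moderate_integrable f : moderate f -> P.-integrable setT (EFin \o f).
Proof.
move=> [mf /(_ 1%N) f1]; apply/integrableP; split; first exact/measurable_EFinP.
by under eq_integral do rewrite /= -[`|_|]expr1.
Qed.

Definition mean f : R := \int[P]_w f w.

Lemma meanD f g : moderate f -> moderate g ->
  mean (fun w => f w + g w) = mean f + mean g.
Proof. by move=> /moderate_integrable mf /moderate_integrable mg; rewrite /mean RintegralD. Qed.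

Lemma meanZ c f : moderate f -> mean (fun w => c * f w) = c * mean f.
Proof. by move=> /moderate_integrable mf; rewrite /mean RintegralZl. Qed.

Lemma meanB f g : moderate f -> moderate g ->
  mean (fun w => f w - g w) = mean f - mean g.
Proof. by move=> /moderate_integrable mf /moderate_integrable mg; rewrite /mean RintegralB. Qed.

Lemma mean_le f g : moderate f -> moderate g ->
  (forall w, `|f w| <= g w) -> `|mean f| <= mean g.
Proof.
move=> mf mg fg.
have mf' := moderate_integrable mf.
apply: le_trans (le_normr_Rintegral measurableT mf') _.
apply: le_Rintegral => //; first exact: integrable_norm.
exact: moderate_integrable.
Qed.

Lemma mean_ae f g : moderate f -> moderate g -> f = g %[ae P] -> mean f = mean g.
Proof.
move=> [mf _] [mg _] fg; congr fine; apply: ae_eq_integral => //.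
- exact/measurable_EFinP.
- exact/measurable_EFinP.
- by apply: filterS fg => w /= h wT; rewrite h.
Qed.

Lemma eq_mean f g : f =1 g -> mean f = mean g.
Proof. by move=> fg; apply: eq_Rintegral => w _. Qed.

Lemma mean_sqr_eq0 f : moderate f -> mean (fun w => f w * f w) = 0 -> f = (fun=> 0) %[ae P].
Proof.
move=> mf f0; have [mff _] := mf; apply: energy_eq0 => //.
have ff := moderate_integrable (moderateM mf mf).
rewrite /energy (eq_integral (EFin \o (fun w => f w * f w))); last first.
  by move=> w _; rewrite expr2.
by rewrite -(fineK (integrable_fin_num measurableT ff)) [fine _]f0.
Qed.

End moderate.

(** Since exp u - 1 <= u exp u, the remainder is at most u (exp u - 1); the two signs of u are then
    treated separately. *)
Lemma expR_remainder (R : realType) (u : R) :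
  `|expR u - 1 - u| <= u ^+ 2 * expR `|u|.
Proof.
have h1 := expR_ge1Dx u; have h2 := expR_ge1Dx (- u).
have h3 : expR u * expR (- u) = 1 by rewrite -expRD subrr expR0.
have e0 := expR_gt0 u.
rewrite ger0_norm; last by lra.
have h4 : expR u - 1 <= u * expR u by nra.
have [u0|u0] := leP 0 u.
  by rewrite ger0_norm//; have := sqr_ge0 u; nra.
rewrite ltr0_norm//; have h5 : 1 <= expR (- u) by lra.
have h6 : expR u - 1 - u <= u ^+ 2 by nra.
by apply: le_trans h6 _; rewrite ler_peMr// sqr_ge0.
Qed.

(** A linear term dominated by t^2 near 0 vanishes: this extracts the derivative at t = 0 from the
    expansions below. *)
Lemma quadratic_vanish (R : realType) (b C : R) :
  (forall t, `|t| <= 1 -> `|t * b| <= t ^+ 2 * C) -> b = 0.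
Proof.
move=> h; apply/eqP; rewrite -normr_eq0 eq_le normr_ge0 andbT.
apply/ler_addgt0Pr => e e0; rewrite add0r.
have C0 : 0 <= C by have := h 1; rewrite normr1 lexx mul1r expr1n mul1r => /(_ isT); apply: le_trans.
have C1 : 0 < C + 1 + e by lra.
(* The choice t = e / (C + 1 + e) satisfies both t <= 1 and t C <= e. *)
have [t [t0 t1 tE]] : exists t, [/\ 0 < t, t <= 1 & t * (C + 1 + e) = e].
  exists (e / (C + 1 + e)); split; first by rewrite divr_gt0.
    by rewrite ler_pdivrMr// mul1r; lra.
  by rewrite divfK// gt_eqF.
have := h t; rewrite normrM gtr0_norm// => /(_ t1).
rewrite expr2 -mulrA ler_pM2l// => /le_trans; apply.
by nra.
Qed.

(** First-order expansion at t = 0, uniform for |t| <= 1. The factor A - t D is affine because the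
    scalar product <g + t h, k> in the identity to be differentiated is affine in t. *)
Lemma mean_expansion d (T : measurableType d) (R : realType) (P : probability T R)
    (A D W Y : T -> R) : moderate P A -> moderate P D -> moderate P W -> moderate P Y ->
  moderate P (fun w => expR `|Y w|) -> (forall t, moderate P (fun w => expR (t * Y w))) ->
  exists C, forall t, `|t| <= 1 ->
    `|mean P (fun w => (A w - t * D w) * (W w * expR (t * Y w))) -
      (mean P (fun w => A w * W w) + t * mean P (fun w => (A w * Y w - D w) * W w))|
    <= t ^+ 2 * C.
Proof.
move=> mA mD mW mY mY1 mYt.
(* The first summand bounds the product of the two linear terms, the second the remainder of the
   exponential, with |t| replaced by 1 in the coefficients. *)
pose G w := `|D w| * `|Y w| * `|W w| +
  (`|A w| + `|D w|) * `|W w| * (Y w * Y w * expR `|Y w|).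
have nA := moderate_norm mA; have nD := moderate_norm mD.
have nW := moderate_norm mW; have nY := moderate_norm mY.
have mG : moderate P G := moderateD (moderateM (moderateM nD nY) nW)
  (moderateM (moderateM (moderateD nA nD) nW) (moderateM (moderateM mY mY) mY1)).
exists (mean P G) => t t1.
have m2 := moderateM (moderateB mA (moderateZ t mD)) (moderateM mW (mYt t)).
have m3 := moderateM mA mW.
have m4 := moderateM (moderateB (moderateM mA mY) mD) mW.
rewrite -(meanZ t m4) -(meanD m3 (moderateZ t m4)) -(meanB m2 (moderateD m3 (moderateZ t m4))).
rewrite -(meanZ (t ^+ 2) mG); apply: mean_le.
- exact: (moderateB m2 (moderateD m3 (moderateZ t m4))).
- exact: (moderateZ (t ^+ 2) mG).
move=> w; rewrite /G.
set a := A w; set b := D w; set y := Y w; set x := W w.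
pose r := expR (t * y) - 1 - t * y.
have rE : `|r| <= t ^+ 2 * (y * y * expR `|y|).
  apply: le_trans (expR_remainder _) _; rewrite -expr2 exprMn -mulrA.
  rewrite ler_wpM2l ?sqr_ge0// ler_wpM2l ?sqr_ge0// ler_expR normrM.
  by rewrite ler_piMl.
have -> : (a - t * b) * (x * expR (t * y)) - (a * x + t * ((a * y - b) * x)) =
    - (t ^+ 2 * (b * y * x)) + (a - t * b) * x * r by rewrite /r; ring.
apply: le_trans (ler_normD _ _) _; rewrite [leRHS]mulrDr; apply: lerD.
  by rewrite normrN (normrM (t ^+ 2)) (ger0_norm (sqr_ge0 t)) !normrM.
rewrite normrM (normrM _ x).
have h1 : `|a - t * b| <= `|a| + `|b|.
  apply: le_trans (ler_normB _ _) _; rewrite lerD2l normrM ler_piMl//.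
rewrite [leRHS]mulrCA; apply: ler_pM => //.
by rewrite ler_wpM2r.
Qed.

Section gaussian_family.
Context {d} {T : measurableType d} {R : realType} {V : lmodType R}.
Variables (P : probability T R) (dotV : {dot V for @idfun R}) (Phi : V -> T -> R).
Hypothesis mPhi : forall k, measurable_fun setT (Phi k).
Hypothesis Phi_linear : forall c k l,
  Phi (c *: k + l) = (fun w => c * Phi k w + Phi l w) %[ae P].
Hypothesis Phi_mgf : forall k,
  (\int[P]_w (expR (Phi k w))%:E = (expR (dotV k k / 2))%:E)%E.

Local Notation E := (mean P).

Let dotC k l : dotV k l = dotV l k. Proof. exact: ccr_dotC. Qed.

Let dotDl c k l h : dotV (c *: k + l) h = c * dotV k h + dotV l h.
Proof. by rewrite linearPl. Qed.

Let dotDr c k l h : dotV h (c *: k + l) = c * dotV h k + dotV h l.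
Proof. by rewrite dotC dotDl dotC [dotV l h]dotC. Qed.

Let Phi0 : Phi 0 = (fun=> 0) %[ae P].
Proof.
have := Phi_linear 1 0 0; rewrite scale1r addr0; apply: filterS => w /= h /h.
by rewrite mul1r => /eqP; rewrite -subr_eq subrr => /eqP.
Qed.

Let PhiZ c k : Phi (c *: k) = (fun w => c * Phi k w) %[ae P].
Proof.
have := Phi_linear c k 0; rewrite addr0; apply: filterS2 Phi0 => w /= h0 h1 wT.
by rewrite h1// h0// addr0.
Qed.

Let mexp c k : measurable_fun setT (fun w => expR (c * Phi k w)).
Proof. by apply: measurableT_comp => //; exact: measurable_funM. Qed.

(** The p-th power is almost everywhere exp Phi(c p k), whose mean the Laplace transform gives. *)
Lemma moderate_expR c k : moderate P (fun w => expR (c * Phi k w)).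
Proof.
split=> // p; apply: (@le_lt_trans _ _ (\int[P]_w (expR (Phi ((c *+ p) *: k) w))%:E)%E); last first.
  by rewrite Phi_mgf ltry.
rewrite le_eqVlt; apply/orP; left; apply/eqP; apply: ge0_ae_eq_integral => //.
- apply/measurable_EFinP; apply: measurable_funX; exact: measurableT_comp.
- by apply/measurable_EFinP; exact: measurableT_comp.
- apply: filterS (PhiZ (c *+ p) k) => w /= h wT; rewrite h//.
  by rewrite ger0_norm ?expR_ge0// -expRM_natl [in RHS]mulrnAl -[in RHS]mulr_natl.
Qed.

Lemma moderate_Phi k : moderate P (Phi k).
Proof.
apply: (moderate_le (mPhi k) (moderateD (moderate_expR 1 k) (moderate_expR (-1) k))) => w.
rewrite mul1r mulN1r (ger0_norm (addr_ge0 (expR_ge0 _) (expR_ge0 _))).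
have := expR_ge1Dx (Phi k w); have := expR_ge1Dx (- Phi k w).
have := expR_gt0 (Phi k w); have := expR_gt0 (- Phi k w).
by move=> h1 h2 h3 h4; rewrite ler_norml; apply/andP; split; lra.
Qed.

Lemma moderate_expR_norm k : moderate P (fun w => expR `|Phi k w|).
Proof.
apply: (moderate_le _ (moderateD (moderate_expR 1 k) (moderate_expR (-1) k))).
  by apply: measurableT_comp => //; exact: measurableT_comp.
move=> w; rewrite mul1r mulN1r (ger0_norm (addr_ge0 (expR_ge0 _) (expR_ge0 _))) ger0_norm//.
by have [h|h] := lerP 0 (Phi k w); rewrite ?(ger0_norm h) ?(ltr0_norm h) ?lerDl ?lerDr ?expR_ge0.
Qed.

Let wt (g : V) w := expR (Phi g w).

Let moderate_wt g : moderate P (wt g).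
Proof. by have := moderate_expR 1 g; under eq_fun do rewrite mul1r. Qed.

Let wtD t g h : wt (t *: h + g) = (fun w => wt g w * expR (t * Phi h w)) %[ae P].
Proof.
apply: filterS (Phi_linear t h g) => w /= e wT.
by rewrite /wt e// expRD mulrC.
Qed.

Let mean_wt g : E (wt g) = expR (dotV g g / 2).
Proof. by rewrite /mean /Rintegral Phi_mgf. Qed.

Let expansion (A D : T -> R) (g h : V) : moderate P A -> moderate P D ->
  exists C, forall t, `|t| <= 1 ->
    `|E (fun w => (A w - t * D w) * wt (t *: h + g) w) -
      (E (fun w => A w * wt g w) + t * E (fun w => (A w * Phi h w - D w) * wt g w))|
    <= t ^+ 2 * C.
Proof.
move=> mA mD.
have [C CP] := mean_expansion mA mD (moderate_wt g) (moderate_Phi h)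
  (moderate_expR_norm h) (fun t => moderate_expR t h).
exists C => t /CP; congr (`|_ - _| <= _); apply: mean_ae.
- exact: (moderateM (moderateB mA (moderateZ t mD)) (moderateM (moderate_wt g) (moderate_expR t h))).
- exact: (moderateM (moderateB mA (moderateZ t mD)) (moderate_wt _)).
by apply: filterS (wtD t g h) => w /= e wT; rewrite e.
Qed.

(** E exp Phi(g + t k) has two expansions in t: one from [expansion] with A = 1 and D = 0, the other
    from the explicit Laplace transform. The claim equates their linear coefficients. *)
Let ibp_base k g : E (fun w => (Phi k w - dotV g k) * wt g w) = 0.
Proof.
have m1 := moderate_cst P 1; have m0 := moderate_cst P 0.
have [C CP] := expansion g k m1 m0.
have mw := moderate_wt g; have mk := moderate_Phi k.
pose M := E (wt g); pose be := dotV g k; pose ga := dotV k k / 2.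
have -> : E (fun w => (Phi k w - be) * wt g w) = E (fun w => Phi k w * wt g w) - be * M.
  rewrite -(meanZ be mw) -(meanB (moderateM mk mw) (moderateZ be mw)).
  by apply: eq_mean => w; rewrite mulrBl.
have E1 t : E (fun w => (1 - t * 0) * wt (t *: k + g) w) = M * expR (t * be + t ^+ 2 * ga).
  transitivity (E (wt (t *: k + g))).
    by apply: eq_mean => w; rewrite mulr0 subr0 mul1r.
  rewrite mean_wt /M mean_wt -expRD; congr expR.
  rewrite dotDl !dotDr (dotC k g) /ga /be; lra.
have E2 : E (fun w => 1 * wt g w) = M by apply: eq_mean => w; rewrite mul1r.
have E3 : E (fun w => (1 * Phi k w - 0) * wt g w) = E (fun w => Phi k w * wt g w).
  by apply: eq_mean => w; rewrite mul1r subr0.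
have M0 : 0 < M by rewrite /M mean_wt expR_gt0.
(* For |t| <= 1 the exponent u below satisfies |u| <= |t| (|be| + |ga|), so t^2 K bounds the
   remainder of exp u. *)
pose K := (`|be| + `|ga|) ^+ 2 * expR (`|be| + `|ga|).
apply: (@quadratic_vanish _ _ (C + M * `|ga| + M * K)) => t t1.
have := CP t t1; rewrite E1 E2 E3; set Z := E _ => h.
pose u := t * be + t ^+ 2 * ga; pose r := expR u - 1 - u.
have tt : t ^+ 2 <= `|t|.
  by rewrite -real_normK ?num_real// expr2 ler_piMr.
have ub : `|u| <= `|t| * (`|be| + `|ga|).
  apply: le_trans (ler_normD _ _) _; rewrite (normrM t) (normrM _ ga) (ger0_norm (sqr_ge0 t)).
  by rewrite mulrDr lerD2l ler_wpM2r.
have rb : `|r| <= t ^+ 2 * K.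
  apply: le_trans (expR_remainder u) _; rewrite /K mulrA.
  apply: ler_pM => //; rewrite ?sqr_ge0 ?expR_ge0//.
    rewrite -[u ^+ 2]real_normK ?num_real// -[t ^+ 2]real_normK ?num_real// -exprMn.
    by rewrite lerXn2r ?nnegrE// mulr_ge0// addr_ge0.
  by rewrite ler_expR; apply: le_trans ub _; rewrite ler_piMl// addr_ge0.
have -> : t * (Z - be * M) = M * r + M * t ^+ 2 * ga - (M * expR u - (M + t * Z)).
  by rewrite /r /u; ring.
apply: le_trans (ler_normB _ _) _.
have -> : t ^+ 2 * (C + M * `|ga| + M * K) = (M * (t ^+ 2 * K) + M * t ^+ 2 * `|ga|) + t ^+ 2 * C by ring.
apply: lerD => //; apply: le_trans (ler_normD _ _) _; apply: lerD.
  by rewrite normrM (gtr0_norm M0) ler_wpM2l// ltW.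
by rewrite (normrM _ ga) (normrM M) (gtr0_norm M0) (ger0_norm (sqr_ge0 t)).
Qed.

(** F' acts as the derivative of F in the direction k, tested against exp Phi(g). Quantifying over
    all g allows the identity to be differentiated in g. *)
Let ibp_wt k F F' := forall g,
  E (fun w => ((Phi k w - dotV g k) * F w - F' w) * wt g w) = 0.

(** Replacing g by g + t h keeps the mean equal to 0 for all t, so its linear coefficient vanishes.
    The derivative of <g + t h, k> produces the new term <h, k> F of the Leibniz rule. *)
Let ibp_mulPhi k F F' h : moderate P F -> moderate P F' -> ibp_wt k F F' ->
  ibp_wt k (fun w => F w * Phi h w) (fun w => F' w * Phi h w + F w * dotV h k).
Proof.
move=> mF mF' Q g; have mk := moderate_Phi k; have mh := moderate_Phi h.
pose A w := (Phi k w - dotV g k) * F w - F' w.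
pose D w := dotV h k * F w.
have mA : moderate P A := moderateB (moderateM (moderateB mk (moderate_cst P (dotV g k))) mF) mF'.
have mD : moderate P D := moderateZ (dotV h k) mF.
have [C CP] := expansion g h mA mD.
have -> : E (fun w => ((Phi k w - dotV g k) * (F w * Phi h w) -
    (F' w * Phi h w + F w * dotV h k)) * wt g w) =
    E (fun w => (A w * Phi h w - D w) * wt g w).
  by apply: eq_mean => w; rewrite /A /D; ring.
apply: (@quadratic_vanish _ _ C) => t /CP.
have -> : E (fun w => (A w - t * D w) * wt (t *: h + g) w) = 0.
  rewrite -[RHS](Q (t *: h + g)); apply: eq_Rintegral => w _.
  by rewrite /A /D dotDl; ring.
have -> : E (fun w => A w * wt g w) = 0 by exact: Q.
by rewrite !add0r normrN.
Qed.

(* The derivative in the direction [k] is [Df k]; as a relation it needs no choice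
   of variables, and [poly_diff_unique] shows that [f] determines it a.e. *)
Inductive poly_diff : (T -> R) -> (V -> T -> R) -> Prop :=
  | poly_diff_cst c : poly_diff (fun=> c) (fun _ _ => 0)
  | poly_diff_Phi h : poly_diff (Phi h) (fun k _ => dotV h k)
  | poly_diff_add f Df g Dg : poly_diff f Df -> poly_diff g Dg ->
      poly_diff (fun w => f w + g w) (fun k w => Df k w + Dg k w)
  | poly_diff_mul f Df g Dg : poly_diff f Df -> poly_diff g Dg ->
      poly_diff (fun w => f w * g w) (fun k w => Df k w * g w + f w * Dg k w).

(** Derivatives of polynomials are again polynomials, so every operator can be iterated; the
    symmetry in k and l gives the commutation relations. *)
Lemma poly_diff_iter f Df : poly_diff f Df -> exists DDf : V -> V -> T -> R,
  (forall k, poly_diff (Df k) (DDf k)) /\ forall k l w, DDf k l w = DDf l k w.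
Proof.
elim=> {f Df} [c|h|f Df g Dg _ [F [F1 F2]] _ [G [G1 G2]]|f Df g Dg pf [F [F1 F2]] pg [G [G1 G2]]].
- exists (fun _ _ _ => 0); split=> // k; exact: poly_diff_cst.
- exists (fun _ _ _ => 0); split=> // k; exact: poly_diff_cst.
- exists (fun k l w => F k l w + G k l w); split=> [k|k l w]; last by rewrite F2 G2.
  exact: poly_diff_add.
- exists (fun k l w => (F k l w * g w + Df k w * Dg l w) + (Df l w * Dg k w + f w * G k l w)).
  split=> [k|k l w]; last by rewrite F2 G2; ring.
  by apply: poly_diff_add; exact: poly_diff_mul.
Qed.

Lemma poly_diff_linear_dir f Df : poly_diff f Df -> forall c k l w,
  Df (c *: k + l) w = c * Df k w + Df l w.
Proof.
elim=> {f Df} [c|h|f Df g Dg _ F _ G|f Df g Dg _ F _ G] e k l w.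
- by rewrite mulr0 addr0.
- exact: dotDr.
- by rewrite F G; ring.
- by rewrite F G; ring.
Qed.

Lemma moderate_poly f Df : poly_diff f Df -> moderate P f.
Proof.
elim=> {f Df} [c|h|f Df g Dg _ F _ G|f Df g Dg _ F _ G].
- exact: moderate_cst.
- exact: moderate_Phi.
- exact: moderateD F G.
- exact: moderateM F G.
Qed.

Lemma moderate_poly_deriv f Df k : poly_diff f Df -> moderate P (Df k).
Proof. by move=> /poly_diff_iter[DDf [/(_ k)/moderate_poly]]. Qed.

(** The term [0 * f w] is left as the product rule produces it: [poly_diff] relates functions
    literally, and simplification is postponed to the means and a.e. identities. *)
Lemma poly_diffZ c f Df : poly_diff f Df ->
  poly_diff (fun w => c * f w) (fun k w => 0 * f w + c * Df k w).
Proof. exact: (poly_diff_mul (poly_diff_cst c)). Qed.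

Lemma poly_diffB f Df g Dg : poly_diff f Df -> poly_diff g Dg ->
  poly_diff (fun w => f w + -1 * g w) (fun k w => Df k w + (0 * g w + -1 * Dg k w)).
Proof. by move=> pf pg; apply: poly_diff_add => //; exact: poly_diffZ. Qed.

(** The statement is general in F so that multiplication by a product f g can be carried out as
    multiplication by f and then by g. *)
Let ibp_mul k f Df : poly_diff f Df -> forall F F', moderate P F -> moderate P F' ->
  ibp_wt k F F' -> ibp_wt k (fun w => F w * f w) (fun w => F' w * f w + F w * Df k w).
Proof.
have mk := moderate_Phi k.
have m g F F' : moderate P F -> moderate P F' ->
    moderate P (fun w => ((Phi k w - dotV g k) * F w - F' w) * wt g w).
  move=> mF mF'.
  exact: (moderateM (moderateB (moderateM (moderateB mk (moderate_cst P (dotV g k))) mF) mF') (moderate_wt g)).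
elim=> {f Df} [c|h|f Df g Dg pf IHf pg IHg|f Df g Dg pf IHf pg IHg] F F' mF mF' Q.
- move=> g; have := meanZ c (m g _ _ mF mF'); rewrite (Q g) mulr0 => h.
  by apply: etrans h; apply: eq_mean => w; ring.
- exact: ibp_mulPhi.
- have pmf := moderate_poly pf; have pmg := moderate_poly pg.
  have dmf := moderate_poly_deriv k pf; have dmg := moderate_poly_deriv k pg.
  move=> e; have Q1 := IHf _ _ mF mF' Q e; have Q2 := IHg _ _ mF mF' Q e.
  rewrite -[RHS]addr0 -{1}Q1 -Q2 -meanD.
  + by apply: eq_mean => w; ring.
  + exact: (m e _ _ (moderateM mF pmf) (moderateD (moderateM mF' pmf) (moderateM mF dmf))).
  + exact: (m e _ _ (moderateM mF pmg) (moderateD (moderateM mF' pmg) (moderateM mF dmg))).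
- have pmf := moderate_poly pf; have dmf := moderate_poly_deriv k pf.
  have Q1 := IHf _ _ mF mF' Q.
  have Q2 := IHg _ _ (moderateM mF pmf) (moderateD (moderateM mF' pmf) (moderateM mF dmf)) Q1.
  move=> e; apply: etrans (Q2 e); apply: eq_mean => w; ring.
Qed.

(** The case F = 1, g = 0 of [ibp_mul], where the weight exp Phi(0) is 1 almost everywhere. *)
Lemma gaussian_ibp f Df k : poly_diff f Df ->
  E (Df k) = E (fun w => f w * Phi k w).
Proof.
move=> pf; have mf := moderate_poly pf; have mdf := moderate_poly_deriv k pf.
have m1 := moderate_cst P 1; have m0 := moderate_cst P 0.
have Q : ibp_wt k (fun=> 1) (fun=> 0).
  move=> g; apply: etrans (ibp_base k g); apply: eq_mean => w.
  by rewrite mulr1 subr0.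
have := ibp_mul pf m1 m0 Q 0.
have dot0 : dotV 0 k = 0 by rewrite linear0l.
have mk := moderate_Phi k.
rewrite (mean_ae (g := fun w => f w * Phi k w - Df k w)).
- by rewrite meanB//; [move/eqP; rewrite subr_eq0 => /eqP|exact: moderateM].
- exact: (moderateM (moderateB (moderateM (moderateB mk (moderate_cst P _)) (moderateM m1 mf)) (moderateD (moderateM m0 mf) (moderateM m1 mdf))) (moderate_wt 0)).
- exact: moderateB (moderateM mf mk) mdf.
apply: filterS Phi0 => w /= h wT; rewrite /wt h// expR0 dot0; ring.
Qed.

Lemma poly_adjoint f Df g Dg k : poly_diff f Df -> poly_diff g Dg ->
  E (fun w => Df k w * g w) = E (fun w => f w * (Phi k w * g w - Dg k w)).
Proof.
move=> pf pg; have := gaussian_ibp k (poly_diff_mul pf pg).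
have mf := moderate_poly pf; have mdf := moderate_poly_deriv k pf.
have mg := moderate_poly pg; have mdg := moderate_poly_deriv k pg.
have mk := moderate_Phi k.
rewrite (meanD (moderateM mdf mg) (moderateM mf mdg)) => h.
have -> : E (fun w => f w * (Phi k w * g w - Dg k w)) =
    E (fun w => f w * g w * Phi k w - f w * Dg k w).
  by apply: eq_mean => w; ring.
by rewrite (meanB (moderateM (moderateM mf mg) mk) (moderateM mf mdg)) -h addrK.
Qed.

(** Let u = f - g, which is 0 almost everywhere. Applying [poly_adjoint] to u and D_k u gives E((D_k
    u)^2) = E(u (Phi(k) D_k u - D_k D_k u)) = 0. *)
Lemma poly_diff_unique f Df g Dg k : poly_diff f Df -> poly_diff g Dg ->
  f = g %[ae P] -> Df k = Dg k %[ae P].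
Proof.
move=> pf pg fg.
have pu := poly_diffB pf pg; have [DD [pDD _]] := poly_diff_iter pu.
have mu := moderate_poly pu; have mdu := moderate_poly_deriv k pu.
have mk := moderate_Phi k; have mDD := moderate_poly_deriv k (pDD k).
have := poly_adjoint k pu (pDD k).
rewrite [RHS](mean_ae (g := fun=> 0)).
- have -> : E (fun=> 0) = 0 by rewrite /mean Rintegral_cst// mul0r.
  move=> /(mean_sqr_eq0 mdu); apply: filterS => w /= h /h.
  by rewrite mul0r add0r mulN1r => /eqP; rewrite subr_eq0 => /eqP.
- exact: moderateM mu (moderateB (moderateM mk mdu) mDD).
- exact: moderate_cst.
apply: filterS fg => w /= h wT; rewrite h//; ring.
Qed.

End gaussian_family.

(** * Annihilation and creation operators *)

Section representation.
Context {d} {T : measurableType d} {R : realType} {V : lmodType R}.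
Variables (P : probability T R) (dotV : {dot V for @idfun R}) (Phi : V -> T -> R).
Hypothesis mPhi : forall k, measurable_fun setT (Phi k).
Hypothesis Phi_linear : forall c k l,
  Phi (c *: k + l) = (fun w => c * Phi k w + Phi l w) %[ae P].
Hypothesis Phi_mgf : forall k,
  (\int[P]_w (expR (Phi k w))%:E = (expR (dotV k k / 2))%:E)%E.

Local Notation poly_diff := (poly_diff dotV Phi).
Local Notation H := (L2 P).
Local Open Scope quotient_scope.

Let dotC k l : dotV k l = dotV l k. Proof. exact: ccr_dotC. Qed.

Definition poly_domain : set H :=
  [set F | exists f Df, poly_diff f Df /\ L2_fun F = f %[ae P]].

Lemma L2_linE c (F G : H) f g : L2_fun F = f %[ae P] -> L2_fun G = g %[ae P] ->
  L2_fun (c *: F + G) = (fun w => c * f w + g w) %[ae P].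
Proof.
move=> Ff Gg; have h1 := L2_scaleE c F.
apply: filterS2 (filterI (L2_addE (c *: F) G) h1) (filterI Ff Gg).
by move=> w /= [e1 e2] [e3 e4] wT; rewrite e1// e2// e3// e4.
Qed.

Let poly_L2 f Df : poly_diff f Df -> exists F : H, L2_fun F = f %[ae P].
Proof. by move=> /(moderate_poly mPhi Phi_linear Phi_mgf)/moderate_sqint/sqint_L2. Qed.

(** Defined on all of [H] by choice: on polynomials [poly_diff_unique] makes the value independent
    of the representation, elsewhere it is 0. *)
Definition ann_op (k : V) (F : H) : H := xget 0 [set G : H | exists f Df,
  [/\ poly_diff f Df, L2_fun F = f %[ae P] & L2_fun G = Df k %[ae P]]].

Definition cre_op (k : V) (F : H) : H := xget 0 [set G : H | exists f Df,
  [/\ poly_diff f Df, L2_fun F = f %[ae P] &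
       L2_fun G = (fun w => Phi k w * f w + -1 * Df k w) %[ae P]]].

Lemma poly_diff_cre l f Df DDf : poly_diff f Df -> (forall k, poly_diff (Df k) (DDf k)) ->
  poly_diff (fun w => Phi l w * f w + -1 * Df l w)
    (fun k w => (dotV l k * f w + Phi l w * Df k w) + (0 * Df l w + -1 * DDf l k w)).
Proof.
move=> pf pDf; apply: poly_diff_add; last exact: poly_diffZ.
by apply: poly_diff_mul => //; exact: poly_diff_Phi.
Qed.

Let poly_unique f Df g Dg k (F : H) : poly_diff f Df -> poly_diff g Dg ->
  L2_fun F = f %[ae P] -> L2_fun F = g %[ae P] ->
  f = g %[ae P] /\ Df k = Dg k %[ae P].
Proof.
move=> pf pg Ff Fg; have fg : f = g %[ae P] := ae_eq_trans (ae_eq_sym Ff) Fg.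
by split=> //; exact: (poly_diff_unique mPhi Phi_linear Phi_mgf k pf pg).
Qed.

Lemma ann_opE k (F : H) f Df : poly_diff f Df -> L2_fun F = f %[ae P] ->
  L2_fun (ann_op k F) = Df k %[ae P].
Proof.
move=> pf Ff; have [DDf [pDf _]] := poly_diff_iter pf.
have [G Gf] := poly_L2 (pDf k).
have [|g [Dg [pg Fg e]]] := xgetPex (0 : H) (P := [set G : H | exists f Df,
  [/\ poly_diff f Df, L2_fun F = f %[ae P] & L2_fun G = Df k %[ae P]]]).
  by exists G, f, Df.
apply: ae_eq_trans e _; have [_ h] := poly_unique k pf pg Ff Fg.
exact: ae_eq_sym.
Qed.

Lemma cre_opE k (F : H) f Df : poly_diff f Df -> L2_fun F = f %[ae P] ->
  L2_fun (cre_op k F) = (fun w => Phi k w * f w + -1 * Df k w) %[ae P].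
Proof.
move=> pf Ff; have [DDf [pDf _]] := poly_diff_iter pf.
have [G Gf] := poly_L2 (poly_diff_cre k pf pDf).
have [|g [Dg [pg Fg e]]] := xgetPex (0 : H) (P := [set G : H | exists f Df,
  [/\ poly_diff f Df, L2_fun F = f %[ae P] &
       L2_fun G = (fun w => Phi k w * f w + -1 * Df k w) %[ae P]]]).
  by exists G, f, Df.
apply: ae_eq_trans e _; have [h1 h2] := poly_unique k pf pg Ff Fg.
by apply: filterS2 h1 h2 => w /= e1 e2 wT; rewrite e1// e2.
Qed.

Fixpoint rep_term (x : @ccr_term R V) : H -> H :=
  match x with
  | ccr_scal c => fun F => c *: F
  | ccr_ann k => ann_op k
  | ccr_cre k => cre_op k
  | ccr_add y z => fun F => rep_term y F + rep_term z F
  | ccr_mul y z => fun F => rep_term y (rep_term z F)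
  end.

Lemma poly_domain_lin c (F G : H) : poly_domain F -> poly_domain G -> poly_domain (c *: F + G).
Proof.
move=> [f [Df [pf Ff]]] [g [Dg [pg Gg]]].
exists (fun w => c * f w + g w), (fun k w => (0 * f w + c * Df k w) + Dg k w).
split; last exact: L2_linE.
by apply: poly_diff_add => //; exact: poly_diffZ.
Qed.

Lemma poly_domain0 : poly_domain 0.
Proof.
exists (fun=> 0), (fun _ _ => 0); split; first exact: poly_diff_cst.
have := L2_scaleE 0 (0 : H); rewrite scale0r; apply: filterS => w /= h /h.
by rewrite mul0r.
Qed.

Let ann_op_lin k c (F G : H) : poly_domain F -> poly_domain G ->
  ann_op k (c *: F + G) = c *: ann_op k F + ann_op k G.
Proof.
move=> [f [Df [pf Ff]]] [g [Dg [pg Gg]]]; apply: L2P.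
apply: ae_eq_trans (ann_opE k (poly_diff_add (poly_diffZ c pf) pg) (L2_linE c Ff Gg)) _.
apply: ae_eq_trans _ (ae_eq_sym (L2_linE c (ann_opE k pf Ff) (ann_opE k pg Gg))).
by apply: aeW => w _; ring.
Qed.

Let cre_op_lin k c (F G : H) : poly_domain F -> poly_domain G ->
  cre_op k (c *: F + G) = c *: cre_op k F + cre_op k G.
Proof.
move=> [f [Df [pf Ff]]] [g [Dg [pg Gg]]]; apply: L2P.
apply: ae_eq_trans (cre_opE k (poly_diff_add (poly_diffZ c pf) pg) (L2_linE c Ff Gg)) _.
apply: ae_eq_trans _ (ae_eq_sym (L2_linE c (cre_opE k pf Ff) (cre_opE k pg Gg))).
by apply: aeW => w _; ring.
Qed.

Lemma rep_term_end x : endomorphism poly_domain (rep_term x).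
Proof.
elim: x => [c|k|k|x [Dx Lx] y [Dy Ly]|x [Dx Lx] y [Dy Ly]] /=.
- split=> [F DF|e F G _ _].
    by rewrite -[c *: F]addr0; apply: poly_domain_lin => //; exact: poly_domain0.
  by rewrite scalerDr !scalerA mulrC.
- split=> [F [f [Df [pf Ff]]]|]; last exact: ann_op_lin.
  have [DDf [pDf _]] := poly_diff_iter pf.
  by exists (Df k), (DDf k); split => //; exact: (ann_opE k pf Ff).
- split=> [F [f [Df [pf Ff]]]|]; last exact: cre_op_lin.
  have [DDf [pDf _]] := poly_diff_iter pf.
  by do 2 eexists; split; [exact: (poly_diff_cre k pf pDf)|exact: (cre_opE k pf Ff)].
- split=> [F DF|c F G DF DG].
    by rewrite -[rep_term x F]scale1r; apply: poly_domain_lin; [exact: Dx|exact: Dy].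
  by rewrite Lx// Ly// scalerDr addrACA.
- split=> [F DF|c F G DF DG]; first by apply: Dx; exact: Dy.
  by rewrite Ly// Lx//; exact: Dy.
Qed.

Let rep_term_dom x F : poly_domain F -> poly_domain (rep_term x F).
Proof. by have [h _] := rep_term_end x; exact: h. Qed.

Let rep_termD x F G : poly_domain F -> poly_domain G ->
  rep_term x (F + G) = rep_term x F + rep_term x G.
Proof.
by move=> DF DG; have [_ /(_ 1 F G DF DG)] := rep_term_end x; rewrite !scale1r.
Qed.

Let rep_termZ x c F : poly_domain F -> rep_term x (c *: F) = c *: rep_term x F.
Proof.
move=> DF; have [_ lx] := rep_term_end x; have D0 := poly_domain0.
have x0 : rep_term x 0 = 0.
  have := rep_termD x D0 D0; rewrite addr0 => /eqP.
  by rewrite -subr_eq subrr => /eqP.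
by have := lx c F 0 DF D0; rewrite x0 !addr0.
Qed.

Let rep_ann_linear c k l F : poly_domain F ->
  ann_op (c *: k + l) F = c *: ann_op k F + ann_op l F.
Proof.
move=> [f [Df [pf Ff]]]; apply: L2P.
apply: ae_eq_trans (ann_opE _ pf Ff) _.
apply: ae_eq_trans _ (ae_eq_sym (L2_linE c (ann_opE k pf Ff) (ann_opE l pf Ff))).
by apply: aeW => w _; rewrite (poly_diff_linear_dir pf).
Qed.

Let rep_cre_linear c k l F : poly_domain F ->
  cre_op (c *: k + l) F = c *: cre_op k F + cre_op l F.
Proof.
move=> [f [Df [pf Ff]]]; apply: L2P.
apply: ae_eq_trans (cre_opE _ pf Ff) _.
apply: ae_eq_trans _ (ae_eq_sym (L2_linE c (cre_opE k pf Ff) (cre_opE l pf Ff))).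
apply: filterS (Phi_linear c k l) => w /= e wT.
by rewrite (poly_diff_linear_dir pf) e//; ring.
Qed.

Let rep_annC k l F : poly_domain F -> ann_op k (ann_op l F) = ann_op l (ann_op k F).
Proof.
move=> [f [Df [pf Ff]]]; have [DDf [pDf DDC]] := poly_diff_iter pf; apply: L2P.
apply: ae_eq_trans (ann_opE k (pDf l) (ann_opE l pf Ff)) _.
apply: ae_eq_trans _ (ae_eq_sym (ann_opE l (pDf k) (ann_opE k pf Ff))).
by apply: aeW => w _; rewrite DDC.
Qed.

Let rep_creC k l F : poly_domain F -> cre_op k (cre_op l F) = cre_op l (cre_op k F).
Proof.
move=> [f [Df [pf Ff]]]; have [DDf [pDf DDC]] := poly_diff_iter pf; apply: L2P.
apply: ae_eq_trans (cre_opE k (poly_diff_cre l pf pDf) (cre_opE l pf Ff)) _.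
apply: ae_eq_trans _ (ae_eq_sym (cre_opE l (poly_diff_cre k pf pDf) (cre_opE k pf Ff))).
by apply: aeW => w _; rewrite (DDC l k) (dotC l k); ring.
Qed.

(** Leibniz rule: differentiating Phi(l) f in the direction k gives the extra term <l, k> f, and the
    second derivatives commute. *)
Let rep_ann_cre k l F : poly_domain F ->
  ann_op k (cre_op l F) = cre_op l (ann_op k F) + dotV k l *: F.
Proof.
move=> [f [Df [pf Ff]]]; have [DDf [pDf DDC]] := poly_diff_iter pf; apply: L2P.
rewrite addrC.
apply: ae_eq_trans (ann_opE k (poly_diff_cre l pf pDf) (cre_opE l pf Ff)) _.
apply: ae_eq_trans _ (ae_eq_sym (L2_linE _ Ff (cre_opE l (pDf k) (ann_opE k pf Ff)))).
by apply: aeW => w _; rewrite (DDC l k) (dotC l k); ring.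
Qed.

(** Restricted to the domain, because distributivity, the centrality of scalars and congruence of
    products rely on the operators being linear there and preserving it. *)
Lemma rep_term_eq x y : ccr_eq dotV x y -> forall F, poly_domain F ->
  rep_term x F = rep_term y F.
Proof.
elim=> {x y} //=.
- by move=> x y _ IH F DF; rewrite IH.
- by move=> y x z _ IH1 _ IH2 F DF; rewrite IH1// IH2.
- by move=> x x' y y' _ IH1 _ IH2 F DF; rewrite IH1// IH2.
- by move=> x x' y y' _ IH1 _ IH2 F DF; rewrite IH2// IH1//; exact: rep_term_dom.
- by move=> x y z F _; rewrite addrA.
- by move=> x y F _; rewrite addrC.
- by move=> x F _; rewrite scale0r add0r.
- by move=> x F _; rewrite !scale0r.
- by move=> x F _; rewrite scale1r.
- by move=> x y z F DF; rewrite rep_termD//; exact: rep_term_dom.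
- by move=> c e F _; rewrite scalerDl.
- by move=> c e F _; rewrite scalerA.
- by move=> c x F DF; rewrite rep_termZ.
Qed.

Let mod f Df : poly_diff f Df -> moderate P f.
Proof. exact: moderate_poly mPhi Phi_linear Phi_mgf _ _. Qed.

Let L2_dot_mean (F G : H) f Df g Dg : poly_diff f Df -> poly_diff g Dg ->
  L2_fun F = f %[ae P] -> L2_fun G = g %[ae P] ->
  L2_dot P F G = mean P (fun w => f w * g w).
Proof.
move=> pf pg Ff Gg; congr fine; apply: ae_eq_integral => //.
- by have /integrableP[] := L2_integrable F G.
- by have [mfg _] := moderateM (mod pf) (mod pg); exact/measurable_EFinP.
- by apply: filterS2 Ff Gg => w /= h1 h2 wT; rewrite h1// h2.
Qed.

Let adjoint_ann k (F G : H) : poly_domain F -> poly_domain G ->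
  L2_dot P (ann_op k F) G = L2_dot P F (cre_op k G).
Proof.
move=> [f [Df [pf Ff]]] [g [Dg [pg Gg]]].
have [DDf [pDf _]] := poly_diff_iter pf; have [DDg [pDg _]] := poly_diff_iter pg.
rewrite (L2_dot_mean (pDf k) pg (ann_opE k pf Ff) Gg).
rewrite (L2_dot_mean pf (poly_diff_cre k pg pDg) Ff (cre_opE k pg Gg)).
rewrite (poly_adjoint mPhi Phi_linear Phi_mgf k pf pg); apply: eq_mean => w.
by rewrite mulN1r.
Qed.

Lemma rep_term_star x (G : H) : poly_domain G ->
  adjoint_at (L2_dot P) poly_domain (rep_term x) G (rep_term (ccr_term_star x) G).
Proof.
have lin c (F F' K : H) : L2_dot P (c *: F + F') K = c * L2_dot P F K + L2_dot P F' K.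
  exact: L2_dot_linear.
have dotD (F F' K : H) : L2_dot P (F + F') K = L2_dot P F K + L2_dot P F' K.
  by rewrite -[F]scale1r lin mul1r scale1r.
have dot0 (K : H) : L2_dot P 0 K = 0.
  by have := dotD 0 0 K; rewrite addr0 => /eqP; rewrite -subr_eq subrr => /eqP.
have dotZ c (F K : H) : L2_dot P (c *: F) K = c * L2_dot P F K.
  by rewrite -[c *: F]addr0 lin dot0 addr0.
elim: x G => [c|k|k|x IHx y IHy|x IHx y IHy] G DG F DF /=.
- by rewrite dotZ [RHS]L2_dotC dotZ L2_dotC.
- exact: adjoint_ann.
- by rewrite L2_dotC -adjoint_ann// L2_dotC.
- rewrite dotD [RHS]L2_dotC dotD; congr (_ + _); rewrite [RHS]L2_dotC.
    exact: IHx.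
  exact: IHy.
- rewrite IHx//; last exact: rep_term_dom.
  by rewrite IHy//; exact: rep_term_dom.
Qed.

(** Evaluates a chosen representative; [rep_term_eq] makes the choice irrelevant on the domain. *)
Definition poly_rep (x : CCR dotV) (F : H) : H := rep_term (repr x) F.

Lemma poly_rep_pi (x : @ccr_term R V) F : poly_domain F ->
  poly_rep (\pi_(CCR dotV) x) F = rep_term x F.
Proof. by move=> DF; apply: rep_term_eq => //; exact: ccr_repr_eq. Qed.

Lemma poly_star_representation : dense_subspace (L2_dot P) poly_domain ->
  star_representation (L2_dot P) poly_domain poly_rep.
Proof.
move=> dD; split => //.
- exact: L2_hilbert_space.
- by move=> x; exact: rep_term_end.
- move=> c x y F DF.
  have -> : c *: x + y =
      \pi_(CCR dotV) (ccr_add (ccr_mul (ccr_scal c) (repr x)) (repr y)).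
    by rewrite ccr_piD ccr_piM ccr_pi_scal !reprK -ccr_scalerAl mul1r.
  by rewrite poly_rep_pi.
- move=> F DF; have -> : 1 = \pi_(CCR dotV) (ccr_scal 1) by rewrite ccr_pi_scal scale1r.
  by rewrite poly_rep_pi//=; exact: scale1r.
- move=> x y F DF.
  have -> : x * y = \pi_(CCR dotV) (ccr_mul (repr x) (repr y)) by rewrite ccr_piM !reprK.
  by rewrite poly_rep_pi.
- move=> x G DG; rewrite -[ccr_star x]/(\pi_(CCR dotV) (ccr_term_star (repr x))).
  rewrite poly_rep_pi//; exact: rep_term_star.
Qed.

Lemma poly_rep_annihilation k (F : H) f Df : poly_diff f Df -> L2_fun F = f %[ae P] ->
  L2_fun (poly_rep (annihilation dotV k) F) = Df k %[ae P].
Proof.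
move=> pf Ff; rewrite poly_rep_pi; first exact: (ann_opE k pf Ff).
by exists f, Df.
Qed.

End representation.

(** * Density of the polynomials *)

Section sign_iteration.
Context {R : realType}.
Implicit Types u : R.

(* Newton's iteration for 1 / u ^ 2 = 1, which involves no division. *)
Definition sign_step u : R := u * (3 - u ^+ 2) / 2.

Lemma sign_stepN u : sign_step (- u) = - sign_step u.
Proof. by rewrite /sign_step sqrrN; lra. Qed.

Lemma iter_sign_stepN n u : iter n sign_step (- u) = - iter n sign_step u.
Proof. by elim: n => //= n ->; rewrite sign_stepN. Qed.

(** One step multiplies 1 - v by 1 - v/2 - v^2/2. As the iterates never fall below u, this factor is
    at most 1 - u/2. *)
Lemma iter_sign_step_ge n u : 0 <= u <= 1 ->
  u <= iter n sign_step u <= 1 /\ 1 - iter n sign_step u <= (1 - u / 2) ^+ n.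
Proof.
move=> /andP[u0 u1]; elim: n => [|n [/andP[IH1 IH2] IH3]] /=.
  by rewrite lexx u1 expr0; split=> //; lra.
set v := iter n sign_step u in IH1 IH2 IH3 *.
have v0 : 0 <= v by exact: le_trans IH1.
have vv : v ^+ 2 <= v by rewrite expr2 ler_piMl.
have vv1 : 0 <= 1 - v by lra.
have fv : 1 - sign_step v = (1 - v) * (1 - v / 2 - v ^+ 2 / 2).
  by rewrite /sign_step; field.
split.
  apply/andP; split.
    rewrite /sign_step; apply: le_trans IH1 _.
    by rewrite -subr_ge0 (_ : _ - _ = v * (1 - v ^+ 2) / 2); [rewrite divr_ge0// mulr_ge0// subr_ge0 (le_trans vv)|field].
  rewrite -subr_ge0 fv mulr_ge0//; lra.
rewrite fv [leRHS]exprSr; apply: le_trans (_ : (1 - v) * (1 - u / 2) <= _).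
  by apply: ler_wpM2l => //; have := sqr_ge0 v; lra.
by apply: ler_wpM2r => //; lra.
Qed.

Lemma cvg_iter_sign_step u : `|u| <= 1 ->
  iter n sign_step u @[n --> \oo] --> Num.sg u.
Proof.
have pos v : 0 < v -> v <= 1 -> iter n sign_step v @[n --> \oo] --> (1 : R).
  move=> v0 v1; have b n : (1 : R) - (1 - v / 2) ^+ n <= iter n sign_step v <= 1.
    have [|/andP[_ ->] h] := @iter_sign_step_ge n v; first by rewrite v1 ltW.
    by rewrite andbT; lra.
  apply: (@squeeze_cvgr _ _ _ _ (fun n => 1 - (1 - v / 2) ^+ n) (fun=> 1)).
  - by apply: nearW => n; exact: b.
  - rewrite -[X in _ --> X]subr0; apply: cvgB; first exact: cvg_cst.
    by apply: cvg_expr; rewrite ger0_norm; lra.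
  - exact: cvg_cst.
have [u0|u0|->] := ltgtP u 0.
- rewrite ltr0_norm// ltr0_sg// => u1.
  have /(_ _) h := pos (- u); rewrite -(opprK u).
  under eq_fun do rewrite iter_sign_stepN.
  by apply: cvgN; apply: h => //; rewrite oppr_gt0.
- by rewrite gtr0_norm// gtr0_sg// => /(pos _ u0).
- rewrite sgr0 => _; apply: cvg_near_cst; apply: nearW => n.
  by elim: n => //= n ->; rewrite /sign_step mul0r mul0r.
Qed.

Lemma iter_sign_step_bound n u : `|u| <= 1 -> `|iter n sign_step u| <= 1.
Proof.
have pos v : 0 <= v -> v <= 1 -> `|iter n sign_step v| <= 1.
  move=> v0 v1; have [|/andP[h1 h2] _] := @iter_sign_step_ge n v; first by rewrite v0.
  by rewrite ger0_norm//; exact: le_trans h1.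
have [u0|u0] := leP 0 u; first by rewrite ger0_norm//; exact: pos.
rewrite ltr0_norm// => u1; rewrite -(opprK u) iter_sign_stepN normrN.
by apply: pos => //; rewrite oppr_ge0 ltW.
Qed.

End sign_iteration.

Section sign_multiplier.
Context {d} {T : measurableType d} {R : realType}.
Variables (mu : {measure set T -> \bar R}) (C : set (T -> R)).
Hypothesis cC : closed_subspace mu C.

(** Every iterate is a polynomial in S, hence a multiplier, and the iterates stay in [-1, 1]. *)
Lemma multiplier_sg S : (forall x, `|S x| <= 1) -> multiplier C S ->
  multiplier C (fun x => Num.sg (S x)).
Proof.
move=> bS mS; apply: (multiplier_cvg cC (phi_ := fun n x => iter n sign_step (S x)) (K := 1)).
- elim=> [//|n IH].
  exact: multiplierM (multiplierM IH (multiplierBl cC 3 (multiplierX cC 2 IH))) (multiplier_cst cC 2^-1).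
- by move=> n x; exact: iter_sign_step_bound.
- by move=> x; exact: cvg_iter_sign_step.
Qed.

(** The indicator of {S > 0} is (sg S + (sg S)^2) / 2. *)
Lemma multiplier_set_gt0 S : (forall x, `|S x| <= 1) -> multiplier C S ->
  multiplier_set C [set x | 0 < S x].
Proof.
move=> bS /(multiplier_sg bS) mS; rewrite /multiplier_set/=.
have := multiplierM (multiplierD cC mS (multiplierX cC 2 mS)) (multiplier_cst cC 2^-1).
congr multiplier; apply/funext => x; rewrite indicE.
have [S0|S0|S0] := ltgtP (S x) 0.
- by rewrite ltr0_sg// memNset/= ?ltNge ?ltW//; lra.
- by rewrite gtr0_sg// mem_set//=; lra.
- by rewrite S0 sgr0 memNset/= ?S0 ?ltxx//; lra.
Qed.

End sign_multiplier.

Section series_bounds.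
Context {R : realType}.

Lemma series_sin_coeff_le (x : R) n : `|series (sin_coeff x) n| <= expR `|x|.
Proof.
apply: le_trans (_ : series (exp_coeff `|x|) n <= _).
  apply: le_trans (ler_norm_sum _ _ _) _; apply: ler_sum => i _.
  rewrite /exp_coeff /sin_coeff /=.
  rewrite !normrM normfV !normr_nat !normrX normrN normr1 expr1n mulr1.
  by case: odd; [rewrite mul1r| rewrite !mul0r ?divr_ge0].
apply: nondecreasing_cvgn_le; last exact: is_cvg_series_exp_coeff.
by apply: nondecreasing_series => i _ _; exact: exp_coeff_ge0.
Qed.

Lemma cvg_series_sin (x : R) : series (sin_coeff x) @ \oo --> sin x.
Proof. by rewrite unlock; exact: is_cvg_series_sin_coeff. Qed.

End series_bounds.

Section gaussian_density.
Context {d} {T : measurableType d} {R : realType} {V : lmodType R}.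
Variables (P : probability T R) (dotV : {dot V for @idfun R}) (Phi : V -> T -> R).
Hypothesis mPhi : forall k, measurable_fun setT (Phi k).
Hypothesis Phi_linear : forall c k l,
  Phi (c *: k + l) = (fun w => c * Phi k w + Phi l w) %[ae P].
Hypothesis Phi_mgf : forall k,
  (\int[P]_w (expR (Phi k w))%:E = (expR (dotV k k / 2))%:E)%E.

Local Notation poly_diff := (poly_diff dotV Phi).

Definition gaussian_poly : set (T -> R) := [set f | exists Df, poly_diff f Df].

Local Notation C := (L2_closure P gaussian_poly).

Lemma gaussian_polyD f g : gaussian_poly f -> gaussian_poly g ->
  gaussian_poly (fun w => f w + g w).
Proof. by move=> [Df pf] [Dg pg]; eexists; exact: poly_diff_add pf pg. Qed.

Lemma gaussian_polyM f g : gaussian_poly f -> gaussian_poly g ->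
  gaussian_poly (fun w => f w * g w).
Proof. by move=> [Df pf] [Dg pg]; eexists; exact: poly_diff_mul pf pg. Qed.

Lemma gaussian_poly_cst c : gaussian_poly (fun=> c).
Proof. by eexists; exact: poly_diff_cst. Qed.

Lemma gaussian_polyX f n : gaussian_poly f -> gaussian_poly (fun w => f w ^+ n).
Proof.
move=> pf; elim: n => [|n IH]; first exact: gaussian_poly_cst.
by under eq_fun do rewrite exprS; exact: gaussian_polyM.
Qed.

Lemma gaussian_poly_subspace : subspace P gaussian_poly.
Proof.
split; first exact: gaussian_poly_cst.
- by move=> f [Df /(moderate_poly mPhi Phi_linear Phi_mgf)/moderate_sqint].
- move=> c f g pf pg; apply: gaussian_polyD => //.
  by apply: gaussian_polyM => //; exact: gaussian_poly_cst.
Qed.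

Let cC : closed_subspace P C := L2_closure_closed gaussian_poly_subspace.

(* The partial sums of the sine series of Y are dominated by exp |Y|, which has
   moments of all orders. *)
Lemma multiplier_sin c b h : multiplier C (fun w => sin (c * Phi h w + b)).
Proof.
have mY : measurable_fun setT (fun w => c * Phi h w + b).
  by apply: measurable_funD => //; exact: measurable_funM.
have mS : measurable_fun setT (fun w => sin (c * Phi h w + b)).
  apply: measurableT_comp => //; apply: continuous_measurable_fun; exact: continuous_sin.
apply: (multiplier_closure gaussian_poly_subspace mS (K := 1)).
  by move=> w; exact: sin_max.
move=> f [Df pf]; have mf := moderate_poly mPhi Phi_linear Phi_mgf pf.
(* The majorant uses exp |y| <= exp y + exp (-y) with y = c Phi(h), which brings it back to moderate
   functions. *)
have me := moderateM (moderateZ (expR `|b|) (moderateD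
  (moderate_expR mPhi Phi_linear Phi_mgf c h)
  (moderate_expR mPhi Phi_linear Phi_mgf (- c) h))) (moderate_norm mf).
apply: (closed_dominated cC (f_ := fun n w => series (sin_coeff (c * Phi h w + b)) n * f w)
  _ _ (moderate_sqint me)).
- move=> n; apply: sub_L2_closure; first exact: gaussian_poly_subspace.
  apply: gaussian_polyM; last by exists Df.
  rewrite /series/=; elim: n => [|n IH].
    by under eq_fun do rewrite big_geq//; exact: gaussian_poly_cst.
  under eq_fun do rewrite big_nat_recr//=.
  apply: gaussian_polyD => //.
  apply: gaussian_polyM; last exact: gaussian_poly_cst.
  apply: gaussian_polyM; first exact: gaussian_poly_cst.
  apply: gaussian_polyX; apply: gaussian_polyD; last exact: gaussian_poly_cst.
  apply: gaussian_polyM; first exact: gaussian_poly_cst.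
  by eexists; exact: poly_diff_Phi.
- by apply: measurable_funM => //; case: mf.
- apply: aeW => w; apply: cvgM; last exact: cvg_cst.
  exact: cvg_series_sin.
- apply: aeW => w n; rewrite normrM ler_wpM2r//.
  apply: le_trans (series_sin_coeff_le _ _) _.
  apply: le_trans (_ : expR (`|b| + `|c * Phi h w|) <= _).
    by rewrite ler_expR addrC ler_normD.
  rewrite expRD ler_wpM2l ?expR_ge0// mulNr.
  have [p|p] := lerP 0 (c * Phi h w); first by rewrite (ger0_norm p) lerDl expR_ge0.
  by rewrite (ltr0_norm p) lerDr expR_ge0.
Qed.

(** The sine of (Phi(h) - b) / (n + 1) has the sign of Phi(h) - b once the argument is below 2 in
    absolute value, which holds at each point for large n. *)
Lemma multiplier_set_ray h b : multiplier_set C [set w | b < Phi h w].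
Proof.
pose Y n w := n.+1%:R^-1 * Phi h w + - (n.+1%:R^-1 * b).
have YE n w : Y n w = n.+1%:R^-1 * (Phi h w - b) by rewrite /Y mulrBr.
apply: (multiplier_cvg cC (phi_ := fun n => \1_[set w | 0 < sin (Y n w)]) (K := 1)).
- move=> n; apply: (multiplier_set_gt0 cC); last exact: multiplier_sin.
  by move=> w; exact: sin_max.
- by move=> n w; rewrite indicE; case: (_ \in _); rewrite ?normr1 ?normr0.
- move=> w; apply: cvg_near_cst; near=> n; rewrite !indicE.
  have n2 : `|Y n w| < 2.
    rewrite YE normrM gtr0_norm ?invr_gt0// mulrC ltr_pdivrMr//.
    have : `|Phi h w - b| <= n%:R by near: n; exact: nbhs_infty_ger.
    by rewrite -natr1; have := ler0n R n; lra.
  congr (nat_of_bool _)%:R; apply/idP/idP; rewrite !inE/=.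
    rewrite !ltNge; apply: contra => Phib.
    have Yn : Y n w <= 0 by rewrite YE mulr_ge0_le0 ?invr_ge0// subr_le0.
    rewrite -[Y n w]opprK sinN oppr_le0.
    have [->|Y0] := eqVneq (Y n w) 0; first by rewrite oppr0 sin0.
    apply: ltW; apply: sin2_gt0; rewrite oppr_gt0 lt_neqAle Y0 Yn/=.
    by rewrite -(ler0_norm Yn).
  move=> Phib; have Yn : 0 < Y n w by rewrite YE mulr_gt0 ?invr_gt0// subr_gt0.
  by apply: sin2_gt0; rewrite Yn/= -(gtr0_norm Yn).
Unshelve. all: by end_near. Qed.

Lemma multiplier_set_preimage h (B : set R) : measurable B ->
  multiplier_set C (Phi h @^-1` B).
Proof.
move=> mB.
have : (@RGenOInfty.G R).-sigma.-measurable B by rewrite -RGenOInfty.measurableE.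
have [s0 sD sU] := multiplier_sigma_algebra cC.
apply: (smallest_sub (X := [set B | multiplier_set C (Phi h @^-1` B)])).
  split=> /=.
  - by rewrite preimage_set0.
  - by move=> A /sD; rewrite !setTD preimage_setC.
  - by move=> A mA; rewrite preimage_bigcup; exact: sU.
move=> _ [b ->] /=; have := multiplier_set_ray h b.
by congr multiplier_set; apply/seteqP; split=> w; rewrite /= in_itv/= andbT.
Qed.

Lemma gaussian_poly_dense :
  (forall A, measurable A -> multiplier_set C A) ->
  dense_subspace (L2_dot P) (poly_domain (P := P) dotV Phi).
Proof.
move=> mA; split.
  by split; [exact: poly_domain0 | move=> c F G; exact: poly_domain_lin].
move=> F e e0.
have [_ /(_ e e0)[f pf Ff]] : C (L2_fun F).
  apply: (multiplier_dense cC mA (E := fun=> setT)) => //; last exact: L2_sqint.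
  - move=> n; apply: sub_L2_closure; first exact: gaussian_poly_subspace.
    by rewrite indicT; exact: gaussian_poly_cst.
  - by apply: aeW => w; apply: nearW.
have sf := subspace_sqint gaussian_poly_subspace pf.
have [G Gf] := sqint_L2 sf; have [Df pDf] := pf.
exists G; first by exists f, Df.
rewrite -lte_fin energy_L2_subE; apply: le_lt_trans Ff.
rewrite le_eqVlt; apply/orP; left; apply/eqP; apply: ae_energy.
- by apply: measurable_funB; exact: L2_measurable.
- by apply: measurable_funB; [exact: L2_measurable | case: sf].
- by apply: filterS Gf => w /= h _; rewrite h.
Qed.

End gaussian_density.

(** * Polynomials in several variables *)

Import (canonicals) mpoly.

Definition mpoly_fun {T V : Type} {R : comNzRingType} (Phi : V -> T -> R) n
    (h : 'I_n -> V) (p : mpoly.mpoly n R) (w : T) : R :=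
  mpoly.meval (fun j => Phi (h j) w) p.

(** Induction along constants, variables, sums and products, to match the constructors of
    [poly_diff]. *)
Lemma mpoly_ind_ring (R : comNzRingType) n (Q : mpoly.mpoly n R -> Prop) :
  (forall c, Q (mpoly.mpolyC n c)) -> (forall i, Q (mpoly.mpolyX R (mpoly.mnm1 i))) ->
  (forall p q, Q p -> Q q -> Q (p + q)) -> (forall p q, Q p -> Q q -> Q (p * q)) ->
  forall p, Q p.
Proof.
move=> QC QX QD QM; have QX1 : Q 1 by rewrite -mpoly.mpolyC1.
apply: mpoly.mpolyind; first by rewrite -(mpoly.mpolyC0 n R).
move=> c m p _ _ Qp; apply: QD => //.
rewrite -mpoly.mul_mpolyC; apply: (QM) => //; rewrite mpoly.mpolyXE_id.
apply: (big_ind Q QX1 QM) => i _.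
by elim: (mpoly.fun_of_multinom m i) => [//|k IH]; rewrite exprS; exact: QM.
Qed.

Lemma L2_dot_suml d (T : measurableType d) (R : realType)
    (mu : {measure set T -> \bar R}) n (c : 'I_n -> R) (f : 'I_n -> L2 mu) (g : L2 mu) :
  L2_dot mu (\sum_(j < n) c j *: f j) g = \sum_(j < n) c j * L2_dot mu (f j) g.
Proof.
elim/big_rec2: _ => [|j y x _ <-]; last by rewrite L2_dot_linear.
by have := L2_dot_linear (-1) 0 0 g; rewrite scaler0 addr0 mulN1r addNr.
Qed.

Section polynomial_functionals.
Context {d} {T : measurableType d} {R : realType} {V : lmodType R}.
Variables (dotV : {dot V for @idfun R}) (Phi : V -> T -> R).

Local Notation poly_diff := (poly_diff dotV Phi).

(** The derivative on the right is the Malliavin derivative paired with k, so independence of the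
    representation carries over from [poly_diff_unique]. *)
Lemma poly_diff_mpoly n (h : 'I_n -> V) (p : mpoly.mpoly n R) :
  poly_diff (mpoly_fun Phi h p)
    (fun k w => \sum_(j < n) mpoly_fun Phi h (mpoly.mderiv j p) w * dotV (h j) k).
Proof.
have ext f Df g Dg : poly_diff f Df -> f =1 g -> Df =2 Dg -> poly_diff g Dg.
  move=> fDf /funext <- fg; rewrite (_ : Dg = Df)//.
  by apply/funext => k; apply/funext => w.
elim/mpoly_ind_ring: p => [c|i|p q IHp IHq|p q IHp IHq].
- apply: (ext _ _ _ _ (poly_diff_cst dotV Phi c)) => [w|k w].
    by rewrite /mpoly_fun mpoly.mevalC.
  by rewrite big1// => j _; rewrite mpoly.mderivC /mpoly_fun mpoly.meval0 mul0r.
- apply: (ext _ _ _ _ (poly_diff_Phi dotV Phi (h i))) => [w|k w].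
    by rewrite /mpoly_fun mpoly.mevalXU.
  rewrite (bigD1 i)//= big1 => [|j ji].
    rewrite mpoly.mderivX mpoly.mnm1E eqxx scale1r /mpoly_fun mpoly.mevalX.
    rewrite big1 ?mul1r ?addr0// => j _.
    by rewrite mpoly.mnmBE subnn expr0.
  by rewrite mpoly.mderivX mpoly.mnm1E eq_sym (negPf ji) scale0r /mpoly_fun mpoly.meval0 mul0r.
- apply: (ext _ _ _ _ (poly_diff_add IHp IHq)) => [w|k w].
    by rewrite /mpoly_fun mpoly.mevalD.
  rewrite -big_split; apply: eq_bigr => j _.
  by rewrite mpoly.mderivD /mpoly_fun mpoly.mevalD mulrDl.
- apply: (ext _ _ _ _ (poly_diff_mul IHp IHq)) => [w|k w].
    by rewrite /mpoly_fun mpoly.mevalM.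
  rewrite mulr_suml mulr_sumr -big_split; apply: eq_bigr => j _.
  rewrite mpoly.mderivM /mpoly_fun mpoly.mevalD !mpoly.mevalM /=; ring.
Qed.

Lemma mpoly_fun_lift n m (h : 'I_n -> V) (g : 'I_m -> V) (f : 'I_n -> 'I_m) p :
  (forall i, g (f i) = h i) -> exists q, mpoly_fun Phi h p = mpoly_fun Phi g q.
Proof.
move=> gf; exists (mpoly.comp_mpoly [tuple mpoly.mpolyX R (mpoly.mnm1 (f i)) | i < n] p).
apply/funext => w; rewrite /mpoly_fun mpoly.comp_mpoly_meval.
by apply: mpoly.meval_eq => i; rewrite tnth_mktuple mpoly.mevalXU gf.
Qed.

(** Concatenating the two families gives common variables, in which sums and products of functionals
    become sums and products of polynomials. *)
Lemma mpoly_fun2 n m (h : 'I_n -> V) (g : 'I_m -> V) p q :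
  exists (l : 'I_(n + m) -> V) p' q',
    mpoly_fun Phi h p = mpoly_fun Phi l p' /\ mpoly_fun Phi g q = mpoly_fun Phi l q'.
Proof.
pose l (i : 'I_(n + m)) := match fintype.split i with inl j => h j | inr j => g j end.
have [|p' ->] := @mpoly_fun_lift n _ h l (@lshift n m) p.
  by move=> i; rewrite /l -[lshift m i]/(unsplit (inl i)) unsplitK.
have [|q' ->] := @mpoly_fun_lift m _ g l (@rshift n m) q.
  by move=> i; rewrite /l -[rshift n i]/(unsplit (inr i)) unsplitK.
by exists l, p', q'.
Qed.

Lemma mpoly_poly_diff f Df : poly_diff f Df ->
  exists n (h : 'I_n -> V) p, f = mpoly_fun Phi h p.
Proof.
elim=> {f Df} [c|h|f Df g Dg _ [n [h [p ->]]] _ [m [h' [q ->]]]|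
                   f Df g Dg _ [n [h [p ->]]] _ [m [h' [q ->]]]].
- exists 0%N, (fun=> 0), (mpoly.mpolyC 0 c).
  by apply/funext => w; rewrite /mpoly_fun mpoly.mevalC.
- exists 1%N, (fun=> h), (mpoly.mpolyX R (mpoly.mnm1 ord0)).
  by apply/funext => w; rewrite /mpoly_fun mpoly.mevalXU.
- have [l [p' [q' [-> ->]]]] := mpoly_fun2 h h' p q.
  exists (n + m)%N, l, (p' + q'); apply/funext => w.
  by rewrite /mpoly_fun mpoly.mevalD.
- have [l [p' [q' [-> ->]]]] := mpoly_fun2 h h' p q.
  exists (n + m)%N, l, (p' * q'); apply/funext => w.
  by rewrite /mpoly_fun mpoly.mevalM.
Qed.

End polynomial_functionals.

(** * Application to the Wiener space *)

Section wiener_density.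
Context {R : realType} (P : probability (wiener_space R) R).
Hypothesis hP : is_wiener_measure P.

Local Notation LL := (L2 (halfline_measure R)).
Local Notation dotL := (L2_dot (halfline_measure R)).

Definition wiener_fun (k : LL) : wiener_space R -> R := L2_fun (wiener_integral P k).

Lemma measurable_wiener_fun k : measurable_fun setT (wiener_fun k).
Proof. exact: L2_measurable. Qed.

Lemma wiener_fun_linear c k l :
  wiener_fun (c *: k + l) = (fun w => c * wiener_fun k w + wiener_fun l w) %[ae P].
Proof.
by rewrite /wiener_fun wiener_integral_linear//; apply: L2_linE; exact: ae_eq_refl.
Qed.

Lemma wiener_fun_mgf k :
  (\int[P]_w (expR (wiener_fun k w))%:E = (expR (dotL k k / 2))%:E)%E.
Proof. exact: wiener_integral_mgf. Qed.

Let wpoly_subspace := gaussian_poly_subspace measurable_wiener_fun wiener_fun_linear wiener_fun_mgf.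
Let C := L2_closure P (gaussian_poly dotL wiener_fun).

(** The coordinates generate the sigma-algebra, and each agrees almost everywhere with some Phi(k);
    modifying an indicator on a null set preserves the multiplier property. *)
Lemma wiener_multiplier_set (A : set (wiener_space R)) : measurable A -> multiplier_set C A.
Proof.
have cC := L2_closure_closed wpoly_subspace.
apply: smallest_sub; first exact: multiplier_sigma_algebra cC.
move=> _ [t [B [mB ->]]].
have [k tk] := wiener_integral_coordinate hP t.
have mt : measurable (coordinate t @^-1` B : set (wiener_space R)).
  by apply: sub_sigma_algebra; exists t, B.
apply: (multiplier_ae cC _ (K := 1) _ _ (multiplier_set_preimage measurable_wiener_fun
  wiener_fun_linear wiener_fun_mgf k mB)).
- exact: measurable_indic.
- by move=> w; rewrite indicE; case: (_ \in _); rewrite ?normr1 ?normr0.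
- apply: (ae_imply tk) => w /= {}tk _; rewrite !indicE; congr (nat_of_bool _)%:R.
  by apply/idP/idP; rewrite !inE/= tk.
Qed.

Lemma wiener_poly_dense : dense_subspace (L2_dot P) (poly_domain (P := P) dotL wiener_fun).
Proof.
exact: (gaussian_poly_dense measurable_wiener_fun wiener_fun_linear wiener_fun_mgf
  wiener_multiplier_set).
Qed.

Lemma polynomial_domainE : polynomial_domain P = poly_domain (P := P) dotL wiener_fun.
Proof.
apply/seteqP; split=> F.
  by move=> [n [h [p Fp]]]; eexists; eexists; split; [exact: (poly_diff_mpoly dotL wiener_fun h p)|exact: Fp].
by move=> [f [Df [/mpoly_poly_diff[n [h [p ->]]] Fp]]]; exists n, h, p.
Qed.

End wiener_density.

Theorem theorem4p1 (R : realType) (P : probability (wiener_space R) R)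
    (hP : is_wiener_measure P) :
  (forall (n : nat) (h : 'I_n -> L2 (halfline_measure R))
      (p : mpoly.mpoly n R),
    poly_functional P h p \in Lfun P 2%:E) /\
  exists pi : CCR (L2_dot (halfline_measure R)) -> L2 P -> L2 P,
    star_representation (L2_dot P) (polynomial_domain P) pi /\
    forall (k : L2 (halfline_measure R)) (F : L2 P)
        (TF : wiener_space R -> L2 (halfline_measure R)),
      is_malliavin_derivative F TF ->
      L2_fun (pi (annihilation (L2_dot (halfline_measure R)) k) F) =
        (fun w => L2_dot (halfline_measure R) (TF w) k) %[ae P].
Proof.
have m := @measurable_wiener_fun R P; have l := wiener_fun_linear hP.
have g := wiener_fun_mgf hP.
split=> [n h p|].
  apply/sqintP/moderate_sqint/(moderate_poly m l g).
  exact: (poly_diff_mpoly (L2_dot (halfline_measure R)) (wiener_fun P) h p).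
exists (poly_rep (P := P) (wiener_fun P)); split=> [|k F TF [n [h [p [Fp ->]]]]].
  rewrite polynomial_domainE; exact: poly_star_representation m l g (wiener_poly_dense hP).
apply: ae_eq_trans (poly_rep_annihilation m l g k
  (poly_diff_mpoly (L2_dot (halfline_measure R)) (wiener_fun P) h p) Fp) _.
apply: aeW => w _; exact/esym/L2_dot_suml.
Qed.
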